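(* Let $\kappa$ be a finite field, $n\ge1$, and let $\chi_i:\kappa^\times\to\mathbb{C}^\times$ be a multiplicative character of order $d_i$. Let $F_i\in\kappa(x_1,\dots,x_n)$ be a $d_i$th-power-free rational function such that $T_{F_i}:=\{m\in\overline{\kappa}^n\mid F_i(x)\equiv F_i(x+m)\}$ is finite. Let $s\in\mathbb{N}$, and for a finite extension $k/\kappa$ and $\mathbf{m}=(m^{(1)},\dots,m^{(2s)})\in k^{n\cdot2s}$ put \[F_{\mathbf{m}}(x):=\prod_{j=1}^sF_i(m^{(j)}+x)\prod_{j=s+1}^{2s}F_i(m^{(j)}+x)^{-1}\in k(x_1,\dots,x_n).\] (a) The number of $\mathbf{m}\in k^{n\cdot2s}$ such that $F_{\mathbf{m}}$ is a perfect $d_i$th power in $\overline{k}(x_1,\dots,x_n)$ is $O((\#k)^{ns})$ as $k$ varies over finite extensions of $\kappa$. (b) If $F_{\mathbf{m}}\in k(x_1,\dots,x_n)$ is not a perfect $d_i$th power in $\overline{k}(x_1,\dots,x_n)$, then \[T_{i,k}(m^{(1)},\dots,m^{(2s)}):=\sum_{x\in k^n}\chi_i\circ\mathrm{N}_{k/\kappa}(F_{\mathbf{m}}(x))=O((\#k)^{n-1/2})\] as $k$ varies over finite extensions of $\kappa$ (with implied constant independent of $k$ and of $\mathbf{m}$).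
   Context: Multiplicative characters are extended by $\chi(0)=0$. A rational function $F$ is thought of as a quotient $G/H$ of two fixed polynomials, and $\chi(F(x))$ is stipulated to be $0$ where $G(x)=0$ or $H(x)=0$ (likewise for $\chi\circ\mathrm{N}_{k/\kappa}$); the numerator and denominator of $F_{\mathbf{m}}$ are the corresponding products of those of its factors. $F$ is $d$th-power-free if each irreducible factor of $F$ has multiplicity strictly between $-d$ and $d$. $x=(x_1,\dots,x_n)$. *)

(* Defs.v *)
From HB Require Import structures.
From mathcomp Require Import all_boot all_order all_fingroup all_algebra all_field.
From mathcomp Require Import boolp classical_sets cardinality reals exp.
From mathcomp Require Import mpoly fraction complex.

Set Implicit Arguments.
Unset Strict Implicit.
Unset Printing Implicit Defensive.

Import Order.TTheory GRing.Theory Num.Theory.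
Local Open Scope ring_scope.

Section RationalFunctions.
Variables (K : fieldType) (n : nat).

(* A rational function together with a choice of numerator and denominator,
   not necessarily coprime. *)
Record ratfun := RatFun { rnum : {mpoly K[n]} ; rden : {mpoly K[n]} }.

Definition ratfrac (F : ratfun) : {fraction {mpoly K[n]}} :=
  tofrac (rnum F) / tofrac (rden F).

(* Since y / 0 = 0, this is 0 wherever the numerator or the denominator
   vanishes. *)
Definition rateval (F : ratfun) (x : 'rV[K]_n) : K :=
  (rnum F).@[x 0] / (rden F).@[x 0].

Definition ratone := RatFun 1 1.
Definition ratmul F G := RatFun (rnum F * rnum G) (rden F * rden G).
Definition ratinv F := RatFun (rden F) (rnum F).

(* P(m + x) *)
Definition mshift (m : 'rV[K]_n) (P : {mpoly K[n]}) : {mpoly K[n]} :=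
  P \mPo [tuple (m 0 i)%:MP + 'X_i | i < n].

Definition ratshift m F := RatFun (mshift m (rnum F)) (mshift m (rden F)).

Definition mdivides (P Q : {mpoly K[n]}) := exists A, Q = A * P.

Definition mirreducible (P : {mpoly K[n]}) :=
  [/\ P != 0, P \isn't a GRing.unit &
      forall A B, P = A * B -> A \is a GRing.unit \/ B \is a GRing.unit].

(* For P irreducible: f is nonzero and has P-adic valuation e. *)
Definition has_mult (P : {mpoly K[n]}) (f : {fraction {mpoly K[n]}}) (e : int) :=
  exists A B, [/\ ~ mdivides P A, ~ mdivides P B &
                  f = tofrac P ^ e * (tofrac A / tofrac B)].

Definition power_free (d : nat) (f : {fraction {mpoly K[n]}}) :=
  forall P, mirreducible P ->
  forall e, has_mult P f e -> - d%:Z < e < d%:Z.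

Definition perfect_power (d : nat) (f : {fraction {mpoly K[n]}}) :=
  exists g, f = g ^+ d.

Definition transl_stab (F : ratfun) : set 'rV[K]_n :=
  [set m | ratfrac F = ratfrac (ratshift m F)]%classic.

(* F_m: the rows of m, numbered from 0, are m^(1), ..., m^(2s). *)
Definition ratmoment (s : nat) (F : ratfun) (m : 'M[K]_(2 * s, n)) : ratfun :=
  ratmul (\big[ratmul/ratone]_(j < 2 * s | (j < s)%N) ratshift (row j m) F)
         (\big[ratmul/ratone]_(j < 2 * s | (s <= j)%N)
             ratinv (ratshift (row j m) F)).

End RationalFunctions.

Arguments ratone {K n}.

Definition ratmap (K L : fieldType) (n : nat) (f : K -> L) (F : ratfun K n) :
  ratfun L n := RatFun (map_mpoly f (rnum F)) (map_mpoly f (rden F)).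

Section Characters.
Variables (R : realType) (kappa : finFieldType).

Definition mulchar (chi : {unit kappa} -> R[i]) :=
  chi 1%g = 1 /\ forall u v, chi (u * v)%g = chi u * chi v.

Definition char_order (chi : {unit kappa} -> R[i]) (d : nat) :=
  [/\ (0 < d)%N, forall u, chi u ^+ d = 1 &
      forall e, (0 < e)%N -> (forall u, chi u ^+ e = 1) -> (d <= e)%N].

Definition char_ext (chi : {unit kappa} -> R[i]) (a : kappa) : R[i] :=
  if insub a is Some u then chi u else 0.

Variable k : fieldExtType kappa.

(* galNorm is valued in k; fieldnormE shows that a preimage in kappa is always
   found. *)
Definition fieldnorm (x : finvect_type k) : kappa :=
  odflt 0 [pick c : kappa | c%:A == galNorm 1 {: finvect_type k} x].

Lemma fieldnormE (x : finvect_type k) :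
  (fieldnorm x)%:A = galNorm 1 {: finvect_type k} x.
Proof.
rewrite /fieldnorm; case: pickP => [c /eqP //|nc].
have gal : galois 1 {: finvect_type k} by apply: finField_galois; apply: sub1v.
have /vlineP[c Dc] := mem_galNorm gal (memvf x).
by have := nc c; rewrite Dc eqxx.
Qed.

Definition moment_sum (n s : nat) (chi : {unit kappa} -> R[i])
    (F : ratfun kappa n) (m : 'M[finvect_type k]_(2 * s, n)) : R[i] :=
  \sum_(x : 'rV[finvect_type k]_n)
    char_ext chi (fieldnorm
      (rateval (ratmoment (ratmap (in_alg (finvect_type k)) F) m) x)).

(* F_m, viewed in kbar(x_1, ..., x_n) through j, is a perfect d-th power. *)
Definition moment_perfect (kbar : closedFieldType)
    (j : finvect_type k -> kbar) (n s d : nat)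
    (F : ratfun kappa n) (m : 'M[finvect_type k]_(2 * s, n)) : Prop :=
  perfect_power d (ratfrac (ratmap j
    (ratmoment (ratmap (in_alg (finvect_type k)) F) m))).

End Characters.

(* Main.v *)
(* (b) Clearing denominators, psi(F_m(x)) = psi(G(x)) with G = Num * Den^(d-1)
   and psi = chi o N, so it suffices to bound the sum of psi(G(x)) over k^n.

   For n = 1 this is Weil's bound, obtained by Stepanov's method in Bombieri's
   form.  Let q = #k = MQ with M, Q powers of p close to sqrt q.  Given a with
   a^d = 1, one builds Psi = sum_{i < d, j < J} k_ij f^(u i) X^(Q j) whose M-th
   power agrees on {x | f(x)^((q-1)/d) = a} with a polynomial of lower degree
   depending linearly on the M-th powers of the k_ij, and chooses the k_ij so
   that the latter vanishes identically.  Psi itself is nonzero, for otherwise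
   sum_i c_i Y^i and Y^d - f would have a resultant divisible by X^Q, hence
   zero by degree considerations; a common factor of degree r, 0 < r < d, then
   gives f^r = h^d by taking the determinant of its companion matrix.

   For n > 1, expand G in the last variable t, with leading coefficient a and
   degree N, and bound the inner sum over t by the case n = 1 unless G(x', t)
   is a constant times a d-th power.  If d does not divide N this happens only
   for a(x') = 0; otherwise it forces the monic polynomial attached to G to
   agree at x' with the d-th power of a fixed truncated d-th root, which happens
   on a hypersurface, or identically.  In the last case G is, up to a d-th
   power, equal to a, and induction applies.

   (a) Over kbar call a monic irreducible polynomial unbalanced if it does not
   divide the numerator and the denominator of F equally often.  Frobenius
   descent shows that the difference of multiplicities remains < d in absolute
   value over kbar.  If F_m is a d-th power, the translate by m_i of an
   unbalanced P must therefore occur again, so that translating P by m_i - m_i'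
   gives an unbalanced polynomial for some i' <> i.  There are boundedly many
   ways to choose all these i', and for each choice the possible m differ by
   solutions of relations m_i - m_i' in Stab(P).  A relation i |-> i' without
   fixed point leaves at most s of the 2s vectors m_i free modulo Stab(P), and
   the intersection of all the Stab(P) embeds into T_F. *)

Require Import Defs.
From HB Require Import structures.
From mathcomp Require Import all_boot all_order all_fingroup all_algebra all_field.
From mathcomp Require Import boolp classical_sets cardinality reals exp.
From mathcomp Require Import mpoly fraction complex.
From mathcomp Require Import zify ring.
From mathcomp Require generic_quotient.

Set Implicit Arguments.
Unset Strict Implicit.
Unset Printing Implicit Defensive.

Import Order.TTheory GRing.Theory Num.Theory.
Local Open Scope ring_scope.
Local Open Scope complex_scope.

(** * Common roots of Y^d - f *)

Lemma tofrac_inj (D : idomainType) : injective (@tofrac D).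
Proof. by move=> a b /eqP; rewrite tofrac_eq => /eqP. Qed.

Lemma frac_ratio (D : idomainType) (x : {fraction D}) :
  exists a b, b != 0 /\ x = tofrac a / tofrac b.
Proof.
elim/generic_quotient.quotW: x => r.
exists (frac r).1, (frac r).2; split; first exact: denom_ratioP.
have d0 := denom_ratioP r.
apply: (canRL (mulfK _)); first by rewrite tofrac_eq0.
unlock FracField.tofrac; rewrite -[LHS]FracField.pi_mul.
apply/generic_quotient.eqmodP; rewrite /= FracField.equivfE /FracField.mulf.
by rewrite !numden_Ratio ?(oner_neq0, mulf_neq0, d0) // ?oner_neq0 // !mulr1 mulrC.
Qed.

(** By Cayley-Hamilton the companion matrix [M] of [C] satisfies M^d = f, a scalar matrix. Taking
    determinants gives the identity, with h = det M. *)
Lemma companion_power (K : fieldType) (C : {poly K}) (f : K) (d : nat) :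
  C \is monic -> (1 < size C)%N -> C %| 'X^d - f%:P ->
  exists h, f ^+ (size C).-1 = h ^+ d.
Proof.
move=> monC sC /dvdpP [Q eQ].
have charC := companionmxK monC; move: (companionmx C) charC.
case: (size C) sC => [|[|r]] //= _ M charM.
have CH := Cayley_Hamilton M; rewrite charM in CH.
have : horner_mx M ('X^d - f%:P) = 0 by rewrite eQ rmorphM /= CH mulr0.
rewrite rmorphB rmorphXn /= horner_mx_X horner_mx_C => /eqP; rewrite subr_eq0.
move=> /eqP eM; exists (\det M).
rewrite -det_scalar -eM.
by elim: d {eQ eM} => [|d IH]; rewrite ?expr0 ?det1 // !exprS det_mulmx IH.
Qed.

(** Bezout: with g = gcd(r, d) = u r - v d one gets (h^u)^d = (f^v)^d f^g, so f^v divides h^u and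
    the quotient w satisfies w^d = f^g. Comparing g-th powers, w^(d/g) equals f up to a constant,
    and e = d/g exceeds 1 because g <= r < d. *)
Lemma power_dvd_root (K : fieldType) (f h : {poly K}) (r d : nat) :
  f != 0 -> (0 < r < d)%N -> f ^+ r = h ^+ d ->
  exists e c g, [/\ (1 < e)%N, (e %| d)%N & f = c *: g ^+ e].
Proof.
move=> f0 /andP[r0 rd] frh.
have d0 : (0 < d)%N by apply: leq_ltn_trans rd.
have [u v ur _] := egcdnP d r0.
set g := gcdn r d in ur.
have g0 : (0 < g)%N by rewrite gcdn_gt0 r0.
have e1 : (h ^+ u) ^+ d = (f ^+ v) ^+ d * f ^+ g.
  by rewrite -!exprM -exprD -ur mulnC [LHS]exprM -frh -exprM mulnC.
have /dvdpP [w hw] : f ^+ v %| h ^+ u.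
  by rewrite -(dvdp_pexp2r _ _ d0) e1 dvdp_mulr.
have wd : w ^+ d = f ^+ g.
  apply: (mulIf (expf_neq0 d (expf_neq0 v f0))).
  by rewrite -exprMn -hw e1 mulrC.
have gd : (g %| d)%N by apply: dvdn_gcdr.
exists (d %/ g)%N.
have /eqpP [[c1 c2] /= /andP[c10 c20] ec] : w ^+ (d %/ g) %= f.
  have we : (w ^+ (d %/ g)) ^+ g = f ^+ g by rewrite -exprM divnK.
  by apply/andP; split; rewrite -(dvdp_pexp2r _ _ g0) we dvdpp.
exists (c2^-1 * c1), w; split.
- rewrite ltn_divRL // mul1n; apply: leq_ltn_trans rd.
  by apply: dvdn_leq => //; apply: dvdn_gcdl.
- by apply/dvdnP; exists g; rewrite mulnC divnK.
- by rewrite -scalerA ec scalerA mulVf // scale1r.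
Qed.

(* If C is a common factor of A and Y^d - f over k(X), then f^(deg C) is the
   d-th power of the determinant of the companion matrix of C. *)
Lemma resultant0_power (k : fieldType) (f : {poly k}) (d : nat)
    (A : {poly {poly k}}) :
  A != 0 -> (size A <= d)%N -> resultant A ('X^d - f%:P) = 0 ->
  exists r h, (0 < r < d)%N /\ f ^+ r = h ^+ d.
Proof.
move=> A0 sA /eqP; rewrite resultant_eq0.
set B := 'X^d - f%:P => sC.
have d0 : (0 < d)%N by apply: leq_trans sA; rewrite size_poly_gt0.
set C := Pdiv.Idomain.gcdp A B in sC.
have sCA : (size C <= size A)%N.
  by apply: Pdiv.Idomain.dvdp_leq => //; apply: Pdiv.Idomain.dvdp_gcdl.
have /Pdiv.Idomain.dvdpP [[c Q] /= c0 eQ] : Pdiv.Idomain.dvdp C B.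
  exact: Pdiv.Idomain.dvdp_gcdr.
(* The leading coefficient of the common factor need not be a unit of k[X]; it is made monic over
   the fraction field. *)
pose T := @tofrac {poly k}.
have Tinj : injective T by apply: tofrac_inj.
pose C1 := map_poly T C.
have sC1 : size C1 = size C by rewrite size_map_inj_poly //; apply: tofrac0.
have C10 : C1 != 0 by rewrite -size_poly_gt0 sC1 (ltnW sC).
pose C2 := (lead_coef C1)^-1 *: C1.
have monC2 : C2 \is monic.
  by rewrite monicE lead_coefZ mulVf // lead_coef_eq0.
have sC2 : size C2 = size C.
  by rewrite size_scale ?invr_eq0 ?lead_coef_eq0 // sC1.
have dvC : C2 %| 'X^d - (T f)%:P.
  rewrite dvdpZl ?invr_eq0 ?lead_coef_eq0 //.
  have e : T c *: ('X^d - (T f)%:P) = map_poly T Q * C1.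
    rewrite -rmorphM /= -eQ map_polyZ rmorphB /= map_polyXn map_polyC //=.
  have Tc0 : T c != 0 by rewrite tofrac_eq0.
  by rewrite -(dvdpZr _ _ Tc0) e dvdp_mull.
have [] := companion_power monC2 _ dvC; first by rewrite sC2.
rewrite sC2 => h; have [a [b [b0 ->]]] := frac_ratio h.
rewrite expr_div_n => /(congr1 (fun z => z * T b ^+ d)).
have Tb0 : T b ^+ d != 0 by rewrite expf_neq0 // tofrac_eq0.
rewrite divfK // -!tofracXn -tofracM => /Tinj e.
(* The root a / b found in k(X) lies in k[X]: b^d divides a^d, hence b divides a. *)
have /dvdpP [w aw] : b %| a by rewrite -(dvdp_pexp2r _ _ d0) -e dvdp_mull.
exists (size C).-1, w; split.
  by case: (size C) sC (leq_trans sCA sA) => [|[|r]].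
apply: (mulIf (expf_neq0 d b0)).
by rewrite e aw exprMn.
Qed.

Lemma size_det_leq (R : comNzRingType) (n e : nat) (M : 'M[{poly R}]_n) :
  (forall i j, (size (M i j) <= e.+1)%N) -> (size (\det M) <= n * e + 1)%N.
Proof.
move=> sM; apply: leq_trans (size_sum _ _ _) _.
apply/bigmax_leqP => s _.
have -> : (-1) ^+ s * \prod_i M i (s i) = (-1) ^+ s *: \prod_i M i (s i).
  by rewrite -mul_polyC rmorphXn /= rmorphN1.
apply: leq_trans (size_scale_leq _ _) _.
apply: leq_trans (size_poly_prod_leq _ _) _.
rewrite cardT size_enum_ord leq_subLR addnA -mulnS addn1 ltnS.
by rewrite -[X in (X * _)%N](card_ord n) -sum_nat_const; apply: leq_sum.
Qed.

(** The Sylvester matrix has order deg A + deg B, and its entries are 0 or coefficients of A and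
    B. *)
Lemma size_resultant_leq (k : fieldType) (A B : {poly {poly k}}) (e : nat) :
  (forall i, (size (A`_i)%R <= e.+1)%N) -> (forall i, (size (B`_i)%R <= e.+1)%N) ->
  (size (resultant A B) <= ((size B).-1 + (size A).-1) * e + 1)%N.
Proof.
move=> sA sB; apply: size_det_leq => i j.
rewrite /Sylvester_mx mxE; case: (split i) => i'; rewrite !mxE /=;
  rewrite rVpoly_delta coefXnM; case: ifP => //; rewrite ?size_poly0 //.
Qed.

(** * The Stepanov method *)

Lemma pnat_frob_sum (R : comNzRingType) (p Q : nat) (I : Type) (r : seq I)
    (F : I -> R) :
  p \in [pchar R] -> p.-nat Q ->
  (\sum_(i <- r) F i) ^+ Q = \sum_(i <- r) F i ^+ Q.
Proof.
move=> pR pQ; have Q0 : (0 < Q)%N by case/andP: pQ.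
elim: r => [|i r IH]; first by rewrite !big_nil expr0n gtn_eqF.
rewrite !big_cons exprDn_pchar ?IH //.
by rewrite (eq_pnat _ (pcharf_eq pR)).
Qed.

(** In characteristic p one has f^Q - 1 = (f - 1)^Q, and X divides f - 1. *)
Lemma frob_dvdp (k : fieldType) (p Q : nat) (f : {poly k}) :
  p \in [pchar k] -> p.-nat Q -> f.[0] = 1 -> 'X^Q %| f ^+ Q - 1.
Proof.
move=> pk pQ f1.
have pP : p \in [pchar {poly k}] by rewrite pchar_poly.
have -> : f ^+ Q - 1 = (f - 1) ^+ Q.
  rewrite -[f in LHS](subrK 1) exprDn_pchar ?(eq_pnat _ (pcharf_eq pP)) //.
  by rewrite expr1n addrK.
apply: dvdp_exp2r; rewrite -['X]subr0 -[0 in X in X %| _]polyC0 dvdp_XsubCl.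
by rewrite rootE !hornerE f1 subrr.
Qed.

(** Both A and B = Y^d - f vanish modulo X^Q at Y = w, so their resultant, a combination of the two,
    is divisible by X^Q. Its degree is at most 2 d e < Q, hence it is zero, and [resultant0_power]
    contradicts the hypothesis on powers of f. *)
Lemma approx_root_eq0 (k : fieldType) (d Q e : nat) (f w : {poly k})
    (A : {poly {poly k}}) :
  (0 < d)%N -> (2 * d * e < Q)%N -> (size f <= e.+1)%N ->
  (forall r h, (0 < r < d)%N -> f ^+ r <> h ^+ d) ->
  'X^Q %| w ^+ d - f ->
  (size A <= d)%N -> (forall i, (size (A`_i)%R <= e.+1)%N) ->
  'X^Q %| A.[w] -> A = 0.
Proof.
move=> d0 eQ sf irr wf sA sAi dvA.
have [//|A0] := eqVneq A 0.
have small (g : {poly k}) : (size g <= Q)%N -> 'X^Q %| g -> g = 0.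
  move=> sg dg; apply/eqP; apply: contraTT dg => g0.
  by apply: contraL sg => /dvdp_leq -/(_ g0); rewrite size_polyXn ltnNge.
(* Writing the resultant as a combination of A and B requires positive degree in Y, so a constant A
   is treated apart. *)
have [sA1|sA1] := leqP (size A) 1.
  move: dvA A0; rewrite (size1_polyC sA1) hornerC => dvA.
  rewrite (small _ _ dvA) ?eqxx //; apply: leq_trans (sAi 0%N) _.
  by apply: leq_trans eQ; rewrite ltnS leq_pmull // muln_gt0.
pose B : {poly {poly k}} := 'X^d - f%:P.
have sB : size B = d.+1 by rewrite size_XnsubC.
have [[u v] /= _ eR] : {uv : {poly {poly k}} * {poly {poly k}}
   | (size uv.1 < size B)%N /\ (size uv.2 < size A)%N
   & (resultant A B)%:P = uv.1 * A + uv.2 * B}.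
  by apply: resultant_in_ideal; rewrite ?sB.
have R0 : resultant A B = 0.
  apply: small.
    apply: leq_trans (size_resultant_leq (e := e) sAi _) _.
      move=> i; rewrite coefB coefXn coefC.
      apply: leq_trans (size_polyD _ _) _; rewrite size_polyN geq_max.
      by case: eqP => _; case: eqP => _; rewrite ?size_poly1 ?size_poly0 ?sf.
    rewrite sB /= addn1; apply: leq_trans eQ; rewrite ltnS leq_mul2r.
    by apply/orP; right; rewrite mul2n -addnn leq_add2l; case: (size A) sA => //= s /ltnW.
  have := congr1 (fun P => P.[w]) eR; rewrite /= hornerC hornerD !hornerM => ->.
  by rewrite dvdp_add // dvdp_mull // !hornerE.
have [r [h [rd frh]]] := resultant0_power A0 sA R0.
by have := irr r h rd.
Qed.

(** The A_j are removed like digits in base X^Q: modulo X^Q only A_0(w) remains, so A_0 = 0, and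
    then a factor X^Q cancels. *)
Lemma approx_sum_eq0 (k : fieldType) (d Q e J : nat) (f w : {poly k})
    (A : nat -> {poly {poly k}}) :
  (0 < d)%N -> (2 * d * e < Q)%N -> (size f <= e.+1)%N ->
  (forall r h, (0 < r < d)%N -> f ^+ r <> h ^+ d) ->
  'X^Q %| w ^+ d - f ->
  (forall j, size (A j) <= d)%N ->
  (forall j i, (size ((A j)`_i)%R <= e.+1)%N) ->
  \sum_(j < J) (A j).[w] * 'X^Q ^+ j = 0 -> forall j, (j < J)%N -> A j = 0.
Proof.
move=> d0 eQ sf irr wf; elim: J A => [//|J IH] A sA sAi.
rewrite big_ord_recl expr0 mulr1.
under eq_bigr do rewrite lift0 exprS mulrCA.
rewrite -mulr_sumr => e0.
have A0 : A 0%N = 0.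
  apply: (approx_root_eq0 d0 eQ sf irr wf) => //.
  by move/eqP: e0; rewrite addr_eq0 => /eqP ->; rewrite -mulrN dvdp_mulr.
move: e0; rewrite A0 horner0 add0r => /eqP; rewrite mulf_eq0 expf_eq0 polyX_eq0.
rewrite andbF /= => /eqP e0.
case=> [//|j] jJ.
exact: (IH (fun j => A j.+1) (fun j => sA j.+1) (fun j => sAi j.+1) e0).
Qed.

Lemma poly_lin_dep (k : fieldType) (T : finType) (N : nat)
    (th : T -> {poly k}) :
  (forall t, (size (th t) <= N)%N) -> (N < #|T|)%N ->
  exists v : T -> k, (exists t, v t != 0) /\ \sum_t v t *: th t = 0.
Proof.
move=> sth NT.
pose V : 'M[k]_(#|T|, N) := \matrix_i poly_rV (th (enum_val i)).
have : kermx V != 0.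
  rewrite kermx_eq0 /row_free neq_ltn; apply/orP; left.
  by apply: leq_ltn_trans NT; apply: rank_leq_col.
case/rowV0Pn => x /sub_kermxP xV x0.
exists (fun t => x 0 (enum_rank t)); split.
  case/rV0Pn: x0 => i xi; exists (enum_val i); by rewrite enum_valK.
rewrite (reindex (enum_val : 'I_#|T| -> T)) /=; last first.
  by apply: onW_bij; apply: enum_val_bij.
under eq_bigr do rewrite enum_valK.
transitivity (rVpoly (x *m V)); last by rewrite xV linear0.
rewrite mulmx_sum_row linear_sum.
by apply: eq_bigr => i _; rewrite rowK linearZ /= poly_rV_K.
Qed.

(** The identity d u = 1 + Q t makes w = f^u a d-th root of f modulo X^Q, and M u = r + c0 t allows
    w(x)^M to be replaced by f(x)^r a^t at a counted point x. The last numerical hypothesis says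
    that the d J (e + 1) unknowns outnumber the linear conditions; the conclusion is the degree
    bound for the auxiliary polynomial [Psi]. *)
Lemma stepanov_count (k : finFieldType) (p M Q d r t u c0 m e J : nat)
    (f : {poly k}) (a : k) :
  p \in [pchar k] -> p.-nat M -> p.-nat Q -> #|k| = (M * Q)%N ->
  (0 < d)%N -> (d * u = 1 + Q * t)%N -> (M * u = r + c0 * t)%N ->
  f.[0] = 1 -> (size f <= m.+1)%N -> (m <= e)%N -> (2 * d * e < Q)%N ->
  (forall r h, (0 < r < d)%N -> f ^+ r <> h ^+ d) ->
  (M * e + m * r * d + J < d * J * e.+1)%N ->
  (#|[set x : k | f.[x] ^+ c0 == a]| <= e + m * u * d + Q * J)%N.
Proof.
move=> pk pM pQ cardk d0 du Mu f1 sf me eQ irr cnt.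
have f0 : f != 0 by apply/eqP => f0; move: f1; rewrite f0 horner0 => /esym/eqP; rewrite oner_eq0.
have M0 : (0 < M)%N by case/andP: pM.
have Q0 : (0 < Q)%N by case/andP: pQ.
have sfX n : (size (f ^+ n) <= (m * n).+1)%N.
  apply: leq_trans (size_poly_exp_leq _ _) _; rewrite ltnS leq_mul2r.
  by apply/orP; right; rewrite -subn1 leq_subLR add1n.
pose T := ('I_d * 'I_J * 'I_e.+1)%type.
(* At a counted point, [th] at (i, j, l) agrees with the M-th power of X^l w^i X^(Q j), since x^(M
   Q) = x. A linear relation between the [th] therefore makes Psi^M vanish there. *)
pose th (i : T) : {poly k} := 'X^(M * i.2) * (f ^+ r * (a ^+ t)%:P) ^+ i.1.1 * 'X^(i.1.2).
have [||v [[i0 vi0] sv]] := @poly_lin_dep k T (M * e + m * r * d + J) th.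
- move=> [[i j] l]; rewrite /th /= exprMn -rmorphXn /=.
  rewrite [_ * (_)%:P]mulrC mul_polyC -scalerAr -scalerAl.
  apply: leq_trans (size_scale_leq _ _) _.
  rewrite [X in X * _]mulrC -!exprM -mulrA -exprD.
  rewrite size_mulXn ?expf_neq0 //.
  have aux x X y Y n j1 J1 : (x <= X -> y <= Y -> n <= y.+1 -> j1 < J1 ->
    x + j1 + n <= X + Y + J1)%N by lia.
  apply: (aux _ _ _ _ _ _ _ _ _ (sfX _) (ltn_ord j)).
    by rewrite leq_mul2l -ltnS ltn_ord orbT.
  by rewrite mulnA leq_mul2l ltnW ?orbT.
- by rewrite !card_prod !card_ord.
(* As M Q = #k, this is an M-th root of [v i]. *)
pose c i := v i ^+ Q.
have cM i : c i ^+ M = v i by rewrite /c -exprM mulnC -cardk expf_card.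
pose w := f ^+ u.
pose A (j : nat) : {poly {poly k}} :=
  \poly_(i < d) \poly_(l < e.+1)
     (if (insub i : option 'I_d, insub j : option 'I_J, insub l : option 'I_e.+1)
        is (Some i', Some j', Some l') then c (i', j', l') else 0).
pose Psi := \sum_(j < J) (A j).[w] * 'X^Q ^+ j.
have Psi0 : Psi != 0.
  apply: contraNneq vi0 => Psi0.
  (* Here w^d = f (f^t)^Q, and (f^t)^Q is 1 modulo X^Q because f(0) = 1. *)
  have wf : 'X^Q %| w ^+ d - f.
    rewrite /w -exprM mulnC du exprD expr1 exprM -[X in _ - X]mulr1 -mulrBr.
    apply: dvdp_mull; rewrite -exprM mulnC exprM.
    have := frob_dvdp pk pQ (f := f ^+ t); rewrite horner_exp f1 expr1n => /(_ erefl).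
    by rewrite -!exprM mulnC.
  have sfe : (size f <= e.+1)%N by apply: leq_trans sf _; rewrite ltnS.
  have := approx_sum_eq0 d0 eQ sfe irr wf _ _ Psi0.
  case: i0 => [[i j] l] /(_ _ _ j (ltn_ord j)) Aj.
  have : (A j)`_i`_l = 0.
    rewrite Aj ?coef0 // => j'; first exact: size_poly.
    move=> i'; rewrite coef_poly; case: ifP => _; rewrite ?size_poly0 //.
  rewrite coef_poly ltn_ord coef_poly ltn_ord !valK => ci0.
  by rewrite -cM ci0 expr0n gtn_eqF.
have aux a1 b x y X : (a1 <= x.+1 -> b <= y.+1 -> y <= X ->
  (a1 + b).-1 <= (x + X).+1)%N by lia.
have sPsi : (size Psi <= (e + m * u * d + Q * J).+1)%N.
  apply: leq_trans (size_sum _ _ _) _; apply/bigmax_leqP => j _.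
  rewrite -exprM.
  have sA : (size (A j).[w] <= (e + m * u * d).+1)%N.
    rewrite horner_poly; apply: leq_trans (size_sum _ _ _) _.
    apply/bigmax_leqP => i _; apply: leq_trans (size_polyMleq _ _) _.
    apply: (aux _ _ _ (m * (u * i))%N); first exact: size_poly.
      by rewrite -exprM; apply: sfX.
    by rewrite mulnA leq_mul2l ltnW ?orbT.
  apply: leq_trans (size_polyMleq _ _) _; rewrite size_polyXn.
  apply: (aux _ _ _ _ _ sA (leqnn _)).
  by rewrite leq_mul2l ltnW ?orbT.
rewrite -ltnS; apply: leq_trans sPsi.
rewrite cardE; apply: max_poly_roots => //; last by rewrite ?enum_uniq.
apply/allP => x; rewrite mem_enum inE => /eqP fx.
suff : Psi.[x] ^+ M == 0 by rewrite expf_eq0 M0 rootE.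
have -> : Psi = \sum_(i : T) c i *: ('X^(i.2) * w ^+ i.1.1 * 'X^Q ^+ i.1.2).
  transitivity (\sum_(i < d) \sum_(j < J) \sum_(l < e.+1)
      c (i, j, l) *: ('X^l * w ^+ i * 'X^Q ^+ j)); last first.
    by rewrite !pair_bigA /=; apply: eq_bigr => [[[i j] l]] _.
  rewrite exchange_big /=.
  apply: eq_bigr => j _; rewrite horner_poly mulr_suml; apply: eq_bigr => i _.
  rewrite poly_def !mulr_suml; apply: eq_bigr => l _.
  by rewrite !valK -!scalerAl.
rewrite horner_sum (pnat_frob_sum _ _ pk pM).
apply/eqP; transitivity (\sum_i v i *: th i).[x]; last by rewrite sv horner0.
rewrite horner_sum; apply: eq_bigr => i _.
rewrite !hornerZ exprMn cM; congr (_ * _).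
rewrite /th !(hornerM, horner_exp, hornerX, hornerC).
rewrite ![(_ * _) ^+ M]exprMn -!exprM [(i.2 * M)%N]mulnC; congr (_ * _ * _).
- by rewrite mulnAC [(u * M)%N]mulnC Mu exprM exprD (exprM _ c0) fx.
- by rewrite mulnAC [(Q * M)%N]mulnC -cardk exprM expf_card.
Qed.

Lemma card_finField_pchar (k : finFieldType) (p : nat) :
  p \in [pchar k] -> (#|k| = p ^ logn p #|k|)%N.
Proof. by move=> pk; have := card_pprimeChar pk. Qed.

(* For q a power of p this is an integral substitute for sqrt q: its square is
   q or p * q. *)
Definition frob_half (p q : nat) : nat := (p ^ (logn p q - (logn p q)./2))%N.

(** The bracket serves twice: as the threshold for M below which the trivial count suffices, and as
    a majorant of the error terms above it. *)
Definition stepanov_const (m d : nat) : nat :=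
  (d * (2 * d * m.+1 + m * d + 4 * m + 20))%N.

(** The parameters of [stepanov_count] are chosen so that d times its bound is M Q = q plus an error
    linear in Q. *)
Lemma stepanov_bound (k : finFieldType) (p d m : nat) (f : {poly k}) (a : k) :
  p \in [pchar k] -> (0 < d)%N -> (d %| #|k|.-1)%N ->
  f.[0] = 1 -> (size f <= m.+1)%N ->
  (forall r h, (0 < r < d)%N -> f ^+ r <> h ^+ d) ->
  (d * #|[set x : k | f.[x] ^+ (#|k|.-1 %/ d) == a]|
     <= #|k| + stepanov_const m d * frob_half p #|k|)%N.
Proof.
move=> pk d0 dq f1 sf irr; rewrite /frob_half.
have cardk := card_finField_pchar pk.
set al := logn p _ in cardk *; set c0 := (_ %/ d)%N.
have pp := pcharf_prime pk.
pose M := (p ^ al./2)%N; pose Q := (p ^ (al - al./2))%N; rewrite -/Q.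
have hal : (al./2 <= al)%N by rewrite -{2}(odd_double_half al) -addnn; lia.
have cMQ : #|k| = (M * Q)%N by rewrite -expnD subnKC.
have M0 : (0 < M)%N by rewrite expn_gt0 prime_gt0.
have Q0 : (0 < Q)%N by rewrite expn_gt0 prime_gt0.
have MQ : (M <= Q)%N.
  by rewrite leq_exp2l ?prime_gt1 // -{2}(odd_double_half al) -addnn; lia.
have pM : p.-nat M by rewrite pnatX pnat_id.
have pQ : p.-nat Q by rewrite pnatX pnat_id.
have copQ : coprime d Q.
  apply: coprime_dvdl dq _; rewrite cMQ -subn1.
  apply: (@coprime_dvdr _ (M * Q)); first exact: dvdn_mull.
  by rewrite subn1 coprimePn // muln_gt0 M0.
(* Since d divides q - 1 it is prime to Q, so some t < d makes d divide 1 + t Q; that t is less than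
   d keeps u at most Q. *)
have [t td /dvdnP [u eu]] := Bezoutl Q d0.
rewrite (eqP copQ) in eu.
have c0d : (c0 * d = M * Q - 1)%N by rewrite divnK // cMQ subn1.
have q0 : (0 < M * Q)%N by rewrite muln_gt0 M0.
have uQ : (u <= Q)%N.
  have : (u * d <= Q * d)%N; last by rewrite leq_pmul2r.
  have := leq_mul td (leqnn Q); rewrite -eu; lia.
have e1 : (M * u * d = M + t + c0 * t * d)%N.
  rewrite -mulnA -eu mulnDr muln1 -addnA; congr (_ + _)%N.
  rewrite mulnAC c0d mulnBl mul1n mulnCA [(t * (M * Q))%N]mulnC.
  by rewrite subnKC // leq_pmull.
(* The terms of order q cancel by c0 d = q - 1, leaving r d = M + t, so r is about M / d. *)
pose r := (M * u - c0 * t)%N.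
have rd : (r * d = M + t)%N by rewrite mulnBl e1; lia.
have Mu : (M * u = r + c0 * t)%N.
  by apply/eqP; rewrite -(eqn_pmul2r d0) mulnDl rd e1.
have trivial_bound : (#|[set x : k | f.[x] ^+ c0 == a]| <= M * Q)%N.
  by rewrite -cMQ max_card.
(* For M below the threshold the trivial bound M Q is absorbed by the error term. *)
have [Msmall|Mbig] := ltnP M (2 * d * m.+1 + m * d + 4 * m + 20).
  rewrite -/c0 cMQ /stepanov_const.
  apply: leq_trans (leq_addl _ _); rewrite -mulnA leq_mul2l.
  apply/orP; right; apply: leq_trans trivial_bound _.
  by rewrite leq_mul2r (ltnW Msmall) orbT.
have d20 : (0 < 2 * d)%N by rewrite muln_gt0.
(* [e] is the largest integer with 2 d e < Q. *)
have [e eQ eQ2] : exists2 e, (2 * d * e < Q)%N & (Q <= 2 * d * e.+1)%N.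
  exists (Q.-1 %/ (2 * d))%N; rewrite -[Q in leqRHS]prednK // -[Q in leqLHS]prednK //.
    by rewrite ltnS mulnC leq_trunc_div.
  by rewrite mulnC ltn_ceil.
have me : (m <= e)%N.
  rewrite -ltnS -(leq_pmul2l d20); apply: leq_trans eQ2.
  by apply: leq_trans MQ; apply: leq_trans Mbig; rewrite -!addnA leq_addr.
(* J is slightly above M / d. The excess of d J over M is at least 2 d (m + 2); multiplied by e + 1
   it yields at least (m + 2) Q, which pays for the conditions m r d + J. The excess is also at most
   d (2 m + 5), so d Q J stays within a constant times Q of M Q. *)
have [J [Jd JM' JM]] : exists J, [/\ (M + d * (2 * (m + 2)) <= d * J)%N,
    (d * J <= M + d * (1 + 2 * (m + 2)))%N & (J <= M + 1 + 2 * (m + 2))%N].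
  exists (M %/ d + 1 + 2 * (m + 2))%N; split.
  - by rewrite [leqRHS]mulnDr leq_add2r mulnC addn1 ltnW // ltn_ceil.
  - by rewrite -addnA [leqLHS]mulnDr leq_add2r mulnC leq_trunc_div.
  - by rewrite !leq_add2r leq_div.
have td' : (m * t <= m * d)%N by rewrite leq_mul2l ltnW ?orbT.
have cnt : (M * e + m * r * d + J < d * J * e.+1)%N.
  apply: leq_trans (leq_mul Jd (leqnn e.+1)).
  rewrite -mulnA rd.
  have : (m * M + 2 * M <= d * (2 * (m + 2)) * e.+1)%N.
    have -> : (d * (2 * (m + 2)) * e.+1 = (m + 2) * (2 * d * e.+1))%N by ring.
    by rewrite -mulnDl leq_mul2l (leq_trans MQ eQ2) orbT.
  rewrite mulnDl; move: (d * _ * e.+1)%N => Y; rewrite mulnDr mulnS.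
  move: Mbig JM td'; clear; rewrite mulnDr; lia.
have du : (d * u = 1 + Q * t)%N by rewrite mulnC -eu mulnC.
have := stepanov_count a pk pM pQ cMQ d0 du Mu f1 sf me eQ irr cnt.
rewrite -/c0 => H.
apply: leq_trans (leq_mul (leqnn d) H) _.
rewrite !mulnDr cMQ.
have h1 : (d * e <= Q)%N.
  by apply: leq_trans (ltnW eQ); rewrite -mulnA mul2n -addnn leq_addr.
have h2 : (d * (m * u * d) <= d * m * d * Q)%N.
  have -> : (d * (m * u * d) = d * m * d * u)%N by ring.
  by rewrite leq_mul2l uQ orbT.
have h3 : (d * (Q * J) <= M * Q + d * (1 + 2 * (m + 2)) * Q)%N.
  by rewrite mulnCA [X in (X <= _)%N]mulnC -mulnDl leq_mul2r JM' orbT.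
apply: leq_trans (leq_add (leq_add h1 h2) h3) _.
rewrite addnC -addnA leq_add2l -[X in (_ + (X + _))%N]mul1n -!mulnDl leq_mul2r.
apply/orP; right; rewrite /stepanov_const.
have -> : (d * m * d = d * (m * d))%N by ring.
move: d0; clear; set X := (d * (m * d))%N; rewrite !mulnDr -/X.
move: (d * (2 * d * m.+1))%N X => Y X; lia.
Qed.

(** * Character sums in one variable *)

(** A multiplicative character of exact order d, extended by 0, described by a generator g of the
    unit group and its value w. The values may lie in any [numDomainType]. *)
Definition cyclic_char (C : numDomainType) (k : finFieldType) (d : nat)
    (psi : k -> C) : Prop :=
  exists (g : k) (w : C), [/\ forall y, y != 0 -> exists s, y = g ^+ s,
    d.-primitive_root w, psi 0 = 0 & forall s, psi (g ^+ s) = w ^+ s].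

Section CyclicChar.
Variables (C : numDomainType) (k : finFieldType) (d : nat) (psi : k -> C).
Hypothesis cpsi : cyclic_char d psi.

Lemma cyclic_char_gt0 : (0 < d)%N.
Proof. by case: cpsi => g [w [_ /prim_order_gt0]]. Qed.

Lemma cyclic_char0 : psi 0 = 0. Proof. by case: cpsi => g [w []]. Qed.

Lemma cyclic_charM x y : psi (x * y) = psi x * psi y.
Proof.
have [g [w [gen _ psi0 psig]]] := cpsi.
have [->|/gen[s ->]] := eqVneq x 0; first by rewrite mul0r psi0 mul0r.
have [->|/gen[t ->]] := eqVneq y 0; first by rewrite mulr0 psi0 mulr0.
by rewrite -exprD !psig exprD.
Qed.

Lemma cyclic_charX x n : (0 < n)%N -> psi (x ^+ n) = psi x ^+ n.
Proof.
by case: n => // n _; elim: n => [|n IH]; rewrite ?expr1 // exprS cyclic_charM IH -exprS.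
Qed.

Lemma cyclic_char_norm x : x != 0 -> `|psi x| = 1.
Proof.
have [g [w [gen pw _ psig]]] := cpsi.
move=> /gen[s ->]; rewrite psig normrX.
suff -> : `|w| = 1 by rewrite expr1n.
apply/eqP; rewrite -(pexpr_eq1 (prim_order_gt0 pw)) //.
by rewrite -normrX (prim_expr_order pw) normr1.
Qed.

Lemma cyclic_char_norm_le1 x : `|psi x| <= 1.
Proof.
have [->|/cyclic_char_norm ->//] := eqVneq x 0.
by rewrite cyclic_char0 normr0.
Qed.

Lemma cyclic_char_order x : x != 0 -> psi x ^+ d = 1.
Proof.
have [g [w [gen pw _ psig]]] := cpsi.
by move=> /gen[s ->]; rewrite psig -exprM mulnC exprM (prim_expr_order pw) expr1n.
Qed.

(** From g^(q-1) = 1 follows w^(q-1) = 1. *)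
Lemma cyclic_char_dvd : (d %| #|k|.-1)%N.
Proof.
have [g [w [gen pw psi0 psig]]] := cpsi.
have g0 : g != 0.
  apply: contraTneq pw => g0; have := psig 1%N; rewrite !expr1 g0 psi0 => <-.
  apply/negP => /prim_expr_order/eqP.
  by rewrite expr0n gtn_eqF ?cyclic_char_gt0 //= eq_sym oner_eq0.
rewrite (prim_order_dvd pw) -psig.
have -> : g ^+ #|k|.-1 = 1.
  apply: (mulfI g0); rewrite -exprS prednK ?expf_card ?mulr1 //.
  by apply/card_gt0P; exists 0.
by rewrite -(expr0 g) psig.
Qed.

End CyclicChar.

Lemma cyclic_char_pow (C : numDomainType) (k : finFieldType) (d e : nat)
    (psi : k -> C) :
  (0 < e)%N -> (e %| d)%N -> cyclic_char d psi ->
  cyclic_char (d %/ e) (fun x => psi x ^+ e).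
Proof.
move=> e0 ed [g [w [gen pw psi0 psig]]]; exists g, (w ^+ e); split => //.
- by have := exp_prim_root pw e; rewrite (gcdn_idPl ed).
- by rewrite psi0 expr0n gtn_eqF.
- by move=> s; rewrite psig -!exprM mulnC.
Qed.

Lemma sum_prim_root (C : numDomainType) (d : nat) (w : C) :
  (1 < d)%N -> d.-primitive_root w -> \sum_(l < d) w ^+ l = 0.
Proof.
move=> d1 pw; apply/eqP; have := subrX1 w d.
rewrite (prim_expr_order pw) subrr => /esym/eqP; rewrite mulf_eq0.
rewrite subr_eq0 -(expr1 w) -(prim_order_dvd pw) dvdn1 expr1.
by rewrite gtn_eqF.
Qed.

Lemma card_roots_leq (k : finFieldType) (f : {poly k}) (m : nat) :
  f != 0 -> (size f <= m.+1)%N -> (#|[set x : k | f.[x] == 0%R]| <= m)%N.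
Proof.
move=> f0 sf; rewrite -ltnS; apply: leq_trans sf.
rewrite cardE; apply: max_poly_roots; rewrite ?enum_uniq //.
by apply/allP => x; rewrite mem_enum inE rootE.
Qed.

(** Upper bounds for all fibres suffice. With N_l the size of the fibre over w^l, the deficits #T +
    B - d N_l are nonnegative, and their sum is at most d (B + z) because all but z points lie in
    some fibre. As the powers of w sum to 0, d times the character sum is minus the sum of the
    deficits weighted by the w^l. *)
Lemma char_sum_of_counts (C : numDomainType) (T : finType) (d B z : nat)
    (w : C) (F : T -> C) :
  (1 < d)%N -> d.-primitive_root w ->
  (forall x, F x = 0 \/ exists s, F x = w ^+ s) ->
  (#|[set x | F x == 0%R]| <= z)%N ->
  (forall l, (d * #|[set x | F x == w ^+ l]| <= #|T| + B)%N) ->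
  `|\sum_x F x| <= (B + z)%:R.
Proof.
move=> d1 pw FE zle cnt.
have d0 := ltnW d1.
have w0 : w != 0.
  apply: contraTneq pw => ->; apply/negP => /prim_expr_order/eqP.
  by rewrite expr0n gtn_eqF //= eq_sym oner_eq0.
pose N l := #|[set x | F x == w ^+ l]|.
have one_l s : forall G : nat -> C, \sum_(l < d | w ^+ s == w ^+ l) G l = G (s %% d)%N.
  move=> G; rewrite (big_pred1 (Ordinal (ltn_pmod s d0))) // => l.
  by rewrite (eq_prim_root_expr pw) (modn_small (ltn_ord l)) eq_sym.
have none G : \sum_(l < d | 0 == w ^+ l) G l = 0 :> C.
  by rewrite big_pred0 // => l; rewrite eq_sym expf_eq0 (negPf w0) andbF.
have NE l : (N l)%:R = \sum_x (F x == w ^+ l)%:R :> C.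
  by rewrite -natr_sum /N -sum1_card big_mkcond; congr _%:R; apply: eq_bigr => x _; rewrite inE.
have SE : \sum_x F x = \sum_(l < d) w ^+ l * (N l)%:R.
  under [RHS]eq_bigr do rewrite NE mulr_sumr.
  rewrite exchange_big /=; apply: eq_bigr => x _.
  transitivity (\sum_(l < d | F x == w ^+ l) w ^+ l); last first.
    by rewrite big_mkcond; apply: eq_bigr => l _; case: eqP; rewrite ?mulr1 ?mulr0.
  have [->|[s ->]] := FE x; first by rewrite none.
  by rewrite (one_l s (fun l => w ^+ l)) (prim_expr_mod pw).
have tot : (#|T| <= \sum_(l < d) N l + z)%N.
  rewrite -(leq_add2l (\sum_(l < d) N l)) in zle; apply: leq_trans zle.
  rewrite -(ler_nat C) natrD natr_sum.
  under [X in _ <= X + _]eq_bigr do rewrite NE.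
  rewrite exchange_big /= -sum1_card -[#|_|]sum1_card [X in _ + X%:R]big_mkcond /=.
  rewrite !natr_sum -big_split /=; apply: ler_sum => x _; rewrite inE.
  rewrite -[X in _ <= X + _](_ : \sum_(l < d | F x == w ^+ l) 1 = _); last first.
    by rewrite big_mkcond; apply: eq_bigr => l _; case: eqP.
  have [->|[s ->]] := FE x; first by rewrite none eqxx add0r.
  by rewrite (one_l s (fun=> 1)) lerDl ler0n.
have dS : d%:R * \sum_x F x = - \sum_(l < d) w ^+ l * (#|T| + B - d * N l)%:R.
  have h : \sum_(l < d) w ^+ l * (#|T| + B)%:R = 0.
    by rewrite -mulr_suml sum_prim_root // mul0r.
  apply/eqP; rewrite -addr_eq0 SE mulr_sumr -big_split /= -[X in _ == X]h.
  by apply/eqP/eq_bigr => l _; rewrite natrB ?cnt // natrM; ring.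
rewrite -(ler_pM2l (_ : 0 < d%:R :> C)) ?ltr0n //.
rewrite -[X in X * `|_|]normr_nat -normrM dS normrN.
apply: le_trans (ler_norm_sum _ _ _) _.
have wn l : `|w ^+ l| = 1 :> C.
  rewrite normrX; suff -> : `|w| = 1 by rewrite expr1n.
  apply/eqP; rewrite -(pexpr_eq1 d0) //.
  by rewrite -normrX (prim_expr_order pw) normr1.
under eq_bigr do rewrite normrM wn mul1r normr_nat.
rewrite -natr_sum -natrM ler_nat.
have : (\sum_(l < d) (#|T| + B - d * N l) + d * \sum_(l < d) N l = d * (#|T| + B))%N.
  rewrite big_distrr -big_split /= -[d in RHS]card_ord -sum_nat_const.
  by apply: eq_bigr => l _; rewrite subnK // cnt.
move: tot; set X := (\sum_(l < d) (_ - _))%N; set Y := (\sum_(l < d) _)%N.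
rewrite -(leq_pmul2l d0) !mulnDr; clear; lia.
Qed.

Definition weil_const (m d : nat) : nat := (stepanov_const m d + m)%N.

Lemma frob_half_gt0 (k : finFieldType) (p : nat) :
  p \in [pchar k] -> (0 < frob_half p #|k|)%N.
Proof. by move=> pk; rewrite expn_gt0 prime_gt0 // (pcharf_prime pk). Qed.

Lemma weil_bound_normalized (C : numDomainType) (k : finFieldType) (p d m : nat)
    (psi : k -> C) (f : {poly k}) :
  p \in [pchar k] -> (1 < d)%N -> cyclic_char d psi ->
  f.[0] = 1 -> (size f <= m.+1)%N ->
  (forall r h, (0 < r < d)%N -> f ^+ r <> h ^+ d) ->
  `|\sum_x psi f.[x]| <= (weil_const m d * frob_half p #|k|)%:R.
Proof.
move=> pk d1 cpsi f1 sf irr.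
have f0 : f != 0.
  by apply/eqP => f0; move: f1; rewrite f0 horner0 => /esym/eqP; rewrite oner_eq0.
have d0 := ltnW d1.
have dq := cyclic_char_dvd cpsi.
have [g [w [gen pw psi0 psig]]] := cpsi.
have g0 : g != 0.
  apply: contraTneq pw => g0; have := psig 1%N; rewrite !expr1 g0 psi0 => <-.
  apply/negP => /prim_expr_order/eqP.
  by rewrite expr0n gtn_eqF //= eq_sym oner_eq0.
have w0 s : w ^+ s != 0.
  by rewrite -normr_eq0 -psig (cyclic_char_norm cpsi) ?oner_eq0 ?expf_neq0.
have le1 : `|\sum_x psi f.[x]| <= (stepanov_const m d * frob_half p #|k| + m)%:R.
  apply: (char_sum_of_counts d1 pw).
  - move=> x; have [->|/gen[s ->]] := eqVneq f.[x] 0; first by left.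
    by right; exists s.
  - apply: leq_trans (card_roots_leq f0 sf); apply/subset_leq_card/fintype.subsetP => x.
    rewrite !inE; apply: contraLR => /(cyclic_char_norm cpsi) h.
    by rewrite -normr_eq0 h oner_eq0.
  - move=> l.
    (* The fibre over w^l is contained in the set where f^((q-1)/d) takes the value
       (g^((q-1)/d))^l. *)
    apply: leq_trans (stepanov_bound ((g ^+ (#|k|.-1 %/ d)) ^+ l) pk d0 dq f1 sf irr).
    rewrite leq_mul2l; apply/orP; right; apply/subset_leq_card/fintype.subsetP => x.
    rewrite !inE; have [->|/gen[s ->]] := eqVneq f.[x] 0.
      by rewrite psi0 eq_sym (negPf (w0 l)).
    rewrite psig (eq_prim_root_expr pw) => /eqP sl.
    rewrite [(g ^+ s) ^+ _]exprAC; set c := g ^+ (_ %/ _).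
    have cd : c ^+ d = 1.
      rewrite -exprM divnK //; apply: (mulfI g0).
      rewrite -exprS prednK ?expf_card ?mulr1 //.
      by apply/card_gt0P; exists 0.
    by rewrite -(expr_mod s cd) sl (expr_mod _ cd).
apply: le_trans le1 _.
rewrite ler_nat /weil_const mulnDl leq_add2l leq_pmulr //.
exact: frob_half_gt0.
Qed.

Lemma stepanov_const_mono (m d d' : nat) :
  (d' <= d)%N -> (stepanov_const m d' <= stepanov_const m d)%N.
Proof.
move=> le; rewrite /stepanov_const leq_mul // !leq_add2r leq_add //.
  by rewrite leq_mul2r leq_mul2l le !orbT.
by rewrite leq_mul2l le orbT.
Qed.

(** Strong induction on d. If f = c h^e with 1 < e dividing d, then psi(f) = psi(c) psi^e(h), where
    psi^e has the smaller order d / e. Otherwise translation and scaling normalize f(0) = 1, and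
    [power_dvd_root] excludes f^r = h^d for 0 < r < d. *)
Lemma weil_bound (C : numDomainType) (k : finFieldType) (p d m : nat)
    (psi : k -> C) (f : {poly k}) :
  p \in [pchar k] -> cyclic_char d psi -> (size f <= m.+1)%N ->
  (forall c h, f <> c *: h ^+ d) ->
  `|\sum_x psi f.[x]| <= (weil_const m d * frob_half p #|k|)%:R.
Proof.
move=> pk; elim/ltn_ind: d psi f => d IH psi f cpsi sf npow.
have f0 : f != 0 by apply/eqP => f0; apply: (npow 0 0); rewrite scale0r.
have d0 := cyclic_char_gt0 cpsi.
have d1 : (1 < d)%N.
  rewrite ltn_neqAle d0 andbT eq_sym; apply/eqP => d1.
  by apply: (npow 1 f); rewrite d1 scale1r expr1.
have Q0 := frob_half_gt0 pk.
have [[e [c [h [e1 ed fE]]]]|noe] :=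
  pselect (exists e c h, [/\ (1 < e)%N, (e %| d)%N & f = c *: h ^+ e]).
  have e0 := ltnW e1.
  have := cyclic_char_pow e0 ed cpsi; set psi' := (fun x => psi x ^+ e) => cpsi'.
  have ded : (d %/ e < d)%N by rewrite ltn_Pdiv.
  have c0 : c != 0 by apply: contraNneq f0 => c0; rewrite fE c0 scale0r.
  have h0 : h != 0.
    by apply: contraNneq f0 => h0; rewrite fE h0 expr0n gtn_eqF // scaler0.
  have -> : \sum_x psi f.[x] = psi c * \sum_x psi' h.[x].
    rewrite mulr_sumr; apply: eq_bigr => x _.
    by rewrite fE hornerZ horner_exp (cyclic_charM cpsi) (cyclic_charX cpsi).
  rewrite normrM (cyclic_char_norm cpsi c0) mul1r.
  apply: le_trans (IH _ ded psi' h cpsi' _ _) _.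
  - apply: leq_trans sf; rewrite fE size_scale // -(prednK e0) exprS.
    by rewrite size_proper_mul ?mulf_neq0 ?lead_coef_eq0 ?expf_neq0 //
      [X in (_ <= (_ + X).-1)%N]polySpred ?expf_neq0 // addnS leq_addr.
  - move=> c' h' hE; apply: (npow (c * c' ^+ e) h').
    by rewrite fE hE exprZn scalerA -exprM divnK.
  - rewrite ler_nat leq_mul2r leq_add2r stepanov_const_mono ?orbT //.
    exact: ltnW.
(* If q <= m the trivial bound suffices; if q > m, then f, having at most m roots, is nonzero at
   some point x0 of k. *)
have [qm|qm] := leqP #|k| m.
  apply: le_trans (ler_norm_sum _ _ _) _.
  apply: (@le_trans _ _ (\sum_(x : k) 1)).
    by apply: ler_sum => x _; apply: cyclic_char_norm_le1 cpsi _.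
  rewrite sumr_const ler_nat; apply: leq_trans qm _.
  rewrite /weil_const; apply: leq_trans (leq_pmulr _ Q0).
  exact: leq_addl.
have /fintype.subsetPn [x0 _ fx0] : ~~ ([set: k] \subset [set x : k | f.[x] == 0%R]).
  apply: contraTN qm => /subset_leq_card; rewrite cardsT -leqNgt => /leq_trans; apply.
  exact: card_roots_leq.
rewrite inE in fx0.
pose f' := f.[x0]^-1 *: (f \Po ('X + x0%:P)).
have f'x x : f'.[x] = f.[x0]^-1 * f.[x + x0].
  by rewrite hornerZ horner_comp !hornerE.
have -> : \sum_x psi f.[x] = psi f.[x0] * \sum_x psi f'.[x].
  rewrite mulr_sumr (reindex_inj (addIr x0)) /=; apply: eq_bigr => x _.
  by rewrite f'x -(cyclic_charM cpsi) mulVKf.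
rewrite normrM (cyclic_char_norm cpsi fx0) mul1r.
have f'0 : f'.[0] = 1 by rewrite f'x add0r mulVf.
apply: weil_bound_normalized => //.
- rewrite size_scale ?invr_eq0 // size_comp_poly2 // size_XaddC //.
- move=> r h rd f'rh.
  have f'n0 : f' != 0.
    apply/eqP => e0; move: f'0; rewrite e0 horner0 => /esym/eqP.
    by rewrite oner_eq0.
  have [e [c [g [e1 ed gE]]]] := power_dvd_root f'n0 rd f'rh; apply: noe.
  exists e, (f.[x0] * c), (g \Po ('X - x0%:P)); split => //.
  transitivity (f.[x0] *: (f' \Po ('X - x0%:P))).
    rewrite comp_polyZ scalerA mulfV // scale1r -comp_polyA comp_polyD comp_polyX.
    by rewrite comp_polyC subrK comp_polyXr.
  by rewrite gE comp_polyZ scalerA rmorphXn.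
Qed.

(** * Character sums in several variables *)

Section MPolyUniIso.
Variables (K : fieldType) (n : nat).

(** The inverse of [muni]: the univariate indeterminate becomes the last variable. *)
Definition mfold (P : {poly {mpoly K[n]}}) : {mpoly K[n.+1]} :=
  (map_poly (@mwiden n K) P).['X_ord_max].

Lemma mfoldM P Q : mfold (P * Q) = mfold P * mfold Q.
Proof. by rewrite /mfold rmorphM hornerM. Qed.

Lemma mfoldD P Q : mfold (P + Q) = mfold P + mfold Q.
Proof. by rewrite /mfold rmorphD hornerD. Qed.

Lemma mfoldC c : mfold c%:P = mwiden c.
Proof. by rewrite /mfold map_polyC hornerC. Qed.

Lemma mfold0 : mfold 0 = 0.
Proof. by rewrite /mfold rmorph0 horner0. Qed.

Lemma mfold1 : mfold 1 = 1.
Proof. by rewrite /mfold rmorph1 hornerC. Qed.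

Lemma mfoldX P m : mfold (P ^+ m) = mfold P ^+ m.
Proof. by elim: m => [|m IH]; rewrite ?expr0 ?mfold1 // !exprS mfoldM IH. Qed.

Lemma muniK : cancel (@muni n K) mfold.
Proof.
move=> p; rewrite [in LHS]muniE /mfold rmorph_sum horner_sum [RHS]mpolyE.
apply: eq_bigr => m _.
rewrite /= map_polyZ /= map_polyXn hornerZ hornerXn mwidenZ mwidenX -scalerAl.
congr (_ *: _); rewrite mpolyXn -mpolyXD; congr ('X_[ _ ]).
apply/mnmP => i; rewrite mnmDE mulmnE mnm1E.
case: (unliftP ord_max i) => [j ->|->].
  have -> : lift ord_max j = widen_ord (leqnSn n) j.
    by apply: val_inj; rewrite /= /bump leqNgt ltn_ord.
  rewrite mnmwiden_widen mnmE (_ : (_ == _) = false) ?mul0n ?addn0 //.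
  by apply/eqP => /(congr1 val) /= e; have := ltn_ord j; rewrite -e ltnn.
by rewrite mnmwiden_ordmax eqxx mul1n.
Qed.

Lemma muni_mwiden (c : {mpoly K[n]}) : muni (mwiden c) = c%:P.
Proof.
elim/mpolyind: c => [|a m p _ _ IH]; first by rewrite !rmorph0.
rewrite mwidenD muniD IH polyCD; congr (_ + _).
rewrite mwidenZ muniZ mwidenX muniE msuppX big_seq1 mcoeffX eqxx scale1r.
rewrite mnmwiden_ordmax expr0 alg_polyC -mul_polyC -rmorphM mul_mpolyC.
congr (polyC (_ *: 'X_[ _ ])); apply/mnmP => i.
by rewrite mnmE mnmwiden_widen.
Qed.

Lemma muni_Xmax : muni ('X_ord_max : {mpoly K[n.+1]}) = 'X.
Proof.
rewrite muniE msuppX big_seq1 mcoeffX eqxx scale1r mnm1E eqxx expr1.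
rewrite (_ : [multinom _ | _ < _] = 0%MM) ?mpolyX0 ?scale1r //.
apply/mnmP => i; rewrite mnmE mnm1E mnm0E; case: eqP => // /(congr1 val) /= e.
by have := ltn_ord i; rewrite -e ltnn.
Qed.

Lemma mfoldK : cancel mfold (@muni n K).
Proof.
elim/poly_ind => [|P c IH]; first by rewrite mfold0 rmorph0.
rewrite mfoldD mfoldM mfoldC rmorphD rmorphM /= IH muni_mwiden.
by rewrite /mfold map_polyX hornerX muni_Xmax.
Qed.

Lemma size_muni (p : {mpoly K[n.+1]}) : (size (muni p) <= msize p)%N.
Proof.
rewrite muniE; apply: leq_trans (size_sum _ _ _) _.
apply/bigmax_leqP_seq => m mp _.
apply: leq_trans (size_scale_leq _ _) _; rewrite size_polyXn.
apply: leq_trans (msize_mdeg_lt mp); rewrite ltnS mdegE.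
by rewrite (bigD1 ord_max) //= leq_addr.
Qed.

Lemma msize_coef_muni (p : {mpoly K[n.+1]}) i : (msize (muni p)`_i <= msize p)%N.
Proof.
rewrite muniE coef_sum; apply: leq_trans (msize_sum _ _ _) _.
apply/bigmax_leqP_seq => m mp _; rewrite coefZ coefXn.
case: eqP => _; rewrite ?mulr0 ?msize0 // mulr1.
apply: leq_trans (msizeZ_le _ _) _; rewrite msizeX.
apply: leq_trans (msize_mdeg_lt mp); rewrite ltnS !mdegE big_ord_recr /=.
by apply: leq_trans (leq_addr _ _); apply: leq_sum => j _; rewrite mnmE.
Qed.

Definition row_rcons (x : 'rV[K]_n) (t : K) : 'rV[K]_n.+1 :=
  \row_i (if unlift ord_max i is Some j then x 0 j else t).

Lemma row_rcons_max x t : row_rcons x t 0 ord_max = t.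
Proof. by rewrite mxE unlift_none. Qed.

Lemma row_rcons_widen x t i : row_rcons x t 0 (widen_ord (leqnSn n) i) = x 0 i.
Proof.
rewrite mxE (_ : widen_ord _ i = lift ord_max i) ?liftK //.
by apply: val_inj; rewrite /= /bump leqNgt ltn_ord.
Qed.

Lemma meval_row_rcons (p : {mpoly K[n.+1]}) x t :
  p.@[row_rcons x t 0] = (map_poly (meval (x 0)) (muni p)).[t].
Proof.
rewrite muniE rmorph_sum horner_sum mevalE; apply: eq_bigr => m _.
rewrite /= map_polyZ /= map_polyXn hornerZ hornerXn mevalZ mevalX -mulrA.
rewrite big_ord_recr /= row_rcons_max; congr (_ * (_ * _)).
by apply: eq_bigr => i _; rewrite row_rcons_widen mnmE.
Qed.

End MPolyUniIso.

Lemma sum_row_rcons (k : finFieldType) (n : nat) (V : nmodType)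
    (F : 'rV[k]_n.+1 -> V) :
  \sum_x F x = \sum_(x : 'rV[k]_n) \sum_(t : k) F (row_rcons x t).
Proof.
rewrite pair_bigA /= (reindex (fun xt : 'rV[k]_n * k => row_rcons xt.1 xt.2)) //=.
exists (fun x : 'rV[k]_n.+1 => (\row_i x 0 (widen_ord (leqnSn n) i), x 0 ord_max)).
  move=> [x t] _ /=; rewrite row_rcons_max; congr (_, _).
  by apply/rowP => i; rewrite mxE row_rcons_widen.
move=> x _; apply/rowP => i /=.
case: (unliftP ord_max i) => [j ->|->]; last by rewrite row_rcons_max.
have -> : lift ord_max j = widen_ord (leqnSn n) j.
  by apply: val_inj; rewrite /= /bump leqNgt ltn_ord.
by rewrite row_rcons_widen mxE.
Qed.

(** Induction on the last variable: where the leading coefficient vanishes the fibre has at most q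
    points, elsewhere at most deg P. Both sides carry a factor q so that the exponent n - 1 does not
    occur. *)
Lemma schwartz_zippel (k : finFieldType) (n : nat) (P : {mpoly k[n]}) :
  P != 0 ->
  (#|[set x : 'rV[k]_n | P.@[x 0%R] == 0%R]| * #|k| <= n * msize P * #|k| ^ n)%N.
Proof.
elim: n P => [|n IH] P P0.
  rewrite (_ : [set _ | _] = finset.set0) ?cards0 //; apply/setP => x.
  rewrite !inE; apply/negbTE; apply: contra P0.
  by rewrite (nvar0_mpolyC P) mevalC mpolyC_eq0.
set G := muni P.
have G0 : G != 0 by apply: contraNneq P0 => G0; rewrite -(muniK P) -/G G0 mfold0.
set a := lead_coef G; have a0 : a != 0 by rewrite lead_coef_eq0.
have sG : (size G <= msize P)%N := size_muni P.
have sa : (msize a <= msize P)%N := msize_coef_muni P _.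
pose Z := [set x : 'rV[k]_n | a.@[x 0%R] == 0%R].
have {}IH : (#|Z| * #|k| <= n * msize P * #|k| ^ n)%N.
  by apply: leq_trans (IH a a0) _; rewrite leq_mul2r leq_mul2l sa !orbT.
have q0 : (0 < #|k|)%N by apply/card_gt0P; exists 0.
have fiber (x : 'rV[k]_n) :
    (\sum_(t : k) (P.@[row_rcons x t 0] == 0)%R <= (x \in Z) * #|k| + msize P)%N.
  have [xZ|xZ] := boolP (x \in Z).
    rewrite mul1n; apply: leq_trans (leq_addr _ _).
    by rewrite -[leqRHS]sum1_card; apply: leq_sum => t _; case: eqP.
  rewrite mul0n add0n.
  have Gx0 : map_poly (meval (x 0)) G != 0.
    apply: contraNneq xZ => Gx0; rewrite inE.
    by have := coef_map (meval (x 0)) G (size G).-1; rewrite Gx0 coef0 => /= <-.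
  have sGx : (size (map_poly (meval (x 0%R)) G) <= (msize P).+1)%N.
    by apply: leq_trans (size_poly _ _) _; apply: leqW.
  apply: leq_trans (card_roots_leq Gx0 sGx).
  rewrite -sum1_card [leqRHS]big_mkcond /=; apply: leq_sum => t _.
  by rewrite inE meval_row_rcons.
have -> : #|[set x : 'rV[k]_n.+1 | P.@[x 0%R] == 0%R]| =
    (\sum_(x : 'rV[k]_n) \sum_(t : k) (P.@[row_rcons x t 0] == 0)%R)%N.
  rewrite -(sum_row_rcons (fun x => (P.@[x 0] == 0) : nat)) -sum1_card big_mkcond /=.
  by apply: eq_bigr => x _; rewrite inE; case: eqP.
apply: (@leq_trans (\sum_(x : 'rV[k]_n) ((x \in Z) * #|k| + msize P) * #|k|)%N).
  by rewrite -big_distrl leq_mul2r leq_sum ?orbT // => x _; apply: fiber.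
rewrite -big_distrl /= big_split /= -big_distrl /= sum_nat_const.
rewrite [#|_|]card_mx mul1n.
have -> : (\sum_(x : 'rV[k]_n) (x \in Z) = #|Z|)%N.
  by rewrite -sum1_card [RHS]big_mkcond; apply: eq_bigr => x _; case: ifP.
rewrite expnS [(#|k| * _)%N]mulnC mulnA leq_mul2r; apply/orP; right.
rewrite mulSn mulnDl addnC [(_ * msize P)%N]mulnC -/(_ + _)%N.
by rewrite leq_add2l.
Qed.

(** * Truncated d-th roots of monic polynomials *)

Lemma size_monic_pow (A : idomainType) (e m : nat) (h : {poly A}) :
  h \is monic -> size h = e.+1 -> size (h ^+ m) = (e * m).+1.
Proof.
move=> mh sh; rewrite -[LHS]prednK ?size_exp ?sh //.
by rewrite size_poly_gt0 expf_neq0 ?monic_neq0.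
Qed.

Lemma size_monic_sub (A : nzRingType) (N : nat) (P Q : {poly A}) :
  P \is monic -> Q \is monic -> size P = N.+1 -> size Q = N.+1 ->
  (size (P - Q)%R <= N)%N.
Proof.
move=> /monicP mP /monicP mQ sP sQ; apply/leq_sizeP => j.
rewrite leq_eqVlt coefB => /predU1P[<-|Nj].
  by move: mP mQ; rewrite !lead_coefE sP sQ /= => -> ->; rewrite subrr.
by rewrite !nth_default ?subrr ?sP ?sQ.
Qed.

Section MonicPowers.
Variables (A : idomainType) (d e : nat).
Implicit Types h : {poly A}.

(** The cofactor of h1 - h2 in h1^d - h2^d. For monic h1, h2 of degree e it is a sum of d monic
    polynomials of degree e (d - 1), whence its top coefficient d. *)
Definition cofactor_sum h1 h2 := \sum_(i < d) h1 ^+ (d.-1 - i) * h2 ^+ i.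

Lemma cofactor_sumP h1 h2 :
  h1 \is monic -> h2 \is monic -> size h1 = e.+1 -> size h2 = e.+1 ->
  (size (cofactor_sum h1 h2) <= (e * d.-1).+1)%N /\
  (cofactor_sum h1 h2)`_(e * d.-1) = d%:R.
Proof.
move=> m1 m2 s1 s2.
have mon i : h1 ^+ (d.-1 - i) * h2 ^+ i \is monic by rewrite rpredM ?rpredX.
have sz (i : 'I_d) : size (h1 ^+ (d.-1 - i) * h2 ^+ i) = (e * d.-1).+1.
  rewrite size_Mmonic ?monic_neq0 ?rpredX //.
  rewrite (size_monic_pow _ m1 s1) (size_monic_pow _ m2 s2).
  rewrite addnS /= addSn -mulnDr subnK //.
  by rewrite -ltnS prednK // (leq_ltn_trans _ (ltn_ord i)).
split.
  by apply: leq_trans (size_sum _ _ _) _; apply/bigmax_leqP => i _; rewrite sz.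
rewrite coef_sum (eq_bigr (fun=> 1)) ?sumr_const ?card_ord // => i _.
by have /monicP := mon i; rewrite lead_coefE sz.
Qed.

(** If h1 and h2 differ, h1^d - h2^d is a nonzero multiple of a polynomial of degree e (d - 1), so
    it cannot have smaller degree. This makes the truncated d-th root unique. *)
Lemma monic_pow_close h1 h2 :
  d%:R != 0 :> A -> h1 \is monic -> h2 \is monic ->
  size h1 = e.+1 -> size h2 = e.+1 ->
  (size (h1 ^+ d - h2 ^+ d)%R <= e * d.-1)%N -> h1 = h2.
Proof.
move=> d0 m1 m2 s1 s2; rewrite subrXX -/(cofactor_sum h1 h2) => sz.
have [sC cC] := cofactor_sumP m1 m2 s1 s2.
set T := cofactor_sum h1 h2 in sz sC cC.
apply/eqP; rewrite -subr_eq0; apply: contraTT sz => h0.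
have T0 : T != 0 by apply: contraNneq d0 => T0; rewrite -cC T0 coef0.
have sT : (e * d.-1 < size T)%N.
  by rewrite ltnNge; apply: contraNN d0 => /leq_sizeP/(_ _ (leqnn _)) <-; rewrite cC.
rewrite -ltnNge size_mul //; apply: (leq_trans sT).
by rewrite -(prednK (_ : 0 < size (h1 - h2)%R)%N) ?size_poly_gt0 // addSn leq_addl.
Qed.

End MonicPowers.

Definition coef_bounded (K : fieldType) (n B : nat) (P : {poly {mpoly K[n]}}) :=
  forall i, (msize (P`_i)%R <= B)%N.

Section CoefBounded.
Variables (K : fieldType) (n : nat).
Implicit Types P Q : {poly {mpoly K[n]}}.

Lemma coef_bounded_leq B B' P : (B <= B')%N -> coef_bounded B P -> coef_bounded B' P.
Proof. by move=> le bP i; apply: leq_trans (bP i) le. Qed.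

Lemma coef_boundedD B P Q : coef_bounded B P -> coef_bounded B Q -> coef_bounded B (P + Q).
Proof.
by move=> bP bQ i; rewrite coefD; apply: leq_trans (msizeD_le _ _) _; rewrite geq_max bP bQ.
Qed.

Lemma coef_boundedN B P : coef_bounded B P -> coef_bounded B (- P).
Proof. by move=> bP i; rewrite coefN msizeN. Qed.

Lemma coef_boundedM B B' P Q :
  coef_bounded B P -> coef_bounded B' Q -> coef_bounded (B + B') (P * Q).
Proof.
move=> bP bQ i; rewrite coefM; apply: leq_trans (msize_sum _ _ _) _.
apply/bigmax_leqP => j _.
have [->|p0] := eqVneq P`_j 0; first by rewrite mul0r msize0.
have [->|q0] := eqVneq Q`_(i - j) 0; first by rewrite mulr0 msize0.
by rewrite msizeM //; apply: leq_trans (leq_pred _) _; apply: leq_add.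
Qed.

Lemma coef_boundedX B P m : coef_bounded B P -> coef_bounded (B * m).+1 (P ^+ m).
Proof.
move=> bP; elim: m => [|m IH].
  by move=> i; rewrite muln0 expr0 coef1; case: (i == 0%N); rewrite ?msize1 ?msize0.
by rewrite exprS mulnS -addnS; apply: coef_boundedM.
Qed.

Lemma coef_boundedMXn B (c : {mpoly K[n]}) j :
  (msize c <= B)%N -> coef_bounded B (c *: 'X^j).
Proof. by move=> cB i; rewrite coefZ coefXn; case: eqP; rewrite ?mulr1 ?mulr0 ?msize0. Qed.

End CoefBounded.

(** Growth of the coefficients along the recursion of [truncated_root]: each step adds to h a
    coefficient taken from G - h^d. *)
Fixpoint root_bound (d D i : nat) : nat :=
  if i is i'.+1 then (D + (root_bound d D i' * d).+1 + root_bound d D i')%N else 1%N.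

(** The root is corrected one coefficient at a time, from the top down. Only d is inverted, so the
    coefficients remain polynomials, of degree bounded in terms of d, D and i. *)
Lemma truncated_root (K : fieldType) (n d e D i : nat) (G : {poly {mpoly K[n]}}) :
  d%:R != 0 :> K -> G \is monic -> size G = (d * e).+1 -> coef_bounded D G ->
  (i <= e)%N ->
  exists h, [/\ h \is monic, size h = e.+1, coef_bounded (root_bound d D i) h &
    (size (G - h ^+ d)%R <= d * e - i)%N].
Proof.
move=> dK mG sG bG; have d0 : (0 < d)%N by case: d dK {sG} => [|//]; rewrite eqxx.
elim: i => [_|i IH ie].
  exists 'X^e; rewrite monicXn size_polyXn; split => //.
    by rewrite -[X in coef_bounded _ X]scale1r; apply: coef_boundedMXn; rewrite msize1.
  rewrite subn0 mulnC; apply: size_monic_sub => //.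
  - by apply: rpredX; apply: monicXn.
  - by rewrite sG mulnC.
  - by apply: size_monic_pow; rewrite ?monicXn ?size_polyXn.
have [h [mh sh bh sz]] := IH (ltnW ie).
(* Adding c X^j to h changes h^d by c X^j times a cofactor with top coefficient d in degree e (d -
   1); dividing the leading error coefficient by d therefore cancels it. *)
set j := (e - i.+1)%N; set c := (d%:R^-1)%:MP * (G - h ^+ d)`_(d * e - i.+1).
have ce : (e + e * d.-1 = d * e)%N by rewrite -mulnS prednK // mulnC.
have jE : (d * e - i.+1 = j + e * d.-1)%N by rewrite -ce -addnBAC.
have bc : (msize c <= D + (root_bound d D i * d).+1)%N.
  rewrite /c mul_mpolyC; apply: leq_trans (msizeZ_le _ _) _.
  have b1 : coef_bounded (D + (root_bound d D i * d).+1) G.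
    by apply: coef_bounded_leq bG; apply: leq_addr.
  have b2 : coef_bounded (D + (root_bound d D i * d).+1) (h ^+ d).
    by apply: coef_bounded_leq (coef_boundedX d bh); apply: leq_addl.
  exact: (coef_boundedD b1 (coef_boundedN b2)).
have sc : (size (c *: 'X^j)%R <= e)%N.
  apply: leq_trans (size_scale_leq _ _) _; rewrite size_polyXn.
  by rewrite /j -subSn // subSS leq_subr.
have sh' : size (h + c *: 'X^j) = e.+1 by rewrite size_polyDl sh.
have mh' : h + c *: 'X^j \is monic by rewrite monicE lead_coefDl ?sh // -monicE.
exists (h + c *: 'X^j); split => //.
  apply: coef_boundedD.
    by apply: coef_bounded_leq bh; apply: leq_addl.
  by apply: coef_boundedMXn; apply: leq_trans bc _; apply: leq_addr.
have [sC cC] := cofactor_sumP d mh' mh sh' sh.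
set T := cofactor_sum _ _ _ in sC cC.
have -> : G - (h + c *: 'X^j) ^+ d = (G - h ^+ d) - c *: ('X^j * T).
  rewrite -[X in G - X](subrK (h ^+ d)) subrXX -/(cofactor_sum _ _ _) -/T.
  by rewrite [h + _]addrC addrK -scalerAl; ring.
apply/leq_sizeP => l; rewrite jE leq_eqVlt coefB coefZ coefXnM => /predU1P[<-|lt].
  rewrite ltnNge leq_addr /= addKn cC /c -jE mulrAC -mpolyC_nat.
  by rewrite -mpolyCM mulVf // mpolyC1 mul1r subrr.
have -> : (G - h ^+ d)`_l = 0.
  apply: nth_default; apply: leq_trans sz _; apply: leq_trans lt; rewrite -jE.
  by move: (d * e)%N => N; clear; lia.
case: ifP => _; first by rewrite mulr0 subr0.
rewrite (nth_default _ (s := T)) ?mulr0 ?subr0 //.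
by apply: leq_trans sC _; rewrite ltn_subRL.
Qed.

(** * Recognizing scaled d-th powers *)

Section Monicize.
Variable A : comNzRingType.

(* a^(N-1) G(t / a) for G of degree N with leading coefficient a *)
Definition monicize (N : nat) (G : {poly A}) : {poly A} :=
  \poly_(i < N.+1) (if i == N then 1 else G`_N ^+ (N.-1 - i) * G`_i).

Lemma size_monicize N G : size (monicize N G) = N.+1.
Proof. by rewrite size_poly_eq // eqxx oner_eq0. Qed.

Lemma monicize_monic N G : monicize N G \is monic.
Proof. by rewrite monicE lead_coefE size_monicize coef_poly ltnS leqnn eqxx. Qed.

Lemma comp_scaleX (P : {poly A}) (a : A) (N : nat) : (size P <= N)%N ->
  P \Po (a *: 'X) = \poly_(i < N) (P`_i * a ^+ i).
Proof.
move=> sP; rewrite comp_polyE (big_ord_widen _ (fun i => P`_i *: (a *: 'X) ^+ i) sP).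
rewrite big_mkcond poly_def; apply: eq_bigr => i _.
rewrite exprZn scalerA; case: ifP => // /negbT; rewrite -leqNgt => h.
by rewrite nth_default // mul0r scale0r.
Qed.

Lemma monicizeP N (G : {poly A}) : (size G <= N.+1)%N ->
  G`_N ^+ N *: G = G`_N *: (monicize N G \Po (G`_N *: 'X)).
Proof.
move=> sG; rewrite (comp_scaleX _ (N := N.+1)) ?size_monicize //.
apply/polyP => i; rewrite !coefZ !coef_poly.
case: ltnP => iN; last by rewrite [G`_i]nth_default ?mulr0 //; apply: leq_trans iN.
case: eqP => [->|/eqP neq]; first by rewrite mul1r mulrC.
have lt : (i < N)%N by rewrite ltn_neqAle neq -ltnS.
rewrite mulrAC -exprD mulrA -exprS; congr (_ ^+ _ * _).
by case: N lt {sG iN neq} => [//|N]; rewrite ltnS /= => le; rewrite subnK.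
Qed.

End Monicize.

Lemma monicize_map (A B : comNzRingType) (f : {rmorphism A -> B}) N (G : {poly A}) :
  map_poly f (monicize N G) = monicize N (map_poly f G).
Proof.
apply/polyP => i; rewrite coef_map [in LHS]coef_poly [RHS]coef_poly !coef_map.
case: ifP => _; last exact: rmorph0.
case: eqP => _; first exact: rmorph1.
by rewrite [LHS]rmorphM; congr (_ * _); apply: rmorphXn.
Qed.

(** If g were c u^d, then [monicize] of g would be a constant times a d-th power and, being monic,
    the d-th power of a monic w. Both w^d and h^d are then close enough for [monic_pow_close] to
    give w = h, against the hypothesis. *)
Lemma not_scaled_power (k : fieldType) (d e : nat) (g h : {poly k}) :
  d%:R != 0 :> k -> size g = (d * e).+1 -> h \is monic -> size h = e.+1 ->
  (size (monicize (d * e) g - h ^+ d)%R <= d * e - e)%N ->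
  monicize (d * e) g != h ^+ d -> forall c u, g <> c *: u ^+ d.
Proof.
move=> dk sg mh sh close neq c u gE.
have d0 : (0 < d)%N by case: d dk {sg close neq gE} => [|//]; rewrite eqxx.
have g0 : g != 0 by rewrite -size_poly_gt0 sg.
set N := (d * e)%N in sg close neq.
set a := g`_N; have a0 : a != 0 by rewrite -lead_coef_eq0 lead_coefE sg in g0.
have := @monicizeP _ N g; rewrite sg -/a => /(_ (leqnn _)) mE.
pose v := u \Po (a^-1 *: 'X).
have m1 : monicize N g = (a^-1 * a ^+ N * c) *: v ^+ d.
  have : monicize N g \Po (a *: 'X) = (a^-1 * a ^+ N * c) *: u ^+ d.
    by rewrite -!scalerA -gE mE scalerA mulVf ?scale1r.
  move/(congr1 (fun P => P \Po (a^-1 *: 'X))).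
  rewrite comp_polyZ rmorphXn /= -comp_polyA comp_polyZ comp_polyX.
  by rewrite scalerA mulfV // scale1r comp_polyXr.
set c' := _ * c in m1.
have v0 : v != 0.
  apply: contraTneq (monicize_monic N g) => v0.
  by rewrite m1 v0 expr0n gtn_eqF // scaler0 monicE lead_coef0 eq_sym oner_eq0.
pose w := (lead_coef v)^-1 *: v.
have lv0 : lead_coef v != 0 by rewrite lead_coef_eq0.
have mw : w \is monic by rewrite monicE lead_coefZ mulVf.
have m2 : monicize N g = w ^+ d.
  have vE : v = lead_coef v *: w by rewrite scalerA mulfV ?scale1r.
  have m3 : monicize N g = (c' * lead_coef v ^+ d) *: w ^+ d.
    by rewrite m1 {1}vE exprZn scalerA.
  have := monicize_monic N g; rewrite monicE m3 lead_coefZ.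
  have /monicP -> : w ^+ d \is monic by apply: rpredX.
  by rewrite mulr1 => /eqP ->; rewrite scale1r.
have sw : size w = e.+1.
  have := size_exp w d; rewrite -m2 size_monicize /= /N mulnC => /eqP.
  rewrite eqn_pmul2r // => /eqP ->; rewrite prednK // size_poly_gt0.
  exact: monic_neq0.
move/negP: neq; apply; rewrite m2; apply/eqP; congr (_ ^+ _).
apply: (monic_pow_close dk mw mh sw sh); rewrite -m2.
by apply: leq_trans close _; rewrite /N -(prednK d0) mulSn addKn mulnC.
Qed.

Lemma scaled_power_dvd_degree (k : fieldType) (d N : nat) (g : {poly k}) c u :
  size g = N.+1 -> g = c *: u ^+ d -> (d %| N)%N.
Proof.
move=> sg gE.
have c0 : c != 0.
  by apply: contra_eq_neq sg => c0; rewrite gE c0 scale0r size_poly0.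
have := size_exp u d; rewrite -(size_scale _ c0) -gE sg /= => ->.
exact: dvdn_mull.
Qed.

Lemma map_mpoly_mwiden (R S : nzRingType) (f : {rmorphism R -> S}) n (P : {mpoly R[n]}) :
  map_mpoly f (mwiden P) = mwiden (map_mpoly f P).
Proof.
elim/mpolyind: P => [|c m P _ _ IH]; first by rewrite !rmorph0.
by rewrite !rmorphD /= IH mwidenZ !map_mpolyZ mwidenZ mwidenX !map_mpolyX mwidenX.
Qed.

Lemma norm_sum_exceptional (C : numDomainType) (T : finType) (Z : {set T})
    (s : T -> C) (q w : nat) :
  (forall x, x \in Z -> `|s x| <= q%:R) ->
  (forall x, x \notin Z -> `|s x| <= w%:R) ->
  `|\sum_x s x| <= (#|Z| * q + #|T| * w)%:R.
Proof.
move=> sZ sC; apply: le_trans (ler_norm_sum _ _ _) _.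
apply: (@le_trans _ _ (\sum_x ((x \in Z)%:R * q%:R + w%:R))).
  apply: ler_sum => x _; have [xZ|xZ] := boolP (x \in Z).
    by rewrite mul1r (le_trans (sZ x xZ)) // lerDl.
  by rewrite mul0r add0r sC.
rewrite big_split /= -mulr_suml -natr_sum sumr_const -(mulr_natr w%:R) -!natrM -natrD.
rewrite mulnC [(w * _)%N]mulnC ler_nat leq_add2r mulnC leq_mul2r.
apply/orP; right; rewrite -sum1_card [leqRHS]big_mkcond.
by apply: leq_sum => x _; case: ifP.
Qed.

(** The order d divides q - 1, so it is prime to the characteristic. *)
Lemma char_ndvd_order (C : numDomainType) (k : finFieldType) (d : nat) (psi : k -> C) :
  cyclic_char d psi -> d%:R != 0 :> k.
Proof.
move=> cpsi; have [p pp pk] := finPcharP k.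
rewrite -(dvdn_pcharf pk); apply/negP => pd.
have pq1 : (p %| #|k|.-1)%N by apply: dvdn_trans pd (cyclic_char_dvd cpsi).
have q0 : (0 < #|k|)%N by apply/card_gt0P; exists 0.
have q1 : (1 < #|k|)%N by apply: finNzRing_gt1.
have pq : (p %| #|k|)%N.
  rewrite (card_finField_pchar pk) dvdn_exp //.
  by rewrite lt0n; apply: contraTneq q1 => e; rewrite (card_finField_pchar pk) e.
have : (p %| gcdn #|k| #|k|.-1)%N by rewrite dvdn_gcd pq pq1.
by rewrite (eqP (coprimenP q0)) dvdn1 => /eqP p1; rewrite p1 in pp.
Qed.

Lemma root_bound_mono d D i e : (i <= e)%N -> (root_bound d D i <= root_bound d D e)%N.
Proof.
elim: e => [|e IH]; first by rewrite leqn0 => /eqP ->.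
by rewrite leq_eqVlt => /predU1P[->//|/IH le]; apply: leq_trans le _; rewrite /= leq_addl.
Qed.

Lemma coef_bounded_monicize (K : fieldType) n D N (P : {poly {mpoly K[n]}}) :
  (N <= D)%N -> coef_bounded D P -> coef_bounded (D * D + 1 + D) (monicize N P).
Proof.
move=> ND bP i; rewrite coef_poly; case: ifP => _; last by rewrite msize0.
case: eqP => _; first by rewrite msize1 addn1 addSn.
have [->|p0] := eqVneq P`_i 0; first by rewrite mulr0 msize0.
have [->|q0] := eqVneq (P`_N ^+ (N.-1 - i)) 0; first by rewrite mul0r msize0.
rewrite msizeM //; apply: leq_trans (leq_pred _) _; apply: leq_add (bP i).
have := @coef_boundedX _ _ D (P`_N)%:P (N.-1 - i).
rewrite -rmorphXn => /(_ _ 0%N); rewrite coefC eqxx => h.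
apply: leq_trans (h _) _.
  by move=> [|j]; rewrite coefC //= msize0.
rewrite addn1 ltnS leq_mul2l; apply/orP; right.
by apply: leq_trans ND; apply: leq_trans (leq_subr _ _) (leq_pred _).
Qed.

Lemma map_mpoly_inj (k L : fieldType) n (j : {rmorphism k -> L}) :
  injective (@map_mpoly n k L j).
Proof.
move=> P Q PQ; apply/mpolyP => m; apply: (fmorph_inj j).
by rewrite -!mcoeff_map_mpoly PQ.
Qed.

Lemma map_mpoly_eq0 (k L : fieldType) n (j : {rmorphism k -> L}) (P : {mpoly k[n]}) :
  (map_mpoly j P == 0) = (P == 0).
Proof. exact: (raddf_eq0 _ (@map_mpoly_inj k L n j)). Qed.

Lemma power_quotient (F : fieldType) (W g v t : F) (d e : nat) :
  W != 0 -> W = v ^+ d -> W ^+ (d * e) * g = W * t ^+ d ->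
  g = ((W ^+ e)^-1 * v * t) ^+ d.
Proof.
move=> W0 WE e1; apply: (mulfI (expf_neq0 (d * e) W0)); rewrite e1 !exprMn -WE.
by rewrite exprVn -exprM [(e * d)%N]mulnC !mulrA mulfV ?mul1r // expf_neq0.
Qed.

(** Up to a d-th power G equals a, so a d-th root of a provides one of G. *)
Lemma perfect_power_lead (L k : fieldType) (n d e : nat)
    (j : {rmorphism k -> L}) (G : {mpoly k[n.+1]}) (a : {mpoly k[n]})
    (H : {poly {mpoly k[n]}}) :
  a != 0 -> a ^+ (d * e) *: muni G = a *: H ^+ d ->
  perfect_power d (tofrac (map_mpoly j a)) ->
  perfect_power d (tofrac (map_mpoly j G)).
Proof.
move=> a0 eG [b]; have [b1 [b2 [b20 ->]]] := frac_ratio b => ab.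
pose T := @tofrac {mpoly L[n.+1]}.
pose W := T (mwiden (map_mpoly j a)).
have W0 : W != 0.
  by rewrite tofrac_eq0 (raddf_eq0 _ (@inj_mwiden _ _)) map_mpoly_eq0.
have b2w0 : T (mwiden b2) != 0 by rewrite tofrac_eq0 (raddf_eq0 _ (@inj_mwiden _ _)).
have WE : W = (T (mwiden b1) / T (mwiden b2)) ^+ d.
  apply: (mulIf (expf_neq0 d b2w0)); rewrite expr_div_n divfK ?expf_neq0 //.
  rewrite -!tofracXn -tofracM -!rmorphXn -rmorphM /=; congr (T (mwiden _)).
  apply: (@tofrac_inj {mpoly L[n]}); rewrite rmorphM !rmorphXn /= ab expr_div_n.
  by rewrite divfK // expf_neq0 // tofrac_eq0.
have := congr1 (fun P => T (map_mpoly j (mfold P))) eG.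
rewrite -!mul_polyC !mfoldM !mfoldC muniK mfoldX !rmorphM !rmorphXn /=.
rewrite !map_mpoly_mwiden /T !tofracM !tofracXn -/T -/W => e1.
exists ((W ^+ e)^-1 * (T (mwiden b1) / T (mwiden b2)) * T (map_mpoly j (mfold H))).
exact: power_quotient W0 WE e1.
Qed.

(** Constants have d-th roots in a closed field; this makes the case n = 0 of the character sum
    bound vacuous. *)
Lemma perfect_power0 (L : closedFieldType) d (P : {mpoly L[0]}) :
  (0 < d)%N -> perfect_power d (tofrac P).
Proof.
move=> d0; have [y] := @solve_monicpoly L d (fun i => if i == 0%N then P@_0%MM else 0) d0.
rewrite (bigD1 (Ordinal d0)) //= expr0 mulr1 big1 ?addr0 => [yE|i].
  exists (tofrac y%:MP); rewrite -tofracXn -(rmorphXn (@mpolyC 0 L)) /= yE.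
  by rewrite -nvar0_mpolyC.
by rewrite -val_eqE /= => /negPf ->; rewrite mul0r.
Qed.

(** [B] is chosen before the fields, the character and G, which is the uniformity required.
    [frob_half] replaces sqrt q, and the factor q on the left replaces the exponent n - 1/2. *)
Theorem mpoly_char_sum_bound (p d D n : nat) :
  exists B : nat, forall (C : numDomainType) (k : finFieldType) (L : closedFieldType)
    (j : {rmorphism k -> L}) (psi : k -> C) (G : {mpoly k[n]}),
    p \in [pchar k] -> cyclic_char d psi -> (msize G <= D)%N ->
    ~ perfect_power d (tofrac (map_mpoly j G)) ->
    `|\sum_(x : 'rV[k]_n) psi G.@[x 0]| * #|k|%:R
      <= (B * frob_half p #|k| * #|k| ^ n)%:R.
Proof.
elim: n => [|n [B IH]].
  exists 0%N => C k L j psi G pk cpsi _ []; apply: perfect_power0.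
  exact: cyclic_char_gt0 cpsi.
(* Bounds the size of the coefficients of [E], the difference between the monicized polynomial and
   the d-th power of its truncated root. *)
pose D2 := (D * D + 1 + D + (root_bound d (D * D + 1 + D) D * d).+1)%N.
exists (B + n * D + n * D2 + weil_const D d + D)%N.
move=> C k L j psi G pk cpsi sG npow.
have d0 := cyclic_char_gt0 cpsi; have dk := char_ndvd_order cpsi.
set q := #|k|; set Q := frob_half p q.
have Q0 : (0 < Q)%N := frob_half_gt0 pk.
have q0 : (0 < q)%N by apply/card_gt0P; exists 0.
have cU : #|{: 'rV[k]_n}| = (q ^ n)%N by rewrite card_mx mul1n.
pose P := muni G; pose N := (size P).-1; pose a := P`_N.
have P0 : P != 0.
  apply/eqP => P0; apply: npow; rewrite -(muniK G) -/P P0 mfold0 rmorph0.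
  by exists 0; rewrite expr0n gtn_eqF // tofrac0.
have sP : size P = N.+1 by rewrite prednK // size_poly_gt0.
have ND : (N.+1 <= D)%N by rewrite -sP (leq_trans (size_muni G)).
have bP : coef_bounded D P by move=> i; apply: leq_trans (msize_coef_muni G i) sG.
have a0 : a != 0 by rewrite -[a]/(lead_coef P) lead_coef_eq0.
pose Px (x : 'rV[k]_n) := map_poly (meval (x 0)) P.
have sPx (x : 'rV[k]_n) : a.@[x 0] != 0 -> size (Px x) = N.+1.
  by move=> ax; rewrite size_map_poly_id0 ?sP // sP.
pose s (x : 'rV[k]_n) := \sum_(t : k) psi (Px x).[t].
have SE : \sum_(x : 'rV[k]_n.+1) psi G.@[x 0] = \sum_x s x.
  by rewrite sum_row_rcons; apply: eq_bigr => x _; apply: eq_bigr => t _; rewrite meval_row_rcons.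
have s_triv (x : 'rV[k]_n) : `|s x| <= q%:R.
  apply: le_trans (ler_norm_sum _ _ _) _; rewrite -[q]sum1_card natr_sum.
  by apply: ler_sum => t _; apply: cyclic_char_norm_le1 cpsi _.
pose zer c := [set x : 'rV[k]_n | c.@[x 0] == 0 :> k].
have zerP c D' : c != 0 -> (msize c <= D')%N -> (#|zer c| * q <= n * D' * q ^ n)%N.
  move=> c0 sc; apply: leq_trans (schwartz_zippel c0) _.
  by rewrite leq_mul2r leq_mul2l sc !orbT.
(* Outside the zeros of a and c the univariate bound applies to each fibre. By [schwartz_zippel] the
   exceptional points number O(q^(n-1)), and each contributes at most q. *)
have weil_case c D' : c != 0 -> (msize c <= D')%N ->
    (forall x : 'rV[k]_n, a.@[x 0] != 0 -> c.@[x 0] != 0 -> forall b u, Px x <> b *: u ^+ d) ->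
    `|\sum_(x : 'rV[k]_n.+1) psi G.@[x 0]| * q%:R
      <= ((n * D + n * D' + weil_const D d) * Q * q ^ n.+1)%:R.
  move=> c0 sc np; rewrite SE.
  apply: (@le_trans _ _ ((#|zer a :|: zer c| * q + #|{: 'rV[k]_n}| * (weil_const D d * Q)) * q)%:R).
    rewrite natrM ler_wpM2r ?ler0n //; apply: norm_sum_exceptional => x.
      by move=> _; apply: s_triv.
    rewrite !inE negb_or => /andP[ax cx].
    by apply: weil_bound pk cpsi _ (np x ax cx); rewrite sPx // ltnW // ltnW.
  rewrite ler_nat mulnDl.
  have zu : (#|zer a :|: zer c| * q <= (n * D + n * D') * q ^ n)%N.
    rewrite mulnDl; apply: leq_trans (leq_add (zerP a D a0 (bP _)) (zerP c D' c0 sc)).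
    by rewrite -mulnDl leq_mul2r cardsU leq_subr orbT.
  rewrite cU expnS.
  apply: leq_trans (leq_add (leq_mul zu (leqnn q)) (leqnn _)) _.
  have -> : (q ^ n * (weil_const D d * Q) * q = weil_const D d * Q * (q * q ^ n))%N by ring.
  rewrite [((_ + weil_const D d) * Q)%N]mulnDl [leqRHS]mulnDl leq_add2r.
  rewrite -!mulnA [(q ^ n * q)%N]mulnC leq_mul2l; apply/orP; right.
  by rewrite leq_pmull.
have mono X Y : (X <= Y)%N -> (X * Q * q ^ n.+1)%:R <= (Y * Q * q ^ n.+1)%:R :> C.
  by move=> le; rewrite ler_nat !leq_mul2r le !orbT.
have DD2 : (D <= D2)%N by rewrite /D2; move: (_.+1); clear; lia.
(* If d does not divide N, a fibre of degree N is never a scaled d-th power, so c = a suffices. *)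
have [/dvdnP [e Nde]|dN] := boolP (d %| N)%N; last first.
  apply: le_trans (weil_case a D a0 (bP _) _) (mono _ _ _).
    move=> x ax _ b u PxE; case/negP: dN; exact: scaled_power_dvd_degree (sPx x ax) PxE.
  rewrite -!addnA; apply: leq_trans (leq_addl _ _); rewrite leq_add2l.
  apply: leq_add; first by rewrite leq_mul2l DD2 orbT.
  by rewrite /weil_const leq_add2l leq_addr.
rewrite mulnC in Nde.
have eD : (e <= D)%N.
  by apply: leq_trans (ltnW ND); rewrite Nde leq_pmull.
pose M := monicize (d * e) P.
have bM : coef_bounded (D * D + 1 + D) M.
  by apply: coef_bounded_monicize => //; rewrite -Nde ltnW.
have dA : d%:R != 0 :> {mpoly k[n]} by rewrite -mpolyC_nat mpolyC_eq0.
have [h [mh sh bh close]] :=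
  truncated_root dk (monicize_monic _ _) (size_monicize _ _) bM (leqnn e).
pose E := M - h ^+ d.
have hmap (x : 'rV[k]_n) (g : {poly {mpoly k[n]}}) : g \is monic ->
    size (map_poly (meval (x 0 : 'I_n -> k)) g) = size g.
  by move=> /monicP mg; rewrite size_map_poly_id0 // mg meval1 oner_eq0.
(* If E is nonzero, take for c its leading coefficient: where c does not vanish, the specialized
   monic polynomial differs from the d-th power of the specialized h, the only possible root. *)
have [E0|E0] := eqVneq E 0; last first.
  have bE : coef_bounded D2 E.
    apply: coef_boundedD.
      by apply: coef_bounded_leq bM; apply: leq_addr.
    apply: coef_boundedN; apply: coef_bounded_leq (coef_boundedX d bh).
    by rewrite /D2; apply: leq_trans (leq_addl _ _); rewrite ltnS leq_mul2r root_bound_mono ?orbT.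
  apply: le_trans (weil_case (lead_coef E) D2 _ (bE _) _) (mono _ _ _).
  - by rewrite lead_coef_eq0.
  - move=> x ax cx.
    have mE : monicize (d * e) (Px x) - map_poly (meval (x 0)) h ^+ d
        = map_poly (meval (x 0)) E.
      by rewrite rmorphB rmorphXn /= -monicize_map.
    apply: (not_scaled_power (e := e) (h := map_poly (meval (x 0)) h) dk).
    + by rewrite sPx // Nde.
    + exact: monic_map.
    + by rewrite hmap.
    + by rewrite mE; apply: leq_trans (size_poly _ _) _; apply: close.
    + rewrite -subr_eq0 mE; apply: contraNneq cx => Ex.
      by have := coef_map (meval (x 0)) E (size E).-1; rewrite Ex coef0 => /= <-.
  - by rewrite -!addnA; apply: leq_trans (leq_addl _ _); rewrite !leq_add2l leq_addr.
(* Now E = 0. Undoing the substitution t / a turns M = h^d into a^(de) P = a H^d, so the induction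
   hypothesis can be applied to a. *)
pose H := h \Po (a *: 'X).
have PH : a ^+ (d * e) *: P = a *: H ^+ d.
  have := @monicizeP _ (d * e) P; rewrite -Nde sP Nde => /(_ (leqnn _)).
  by rewrite -/M -Nde -/a Nde => ->; rewrite -rmorphXn /= (subr0_eq E0).
have anp : ~ perfect_power d (tofrac (map_mpoly j a)).
  by move=> /(perfect_power_lead a0 PH).
have := IH C k L j psi a pk cpsi (bP _) anp; rewrite -/q -/Q => IHa.
pose Hx (x : 'rV[k]_n) := map_poly (meval (x 0 : 'I_n -> k)) H.
have PHx (x : 'rV[k]_n) : a.@[x 0] ^+ (d * e) *: Px x = a.@[x 0] *: Hx x ^+ d.
  have := congr1 (map_poly (meval (x 0))) PH.
  by rewrite !map_polyZ /= !rmorphXn.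
(* Where a(x) is nonzero, psi(P_x(t)) is psi(a(x)) unless H_x(t) = 0, so the inner sum differs from
   q psi(a(x)) by at most the number of roots of H_x. *)
have far (x : 'rV[k]_n) : x \notin zer a -> `|s x - q%:R * psi a.@[x 0]| <= D%:R.
  rewrite inE => ax.
  have Hx0 : Hx x != 0.
    apply/eqP => Hx0; have := sPx x ax; have := PHx x.
    rewrite Hx0 expr0n gtn_eqF // scaler0 => /eqP; rewrite scaler_eq0.
    by rewrite (negPf (expf_neq0 _ ax)) /= => /eqP ->; rewrite size_poly0.
  have sHx : (size (Hx x) <= D.+1)%N.
    apply: leq_trans (size_poly _ _) _.
    by rewrite /H (comp_scaleX _ (N := e.+1)) ?sh //; apply: leq_trans (size_poly _ _) _.
  have psiP t : psi (Px x).[t] = psi a.@[x 0] * psi (Hx x).[t] ^+ d.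
    have := congr1 (fun g => psi g.[t]) (PHx x).
    rewrite !hornerZ horner_exp !(cyclic_charM cpsi) (cyclic_charX cpsi _ d0) => <-.
    (* For e = 0 the rule psi(y^i) = psi(y)^i, available for i > 0, is replaced by psi(1) = 1. *)
    case: (posnP e) => [e0|e0].
      rewrite e0 muln0 expr0.
      have -> : psi 1 = 1.
        have := cyclic_charM cpsi 1 a.@[x 0]; rewrite mul1r -{1}[psi _]mul1r.
        by move/mulIf => -> //; rewrite -normr_eq0 (cyclic_char_norm cpsi ax) oner_eq0.
      by rewrite mul1r.
    rewrite (cyclic_charX cpsi) ?muln_gt0 ?d0 // exprM (cyclic_char_order cpsi ax).
    by rewrite expr1n mul1r.
  have -> : s x - q%:R * psi a.@[x 0] =
      psi a.@[x 0] * \sum_t (psi (Hx x).[t] ^+ d - 1).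
    rewrite sumrB sumr_const mulrBr mulr_sumr; congr (_ - _); last by rewrite mulrC.
    by apply: eq_bigr => t _; rewrite psiP.
  rewrite normrM (cyclic_char_norm cpsi ax) mul1r.
  apply: le_trans (ler_norm_sum _ _ _) _.
  apply: (@le_trans _ _ (#|[set t | (Hx x).[t] == 0%R]|%:R)); last first.
    by rewrite ler_nat; apply: card_roots_leq.
  rewrite -sum1_card natr_sum [leRHS]big_mkcond; apply: ler_sum => t _; rewrite inE.
  have [->|Ht] := eqVneq (Hx x).[t] 0.
    by rewrite (cyclic_char0 cpsi) expr0n gtn_eqF // sub0r normrN normr1.
  by rewrite (cyclic_char_order cpsi Ht) subrr normr0.
have near (x : 'rV[k]_n) : x \in zer a -> `|s x - q%:R * psi a.@[x 0]| <= q%:R.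
  by rewrite inE => /eqP ->; rewrite (cyclic_char0 cpsi) mulr0 subr0; apply: s_triv.
have total := norm_sum_exceptional near far.
rewrite sumrB -mulr_sumr cU in total.
rewrite SE.
have tri : `|\sum_x s x| <= (#|zer a| * q + q ^ n * D)%:R
    + q%:R * `|\sum_(x : 'rV[k]_n) psi a.@[x 0]|.
  rewrite -[X in _ + X * _]normr_nat -normrM -lerBlDr.
  exact: le_trans (lerB_dist _ _) total.
apply: le_trans (ler_wpM2r (ler0n _ q) tri) _.
rewrite mulrDl -mulrA.
apply: le_trans (lerD (lexx _) (ler_wpM2l (ler0n _ q) IHa)) _.
rewrite -!natrM -natrD ler_nat.
have z1 := zerP a D a0 (bP _).
apply: leq_trans (leq_add (leq_mul (leq_add z1 (leqnn _)) (leqnn q)) (leqnn _)) _.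
rewrite expnS.
have -> : ((n * D * q ^ n + q ^ n * D) * q + q * (B * Q * q ^ n) =
  (n * D + D + B * Q) * (q * q ^ n))%N by ring.
rewrite leq_mul2r; apply/orP; right.
apply: (@leq_trans ((n * D + D + B) * Q)%N).
  by rewrite mulnDl leq_add2r leq_pmulr.
by rewrite leq_mul2r; apply/orP; right; clear; lia.
Qed.

(** * Unique factorization of multivariate polynomials *)

Section Divisibility.
Variable D : idomainType.
Implicit Types a b c p : D.

Definition rdivides a b := exists c, b = c * a.

Definition irreducible_elt a :=
  [/\ a != 0, a \isn't a GRing.unit &
      forall x y, a = x * y -> x \is a GRing.unit \/ y \is a GRing.unit].

Definition prime_elt a :=
  [/\ a != 0, a \isn't a GRing.unit &
      forall x y, rdivides a (x * y) -> rdivides a x \/ rdivides a y].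

Lemma rdividesD a b c : rdivides a b -> rdivides a c -> rdivides a (b + c).
Proof. by move=> [x ->] [y ->]; exists (x + y); rewrite mulrDl. Qed.

Lemma rdividesMl a b c : rdivides a b -> rdivides a (c * b).
Proof. by move=> [x ->]; exists (c * x); rewrite mulrA. Qed.

Lemma rdividesMr a b c : rdivides a b -> rdivides a (b * c).
Proof. by move=> ab; rewrite mulrC; apply: rdividesMl. Qed.

Lemma rdivides_sum a (I : Type) (r : seq I) (P : pred I) (F : I -> D) :
  (forall i, P i -> rdivides a (F i)) -> rdivides a (\sum_(i <- r | P i) F i).
Proof.
move=> aF; elim/big_rec: _ => [|i x Pi ax]; first by exists 0; rewrite mul0r.
by apply: rdividesD => //; apply: aF.
Qed.

Definition prime_factorization a :=
  exists u (s : seq D), [/\ u \is a GRing.unit, forall x, x \in s -> prime_elt x &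
    a = u * \prod_(x <- s) x].

(** Some prime x divides a, for a is not a unit; irreducibility makes the cofactor a unit, so a is
    an associate of x. *)
Lemma irreducible_prime_of_factorization a :
  prime_factorization a -> irreducible_elt a -> prime_elt a.
Proof.
case=> u [[|x s] [Uu ps ->]] [a0 au irr].
  by move: au; rewrite big_nil mulr1 Uu.
have [x0 xu px] := ps x (mem_head _ _).
move: irr a0 au; rewrite big_cons mulrCA => /(_ x (u * \prod_(y <- s) y) erefl).
case=> [|Uw a0 au]; first by rewrite (negPf xu).
set w := u * _ in Uw a0 au *; split => // y z [c yz].
have /px : rdivides x (y * z) by exists (c * w); rewrite yz mulrCA mulrC mulrA.
have step t : rdivides x t -> rdivides (x * w) t.
  by case=> e ->; exists (e * w^-1); rewrite -mulrA [w^-1 * _]mulrCA mulVr // mulr1.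
by case=> /step; [left | right].
Qed.

End Divisibility.

(** * Gauss's lemma over a factorial domain *)

Section GaussLemma.
Variable D : idomainType.
Hypothesis factD : forall a : D, a != 0 -> prime_factorization a.
Implicit Types (p c : D) (A B P Q : {poly D}).

Lemma rdivides_polyC p A : rdivides p%:P A <-> forall i, rdivides p A`_i.
Proof.
split=> [[C ->] i|pA]; first by exists C`_i; rewrite coefMC.
have /choice [f fE] : forall i, exists c, A`_i = c * p by move=> i; apply: pA.
exists (\poly_(i < size A) f i); apply/polyP => i.
rewrite coefMC coef_poly; case: ltnP => h; first exact: fE.
by rewrite nth_default // mul0r.
Qed.

(** If p divides neither A nor B, let i and l be the least indices with A_i and B_l not divisible by
    p. In the coefficient of A B at i + l every term but A_i B_l is divisible by p. *)
Lemma prime_elt_polyC p : prime_elt p -> prime_elt p%:P.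
Proof.
move=> [p0 pu pp]; split; first by rewrite polyC_eq0.
  by rewrite poly_unitE size_polyC p0 coefC.
move=> A B /rdivides_polyC pAB.
have [pA|npA] := pselect (rdivides p%:P A); first by left.
have [pB|npB] := pselect (rdivides p%:P B); first by right.
have minimal C : ~ rdivides p%:P C ->
    exists i, ~ rdivides p C`_i /\ forall l, (l < i)%N -> rdivides p C`_l.
  move=> nC; have ex : exists i, `[< ~ rdivides p C`_i >].
    apply: contrapT => nex; apply: nC; apply/rdivides_polyC => i.
    by apply: contrapT => nCi; apply: nex; exists i; apply/asboolP.
  exists (ex_minn ex); case: ex_minnP => i /asboolP nCi mini; split => // l li.
  apply: contrapT => nCl; have /mini : `[< ~ rdivides p C`_l >] by apply/asboolP.
  by rewrite leqNgt li.
have [i [nAi minA]] := minimal _ npA; have [l [nBl minB]] := minimal _ npB.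
have := pAB (i + l)%N; rewrite coefM.
have io : (i < (i + l).+1)%N by rewrite ltnS leq_addr.
rewrite (bigD1 (Ordinal io)) //= addKn => h.
have rest : rdivides p (\sum_(t < (i + l).+1 | t != Ordinal io) A`_t * B`_(i + l - t)).
  apply: rdivides_sum => t; rewrite -val_eqE /= neq_ltn => /orP[ti|it].
    by apply: rdividesMr; apply: minA.
  have tl : (t <= i + l)%N by rewrite -ltnS ltn_ord.
  have lt : (i + l - t < l)%N by rewrite -(ltn_add2r t) subnK // [(l + t)%N]addnC ltn_add2r.
  exact: rdividesMl (minB _ lt).
have : rdivides p (A`_i * B`_l).
  case: h => c1 h1; case: rest => c2 h2; exists (c1 - c2).
  by rewrite mulrBl -h1 -h2 addrK.
by case/pp.
Qed.

(** The primes of c are cancelled one by one: each divides G or Q, and removing a constant factor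
    does not change the degree. *)
Lemma cancel_factor_split c P G Q : c != 0 -> c%:P * P = G * Q ->
  exists G' Q', [/\ P = G' * Q', size G' = size G & size Q' = size Q].
Proof.
move=> /factD [u [s [Uu ps ->]]]; elim: s G Q ps => [|x s IH] G Q ps.
  rewrite big_nil mulr1 => e; exists (u^-1%:P * G), Q; split => //.
    by rewrite -mulrA -e mulrA -polyCM mulVr // mul1r.
  by rewrite mul_polyC size_scale // invr_eq0; apply: contraTneq Uu => ->; rewrite unitr0.
rewrite big_cons mulrCA polyCM -mulrA => e.
have [x0 _ px] := prime_elt_polyC (ps x (mem_head _ _)).
have sx (C : {poly D}) : size (C * x%:P) = size C.
  by rewrite mulrC mul_polyC size_scale // -polyC_eq0.
have ps' y : y \in s -> prime_elt y by move=> ys; apply: ps; rewrite inE ys orbT.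
have /px [[C GE]|[C QE]] : rdivides x%:P (G * Q).
  by rewrite -e; exists ((u * \prod_(j <- s) j)%:P * P); rewrite mulrC.
  have [|G' [Q' [-> sG' sQ']]] := IH C Q ps'.
    by apply: (mulfI x0); rewrite e GE; ring.
  by exists G', Q'; rewrite GE sx sG'.
have [|G' [Q' [-> sG' sQ']]] := IH G C ps'.
  by apply: (mulfI x0); rewrite e QE; ring.
by exists G', Q'; rewrite QE sx sQ'.
Qed.

(** As no prime constant divides P, each prime of c divides the other factor W and can be cancelled
    there. *)
Lemma cancel_factor_divides c P A W : c != 0 ->
  (forall p, prime_elt p -> ~ rdivides p%:P P) ->
  c%:P * A = P * W -> rdivides P A.
Proof.
move=> /factD [u [s [Uu ps ->]]] nP; elim: s W ps => [|x s IH] W ps.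
  rewrite big_nil mulr1 => e; exists (u^-1%:P * W).
  by rewrite -mulrA [W * P]mulrC -e mulrA -polyCM mulVr // mul1r.
rewrite big_cons mulrCA polyCM -mulrA => e.
have px0 := ps x (mem_head _ _).
have [x0 _ px] := prime_elt_polyC px0.
have ps' y : y \in s -> prime_elt y by move=> ys; apply: ps; rewrite inE ys orbT.
have /px [/(nP x px0)//|[C WE]] : rdivides x%:P (P * W).
  by rewrite -e; exists ((u * \prod_(j <- s) j)%:P * A); rewrite mulrC.
by apply: (IH C ps'); apply: (mulfI x0); rewrite e WE; ring.
Qed.

(** A constant P is settled in D. Otherwise P is primitive and its pseudo-gcd G with A decides: if G
    is constant, a Bezout relation multiplied by B shows that P divides a constant times B; if not,
    P agrees with G up to constants and divides A. *)
Lemma irreducible_prime_poly P : irreducible_elt P -> prime_elt P.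
Proof.
move=> irrP; have [P0 Pu Pirr] := irrP.
have [sP|sP] := leqP (size P) 1.
  move: irrP; rewrite (size1_polyC sP); set c := P`_0 => -[c0 cu cirr].
  rewrite polyC_eq0 in c0; apply: prime_elt_polyC.
  apply: (irreducible_prime_of_factorization (factD c0)); split => //.
    by move: cu; rewrite poly_unitE size_polyC c0 coefC.
  move=> x y cE; have [x0 y0] : x != 0 /\ y != 0.
    by apply/andP; rewrite -negb_or -mulf_eq0 -cE.
  have := cirr x%:P y%:P; rewrite -polyCM cE => /(_ erefl).
  by rewrite !poly_unitE !size_polyC x0 y0 !coefC.
have nP p : prime_elt p -> ~ rdivides p%:P P.
  move=> [p0 pu _] [Q PQ]; have := Pirr _ _ PQ.
  rewrite !poly_unitE size_polyC p0 !coefC /= (negPf pu).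
  case=> // /andP[/eqP sQ _]; move: sP; rewrite PQ mulrC mul_polyC size_scale //.
  by rewrite sQ.
split => // A B [W AB].
pose G := Pdiv.Idomain.gcdp P A.
have G0 : G != 0 by rewrite Pdiv.Idomain.gcdp_eq0 (negPf P0).
have [[c1 Q1] /= c10 e1] := Pdiv.Idomain.dvdpP _ _ (Pdiv.Idomain.dvdp_gcdl P A).
have [[c2 Q2] /= c20 e2] := Pdiv.Idomain.dvdpP _ _ (Pdiv.Idomain.dvdp_gcdr P A).
rewrite -/G in e1 e2.
have [sG|sG] := leqP (size G) 1.
  right; have [[u v] /= /Pdiv.Idomain.eqpP [[a b] /= /andP[a0 b0] e]] := Pdiv.Idomain.Bezoutp P A.
  rewrite -/G (size1_polyC sG) in e.
  have g0 : G`_0 != 0 by rewrite -polyC_eq0 -(size1_polyC sG).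
  apply: (@cancel_factor_divides (b * G`_0) P B (a%:P * (u * B + v * W))).
  - by rewrite mulf_neq0.
  - exact: nP.
  - rewrite polyCM [b%:P * _]mul_polyC -e -mul_polyC.
    transitivity (a%:P * (u * P * B + v * (A * B))); first by ring.
    by rewrite AB; ring.
(* From c1 P = Q1 G, splitting off c1 gives a factorization of P with the same degrees;
   irreducibility then forces Q1 to be constant. *)
left; rewrite -mul_polyC in e1; rewrite -mul_polyC in e2.
have [Q' [G' [PE sQ' sG']]] := cancel_factor_split c10 e1.
have := Pirr _ _ PE; rewrite !poly_unitE sQ' sG' [size G == 1]gtn_eqF // andFb.
case=> // /andP[/eqP sQ1 _].
have q0 : Q1`_0 != 0.
  by rewrite -polyC_eq0 -size1_polyC ?sQ1 // -size_poly_gt0 sQ1.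
apply: (@cancel_factor_divides (Q1`_0 * c2) P A (c1%:P * Q2)).
- by rewrite mulf_neq0.
- exact: nP.
- by rewrite polyCM -mulrA e2 mulrCA -(size1_polyC (_ : size Q1 <= 1)%N) ?sQ1 // -e1; ring.
Qed.

End GaussLemma.

(** * Transport of irreducible and prime elements along multiplicative bijections *)

Section MulIso.
Variables (D E : idomainType) (f : D -> E) (g : E -> D).
Hypotheses (fK : cancel f g) (gK : cancel g f).
Hypotheses (fM : forall x y, f (x * y) = f x * f y) (f1 : f 1 = 1) (f0 : f 0 = 0).

Lemma mul_iso_inv x y : g (x * y) = g x * g y.
Proof. by rewrite -{1}(gK x) -{1}(gK y) -fM fK. Qed.

Lemma mul_iso_unit x : (f x \is a GRing.unit) = (x \is a GRing.unit).
Proof.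
apply/unitrP/unitrP => [[y [e1 e2]]|[y [e1 e2]]].
  by exists (g y); split; apply: (can_inj fK); rewrite fM gK f1.
by exists (f y); rewrite -!fM e1 e2 f1.
Qed.

Lemma mul_iso_irreducible a : irreducible_elt a -> irreducible_elt (f a).
Proof.
move=> [a0 au irr]; split; first by rewrite -f0 (can_eq fK).
  by rewrite mul_iso_unit.
move=> x y /(congr1 g); rewrite fK mul_iso_inv => /irr.
by rewrite -(mul_iso_unit (g x)) -(mul_iso_unit (g y)) !gK.
Qed.

Lemma mul_iso_prime a : prime_elt (f a) -> prime_elt a.
Proof.
move=> [a0 au pa]; split; first by apply: contraNneq a0 => ->; rewrite f0.
  by rewrite -mul_iso_unit.
move=> x y [c xy].
have down z : rdivides (f a) (f z) -> rdivides a z.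
  by move=> [e ez]; exists (g e); apply: (can_inj fK); rewrite fM gK.
have /pa [] : rdivides (f a) (f x * f y) by exists (f c); rewrite -!fM xy.
  by move=> /down; left.
by move=> /down; right.
Qed.

End MulIso.

Section MPolyFactor.
Variable K : fieldType.

Lemma mpoly_unitE n (P : {mpoly K[n]}) : (P \is a GRing.unit) = (msize P == 1%N).
Proof.
apply/idP/msize_poly1P => [|[c c0 ->]].
  by move=> /andP[/eqP PE c0]; exists P@_0%MM => //; rewrite -unitfE.
by apply/unitrP; exists (c^-1)%:MP; rewrite -!mpolyCM mulVf // mulfV // mpolyC1.
Qed.

(** Induction on the degree: in a product of two nonunits both factors have smaller degree. *)
Lemma mpoly_irreducible_factorization n (P : {mpoly K[n]}) : P != 0 ->
  exists u s, [/\ u \is a GRing.unit, forall x, x \in s -> irreducible_elt x &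
    P = u * \prod_(x <- s) x].
Proof.
have [N sN] := ubnP (msize P); elim: N P sN => [//|N IH] P; rewrite ltnS => sN P0.
have [Pu|Pu] := boolP (P \is a GRing.unit).
  by exists P, [::]; split => //; rewrite big_nil mulr1.
have [irr|nirr] := pselect (irreducible_elt P).
  exists 1, [:: P]; rewrite unitr1 big_seq1 mul1r; split => // x.
  by rewrite inE => /eqP ->.
have [A [B [PAB Au Bu]]] : exists A B,
    [/\ P = A * B, A \isn't a GRing.unit & B \isn't a GRing.unit].
  apply: contrapT => h; apply: nirr; split => // A B PAB.
  have [?|Au] := boolP (A \is a GRing.unit); first by left.
  by have [?|Bu] := boolP (B \is a GRing.unit); [right | case: h; exists A, B].
have /andP[A0 B0] : (A != 0) && (B != 0) by rewrite -negb_or -mulf_eq0 -PAB.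
have big (C : {mpoly K[n]}) : C != 0 -> C \isn't a GRing.unit -> (1 < msize C)%N.
  by rewrite mpoly_unitE -msize_poly_eq0; case: (msize C) => [|[|m]].
have := msizeM A0 B0; rewrite -PAB => sAB.
have aux a b m : (m = (a + b).-1 -> m <= N -> 1 < b -> a < N)%N by lia.
have [|u [s [Uu irs AE]]] := IH A _ A0.
  exact: aux sAB sN (big B B0 Bu).
have [|v [t [Uv irt BE]]] := IH B _ B0.
  by rewrite addnC in sAB; apply: aux sAB sN (big A A0 Au).
exists (u * v), (s ++ t); split; first by rewrite unitrM Uu.
  by move=> x; rewrite mem_cat => /orP[/irs|/irt].
by rewrite PAB AE BE big_cat /= mulrACA.
Qed.

(** Induction on n through the identification with K[x_1, ..., x_n][t]: irreducible factorizations
    of the coefficients are prime factorizations by induction, so Gauss's lemma applies. For n = 0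
    all nonzero elements are units. *)
Lemma mpoly_irreducible_prime n (P : {mpoly K[n]}) : irreducible_elt P -> prime_elt P.
Proof.
elim: n P => [|n IH] P irrP.
  case: irrP => P0; rewrite mpoly_unitE => /msize_poly1P[]; exists P@_0%MM.
    by apply: contra P0 => /eqP e; rewrite (nvar0_mpolyC P) e.
  exact: nvar0_mpolyC.
apply: (mul_iso_prime (@muniK K n) (@mfoldK K n) (rmorphM _) (rmorph1 _) (rmorph0 _)).
apply: irreducible_prime_poly.
  move=> a /mpoly_irreducible_factorization [u [s [Uu irs ->]]].
  by exists u, s; split => // x /irs /IH.
exact: (mul_iso_irreducible (@muniK K n) (@mfoldK K n) (rmorphM _) (rmorph1 _) (rmorph0 _)).
Qed.

End MPolyFactor.

(** * Factorization into monic irreducible polynomials *)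

Section MonicIrreducible.
Variables (K : fieldType) (n : nat).
Implicit Types (P Q A B : {mpoly K[n]}) (s t : seq {mpoly K[n]}).

(** The leading coefficient is taken for the monomial order. This selects one polynomial in each
    class of associates, so divisibility between two such polynomials is equality. *)
Definition monic_irr P := irreducible_elt P /\ mleadc P = 1.

Lemma monic_irr_prime P : monic_irr P -> prime_elt P.
Proof. by move=> [/mpoly_irreducible_prime]. Qed.

Lemma monic_irr_eq P Q : monic_irr P -> monic_irr Q -> rdivides P Q -> P = Q.
Proof.
move=> [[P0 Pu _] lP] [[Q0 _ irrQ] lQ] [C QE].
have [|] := irrQ _ _ QE; last by rewrite (negPf Pu).
rewrite mpoly_unitE => /msize_poly1P [c c0 CE].
by move: lQ; rewrite QE CE mul_mpolyC mleadcZE lP mulr1 => ->; rewrite scale1r.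
Qed.

Definition is_factorization A s :=
  (forall P, P \in s -> monic_irr P) /\ A = (mleadc A)%:MP * \prod_(P <- s) P.

Lemma mleadc_prod_monic s : (forall P, P \in s -> mleadc P = 1) ->
  mleadc (\prod_(P <- s) P) = 1.
Proof.
elim: s => [|P s IH] h; first by rewrite big_nil mleadc1.
rewrite big_cons; have [P0|P0] := eqVneq P 0.
  by have := h P (mem_head _ _); rewrite P0 mcoeff0 => /esym/eqP; rewrite oner_eq0.
have hs : mleadc (\prod_(P <- s) P) = 1.
  by apply: IH => Q Qs; apply: h; rewrite inE Qs orbT.
have Q0 : \prod_(P <- s) P != 0.
  by apply: contraTneq (oner_neq0 K) => e; rewrite -hs e mcoeff0 eqxx.
by rewrite mleadM // mleadcM h ?mem_head // hs mulr1.
Qed.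

Lemma factorization_exists A : A != 0 -> exists s, is_factorization A s.
Proof.
move=> A0; have [u [s [Uu irs AE]]] := mpoly_irreducible_factorization A0.
pose mon P := (mleadc P)^-1 *: P.
have lead0 P : irreducible_elt P -> mleadc P != 0 by case=> P0 _ _; rewrite mleadc_eq0.
have monP P : irreducible_elt P -> monic_irr (mon P).
  move=> irP; have [P0 Pu irr] := irP; have l0 := lead0 P irP.
  have li0 : (mleadc P)^-1 != 0 by rewrite invr_eq0.
  split; last by rewrite mleadcZE mulVf.
  split; first by rewrite mscalerI negb_or li0.
    by rewrite mpoly_unitE msizeZ // -mpoly_unitE.
  move=> x y /(congr1 (fun z => mleadc P *: z)).
  rewrite scalerA mulfV // scale1r scalerAl => /irr [xu|]; last by right.
  by left; rewrite mpoly_unitE msizeZ // -mpoly_unitE in xu.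
have prodE : exists2 c, c != 0 & \prod_(P <- s) P = c *: \prod_(P <- map mon s) P.
  elim: s irs {AE} => [|P s IH] irs.
    by exists 1; rewrite ?oner_eq0 // !big_nil scale1r.
  have [|c c0 e] := IH; first by move=> Q Qs; apply: irs; rewrite inE Qs orbT.
  have irP := irs P (mem_head _ _).
  exists (mleadc P * c); first by rewrite mulf_neq0 // lead0.
  rewrite !big_cons e /mon -scalerAl scalerA mulrAC mulfV ?lead0 // mul1r.
  by rewrite -scalerAr.
have [c c0 sE] := prodE.
have [d d0 uE] : exists2 d, d != 0 & u = d%:MP.
  by move: Uu; rewrite mpoly_unitE => /msize_poly1P.
exists (map mon s); split.
  by move=> P /mapP[Q Qs ->]; apply/monP/irs.
have AE2 : A = (d * c)%:MP * \prod_(P <- map mon s) P.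
  by rewrite AE uE sE -mul_mpolyC mulrA -mpolyCM.
rewrite {1}AE2; congr (_%:MP * _).
rewrite AE2 mul_mpolyC mleadcZE mleadc_prod_monic ?mulr1 // => P /mapP[Q Qs ->].
by case: (monP Q (irs Q Qs)).
Qed.

Lemma factorization_perm s t (c e : K) :
  (forall P, P \in s -> monic_irr P) -> (forall P, P \in t -> monic_irr P) ->
  c != 0 -> e != 0 ->
  c%:MP * \prod_(P <- s) P = e%:MP * \prod_(P <- t) P -> perm_eq s t.
Proof.
elim: s t => [|P s IH] t ms mt c0 e0.
  case: t mt => [//|Q t] mt; rewrite big_nil mulr1 big_cons mulrCA => E.
  have [[_ /negP Qu _] _] := mt Q (mem_head _ _); case: Qu.
  have : c%:MP_[n] \is a GRing.unit by rewrite mpoly_unitE msizeC c0.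
  by rewrite E unitrM => /andP[].
rewrite big_cons => E.
have mP := ms P (mem_head _ _); have [P0 Pu pP] := monic_irr_prime mP.
have Pt : P \in t.
  have : rdivides P (e%:MP * \prod_(Q <- t) Q).
    by rewrite -E; exists (c%:MP * \prod_(j <- s) j); rewrite mulrCA mulrC.
  case/pP => [[C eC]|].
    have : e%:MP_[n] \is a GRing.unit by rewrite mpoly_unitE msizeC e0.
    by rewrite eC unitrM (negPf Pu) andbF.
  elim: t mt {E} => [|Q t IHt] mt.
    rewrite big_nil => -[C e1]; have := unitr1 {mpoly K[n]}.
    by rewrite e1 unitrM (negPf Pu) andbF.
  rewrite big_cons => /pP [/(monic_irr_eq mP (mt Q (mem_head _ _))) ->|].
    exact: mem_head.
  by move=> /IHt h; rewrite inE h ?orbT // => R Rt; apply: mt; rewrite inE Rt orbT.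
have pt := perm_to_rem Pt.
rewrite perm_sym (perm_trans pt) // perm_cons perm_sym.
apply: IH c0 e0 _.
- by move=> Q Qs; apply: ms; rewrite inE Qs orbT.
- by move=> Q /mem_rem; apply: mt.
- by apply: (mulfI P0); rewrite mulrCA E (perm_big _ pt) /= big_cons mulrCA.
Qed.

(** A factorization picked by choice, with repetitions; for A nonzero it is determined up to
    order. *)
Definition mfactors A : seq {mpoly K[n]} :=
  if pselect (exists s, is_factorization A s) is left ex
  then projT1 (cid ex) else [::].

Lemma mfactorsP A : A != 0 -> is_factorization A (mfactors A).
Proof.
move=> /factorization_exists ex; rewrite /mfactors; case: pselect => // ex'.
exact: (projT2 (cid ex')).
Qed.

Lemma mfactors_monic A P : A != 0 -> P \in mfactors A -> monic_irr P.
Proof. by move=> /mfactorsP[h _] /h. Qed.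

Lemma mfactorsE A : A != 0 -> A = (mleadc A)%:MP * \prod_(P <- mfactors A) P.
Proof. by move=> /mfactorsP[]. Qed.

Lemma mfactors_perm A s (c : K) : A != 0 -> (forall P, P \in s -> monic_irr P) ->
  A = c%:MP * \prod_(P <- s) P -> perm_eq (mfactors A) s.
Proof.
move=> A0 ms AE; have l0 : mleadc A != 0 by rewrite mleadc_eq0.
have c0 : c != 0 by apply: contraNneq A0 => c0; rewrite AE c0 mul0r.
apply: factorization_perm l0 c0 _ => //; last by rewrite -mfactorsE.
by move=> P; apply: mfactors_monic.
Qed.

Lemma mfactorsM A B : A != 0 -> B != 0 -> perm_eq (mfactors (A * B)) (mfactors A ++ mfactors B).
Proof.
move=> A0 B0; apply: (@mfactors_perm _ _ (mleadc A * mleadc B)).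
- by rewrite mulf_neq0.
- by move=> P; rewrite mem_cat => /orP[]; apply: mfactors_monic.
- by rewrite {1}(mfactorsE A0) {1}(mfactorsE B0) big_cat /= mpolyCM mulrACA.
Qed.

Lemma mem_mfactors A P : A != 0 -> monic_irr P -> (P \in mfactors A) <-> rdivides P A.
Proof.
move=> A0 mP; split.
  move=> /perm_to_rem pt; rewrite (mfactorsE A0) (perm_big _ pt) /= big_cons mulrCA.
  by rewrite mulrC; eexists; reflexivity.
move=> [C AE]; have /andP[C0 P0] : (C != 0) && (P != 0) by rewrite -negb_or -mulf_eq0 -AE.
have pP : perm_eq (mfactors P) [:: P].
  apply: (@mfactors_perm _ _ 1) => //; last by rewrite big_seq1 mul1r.
  by move=> Q; rewrite inE => /eqP ->.
rewrite AE (perm_mem (mfactorsM C0 P0)) mem_cat (perm_mem pP) mem_head.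
by rewrite orbT.
Qed.

(** Every factor has degree at least 1, so there are at most deg A of them. *)
Lemma size_mfactors A : A != 0 -> (size (mfactors A) < msize A)%N.
Proof.
move=> A0; have l0 : mleadc A != 0 by rewrite mleadc_eq0.
rewrite {2}(mfactorsE A0) mul_mpolyC msizeZ //.
have : forall P, P \in mfactors A -> monic_irr P by move=> P; apply: mfactors_monic.
elim: (mfactors A) => [|P s IH] ms; first by rewrite big_nil msize1.
rewrite big_cons; have [[P0 Pu _] _] := ms P (mem_head _ _).
have ms' Q : Q \in s -> monic_irr Q by move=> Qs; apply: ms; rewrite inE Qs orbT.
have Q0 : \prod_(P <- s) P != 0.
  by rewrite -msize_poly_eq0 -lt0n; apply: leq_ltn_trans (IH ms').
have P1 : (1 < msize P)%N.
  by move: Pu; rewrite mpoly_unitE; move: P0; rewrite -msize_poly_eq0; case: (msize P) => [|[|m]].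
have aux a b m : (m < b -> 1 < a -> m.+1 < (a + b).-1)%N by lia.
by rewrite msizeM //; apply: aux (IH ms') P1.
Qed.

End MonicIrreducible.

(** * Translations *)

Section Shift.
Variables (K : fieldType) (n : nat).
Implicit Types (P Q A B : {mpoly K[n]}) (a b : 'rV[K]_n).

Lemma mshiftM a P Q : mshift a (P * Q) = mshift a P * mshift a Q.
Proof. exact: rmorphM. Qed.

Lemma mshiftD a P Q : mshift a (P + Q) = mshift a P + mshift a Q.
Proof. exact: rmorphD. Qed.

Lemma mshiftZ a c P : mshift a (c *: P) = c *: mshift a P.
Proof. exact: comp_mpolyZ. Qed.

Lemma mshiftX a P m : mshift a (P ^+ m) = mshift a P ^+ m.
Proof. exact: rmorphXn. Qed.

Lemma mshift1 a : mshift a 1 = 1. Proof. exact: rmorph1. Qed.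

Lemma mshift_zero a : mshift a 0 = 0. Proof. exact: rmorph0. Qed.

Lemma mshiftC a c : mshift a c%:MP = c%:MP. Proof. exact: comp_mpolyC. Qed.

Lemma mshift_prod a (I : Type) (r : seq I) (F : I -> {mpoly K[n]}) :
  mshift a (\prod_(i <- r) F i) = \prod_(i <- r) mshift a (F i).
Proof. exact: rmorph_prod. Qed.

Lemma mshiftXU a i : mshift a 'X_i = (a 0 i)%:MP + 'X_i.
Proof. by rewrite /mshift comp_mpolyXU -tnth_nth tnth_mktuple. Qed.

Lemma mshift_comp a b P : mshift a (mshift b P) = mshift (a + b) P.
Proof.
have XU i : mshift a (mshift b 'X_i) = mshift (a + b) 'X_i.
  rewrite (mshiftXU b i) (mshiftXU (a + b) i) (mshiftD a (b 0 i)%:MP 'X_i).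
  rewrite (mshiftC a (b 0 i)) (mshiftXU a i).
  by rewrite mxE mpolyCD addrA [_ + (a 0 i)%:MP]addrC.
have X m : mshift a (mshift b 'X_[m]) = mshift (a + b) 'X_[m].
  rewrite mpolyXE_id (mshift_prod b) (mshift_prod a) (mshift_prod (a + b)).
  apply: eq_bigr => i _.
  by rewrite (mshiftX b 'X_i) (mshiftX a (mshift b 'X_i)) (mshiftX (a + b) 'X_i) XU.
elim/mpolyind: P => [|c m P _ _ IH]; first by rewrite !mshift_zero.
rewrite (mshiftD b (c *: 'X_[m]) P) (mshiftD a (mshift b (c *: 'X_[m])) _).
rewrite (mshiftD (a + b) (c *: 'X_[m]) P) IH.
by rewrite (mshiftZ b c 'X_[m]) (mshiftZ a c (mshift b 'X_[m])) X (mshiftZ (a + b) c 'X_[m]).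
Qed.

Lemma mshift_by0 P : mshift 0 P = P.
Proof.
rewrite /mshift -[RHS]comp_mpoly_id; congr (_ \mPo _).
by apply: eq_from_tnth => i; rewrite !tnth_mktuple mxE mpolyC0 add0r.
Qed.

Lemma mshiftK a : cancel (mshift a) (mshift (- a)).
Proof. by move=> P; rewrite mshift_comp addNr mshift_by0. Qed.

Lemma mshiftKV a : cancel (mshift (- a)) (mshift a).
Proof. by move=> P; rewrite mshift_comp addrN mshift_by0. Qed.

Lemma mshift_eq0 a P : (mshift a P == 0) = (P == 0).
Proof.
by apply/eqP/eqP => [/(congr1 (mshift (- a)))|->]; rewrite ?mshiftK mshift_zero.
Qed.

Let msize_mul_leq A B : (msize (A * B) <= (msize A + msize B).-1)%N.
Proof.
have [->|A0] := eqVneq A 0; first by rewrite mul0r msize0.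
have [->|B0] := eqVneq B 0; first by rewrite mulr0 msize0.
by rewrite msizeM.
Qed.

(** Translation alters only terms of lower degree. The property is multiplicative, so it passes from
    the variables to all monomials. *)
Let shift_small a P := P != 0 /\ (msize (mshift a P - P) <= (msize P).-1)%N.

Let shift_small_msize a P : shift_small a P -> (msize (mshift a P) <= msize P)%N.
Proof.
move=> [_ hP]; rewrite -[mshift a P](subrK P); apply: leq_trans (msizeD_le _ _) _.
by rewrite geq_max leqnn andbT (leq_trans hP) // leq_pred.
Qed.

Let shift_smallM a A B : shift_small a A -> shift_small a B -> shift_small a (A * B).
Proof.
move=> sA [B0 hB]; have lA := shift_small_msize sA; have [A0 hA] := sA.
split; first by rewrite mulf_neq0.
have -> : mshift a (A * B) - A * B = mshift a A * (mshift a B - B) + (mshift a A - A) * B.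
  by rewrite mshiftM; ring.
apply: leq_trans (msizeD_le _ _) _; rewrite geq_max (msizeM A0 B0).
have A1 : (0 < msize A)%N by rewrite lt0n msize_poly_eq0.
have B1 : (0 < msize B)%N by rewrite lt0n msize_poly_eq0.
have aux x y z w : (x <= z -> y <= w.-1 -> 0 < z -> 0 < w ->
  (x + y).-1 <= (z + w).-1.-1)%N by lia.
apply/andP; split; first exact: leq_trans (msize_mul_leq _ _) (aux _ _ _ _ lA hB A1 B1).
apply: leq_trans (msize_mul_leq _ _) _.
by rewrite addnC [(msize A + _)%N]addnC; apply: aux.
Qed.

Let shift_smallX a m : shift_small a 'X_[m].
Proof.
have one : shift_small a 1 by split; rewrite ?oner_eq0 // mshift1 subrr msize0.
rewrite mpolyXE_id; apply: (big_ind (shift_small a)) => // [|i _]; first exact: shift_smallM.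
elim: (m i) => [|l IH]; rewrite ?expr0 // exprS; apply: shift_smallM => //; split.
  by rewrite -msize_poly_eq0 msizeX.
by rewrite mshiftXU addrK msizeX mdeg1 msizeC; case: (_ != 0).
Qed.

Lemma msize_mshiftB a P : (msize (mshift a P - P) <= (msize P).-1)%N.
Proof.
have -> : mshift a P - P = \sum_(m <- msupp P) P@_m *: (mshift a 'X_[m] - 'X_[m]).
  rewrite {1 2}(mpolyE P) /mshift raddf_sum /= -sumrB; apply: eq_bigr => m _.
  by rewrite comp_mpolyZ scalerBr.
apply: leq_trans (msize_sum _ _ _) _; apply/bigmax_leqP_seq => m mP _.
apply: leq_trans (msizeZ_le _ _) _; have [_ h] := shift_smallX a m.
apply: leq_trans h _; rewrite msizeX /= -ltnS.
by rewrite (leq_trans (msize_mdeg_lt mP)) // leqSpred.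
Qed.

(** The monomial order refines the degree, and the difference has smaller degree. Hence translates
    of monic polynomials are monic. *)
Lemma mlead_mshift a P : mlead (mshift a P) = mlead P /\ mleadc (mshift a P) = mleadc P.
Proof.
have [->|P0] := eqVneq P 0; first by rewrite mshift_zero.
set R := mshift a P - P; have -> : mshift a P = P + R by rewrite addrC subrK.
have [->|R0] := eqVneq R 0; first by rewrite addr0.
have sR : (msize R < msize P)%N.
  apply: leq_ltn_trans (msize_mshiftB a P) _.
  by rewrite prednK // lt0n msize_poly_eq0.
have lt : (mlead R < mlead P)%O.
  rewrite ltNge; apply/negP => /lemc_mdeg.
  by rewrite -ltnS !mlead_deg // leqNgt sR.
have -> : mlead (P + R) = mlead P by rewrite mleadDl.
by rewrite mcoeffD (mcoeff_gt_mlead lt) addr0.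
Qed.

Lemma monic_irr_mshift a P : monic_irr P -> monic_irr (mshift a P).
Proof.
move=> [irP lP]; split; last by have [_ ->] := mlead_mshift a P.
exact: mul_iso_irreducible (mshiftK a) (mshiftKV a) (mshiftM a) (mshift1 a) (mshift_zero a) _ irP.
Qed.

Lemma mfactors_mshift a A : A != 0 ->
  perm_eq (mfactors (mshift a A)) (map (mshift a) (mfactors A)).
Proof.
move=> A0; apply: (@mfactors_perm _ _ _ _ (mleadc A)).
- by rewrite mshift_eq0.
- by move=> P /mapP[Q QA ->]; apply/monic_irr_mshift/(mfactors_monic A0).
- by rewrite {1}(mfactorsE A0) mshiftM mshiftC mshift_prod big_map.
Qed.

Lemma count_mfactors_mshift a A P : A != 0 ->
  count_mem P (mfactors (mshift a A)) = count_mem (mshift (- a) P) (mfactors A).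
Proof.
move=> A0; rewrite (seq.permP (mfactors_mshift a A0)) count_map; apply: eq_count => Q /=.
by apply/eqP/eqP => [<-|->]; rewrite ?mshiftK ?mshiftKV.
Qed.

End Shift.

(** * Frobenius descent *)

Lemma uniq_sub_perm (T : eqType) (s t : seq T) :
  uniq s -> {subset s <= t} -> exists u, perm_eq t (s ++ u).
Proof.
move=> us st; have /count_subseqP [s' s't ss'] :
    forall x, (count_mem x s <= count_mem x t)%N.
  move=> x; rewrite (count_uniq_mem _ us); case: (boolP (x \in s)) => //= /st.
  by rewrite -has_pred1 has_count.
have [u tu] := perm_to_subseq s't; exists u.
by apply: perm_trans tu _; rewrite perm_cat2r perm_sym.
Qed.

Section FrobeniusDescent.
Variables (kappa : finFieldType) (L : closedFieldType) (io : {rmorphism kappa -> L}).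

(* io is unused, but lets the morphism instances below be found. *)
Definition frobL (_ : {rmorphism kappa -> L}) (x : L) : L := x ^+ #|kappa|.

Lemma frobL_zmod : zmod_morphism (frobL io).
Proof.
move=> x y; have [p pp pk] := finPcharP kappa; have pL := rmorph_pchar io pk.
have pq : p.-nat #|kappa| by rewrite (card_finField_pchar pk) pnatX pnat_id.
have pqL : [pchar L].-nat #|kappa| by rewrite (eq_pnat _ (pcharf_eq pL)).
apply/eqP; rewrite eq_sym subr_eq /frobL; apply/eqP.
by rewrite -exprDn_pchar // subrK.
Qed.

Lemma frobL_monoid : monoid_morphism (frobL io).
Proof. by split=> [|x y]; rewrite /frobL ?expr1n // exprMn. Qed.

HB.instance Definition _ := GRing.isZmodMorphism.Build L L (frobL io) frobL_zmod.
HB.instance Definition _ := GRing.isMonoidMorphism.Build L L (frobL io) frobL_monoid.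

Lemma frobL_io a : frobL io (io a) = io a.
Proof. by rewrite /frobL -rmorphXn expf_card. Qed.

(** A fixed point is a root of X^q - X, the product of the X - a for a in [kappa]. *)
Lemma frobL_fixed x : frobL io x = x -> exists a, io a = x.
Proof.
move=> fx; have := congr1 (fun P => (map_poly io P).[x]) (finField_genPoly kappa).
rewrite rmorphB /= map_polyXn map_polyX hornerD hornerN hornerXn hornerX.
rewrite -[x ^+ _]/(frobL io x) fx subrr rmorph_prod horner_prod => /esym/eqP.
rewrite prodf_seq_eq0 => /hasP[a _]; rewrite rmorphB /= map_polyX map_polyC hornerXsubC.
by rewrite subr_eq0 => /eqP ->; exists a.
Qed.

Lemma frobL_surj y : exists x, frobL io x = y.
Proof.
have q0 : (0 < #|kappa|)%N by apply/card_gt0P; exists 0.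
have [x] := @solve_monicpoly L _ (fun i => if i == 0%N then y else 0) q0.
rewrite (bigD1 (Ordinal q0)) //= expr0 mulr1 big1 ?addr0 => [|i]; first by exists x.
by rewrite -val_eqE /= => /negPf ->; rewrite mul0r.
Qed.

Variable n : nat.
Local Notation phi := (@map_mpoly n L L (frobL io)).
Local Notation lift := (@map_mpoly n kappa L io).

Lemma frob_mpoly_bij : exists g, cancel phi g /\ cancel g phi.
Proof.
have inj : injective phi by apply: map_mpoly_inj.
have surj Q : exists P, phi P = Q.
  elim/mpolyind: Q => [|c m Q _ _ [P <-]]; first by exists 0; rewrite rmorph0.
  have [b <-] := frobL_surj c; exists (b *: 'X_[m] + P).
  by rewrite rmorphD /= map_mpolyZ map_mpolyX.
have [g gK] := choice surj; exists g; split => // P.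
by apply: inj; rewrite gK.
Qed.

Lemma frob_mpoly_lift A : phi (lift A) = lift A.
Proof. by apply/mpolyP => m; rewrite !mcoeff_map_mpoly /= frobL_io. Qed.

Lemma frob_mpoly_fixed Q : phi Q = Q -> exists A, lift A = Q.
Proof.
move=> fQ; have ex c : exists a, frobL io c = c -> io a = c.
  by have [/frobL_fixed [a ac]|nc] := pselect (frobL io c = c); [exists a | exists 0].
have [h hE] := choice ex.
exists (\sum_(m <- msupp Q) h Q@_m *: 'X_[m]).
rewrite [RHS]mpolyE rmorph_sum; apply: eq_bigr => m _ /=.
by rewrite map_mpolyZ map_mpolyX hE // -[in RHS]fQ mcoeff_map_mpoly.
Qed.

Lemma monic_irr_frob P : monic_irr P -> monic_irr (phi P).
Proof.
have [g [phiK gK]] := frob_mpoly_bij => -[irP lP].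
split; first exact: (mul_iso_irreducible phiK gK (rmorphM _) (rmorph1 _) (rmorph0 _)).
have ml : mlead (phi P) = mlead P.
  rewrite /mlead; apply: perm_big; apply: msupp_map_mpoly; exact: fmorph_inj.
by rewrite ml mcoeff_map_mpoly lP; apply: rmorph1.
Qed.

Lemma frob_rdivides P Q : rdivides P Q -> rdivides (phi P) (phi Q).
Proof. by move=> [C ->]; exists (phi C); rewrite rmorphM. Qed.

Lemma frob_iter_factor P A i : A != 0 -> monic_irr P -> rdivides P (lift A) ->
  iter i phi P \in mfactors (lift A).
Proof.
move=> A0 mP PA; have lA0 : lift A != 0 by rewrite map_mpoly_eq0.
have [mi di] : monic_irr (iter i phi P) /\ rdivides (iter i phi P) (lift A).
  elim: i => [//|i [mi di]]; split; first exact: monic_irr_frob.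
  by rewrite -(frob_mpoly_lift A); apply: frob_rdivides.
by apply/mem_mfactors.
Qed.

(** All Frobenius iterates of P divide [lift A], which has finitely many monic irreducible factors,
    so the orbit is finite. *)
Lemma frob_orbit P A : A != 0 -> monic_irr P -> rdivides P (lift A) ->
  exists s, [/\ uniq s, P \in s, forall Q, Q \in s -> exists i, Q = iter i phi P &
    perm_eq (map phi s) s].
Proof.
move=> A0 mP PA; set N := size (mfactors (lift A)).
have loopN : looping phi P N.
  apply: contraT; rewrite -looping_uniq => /uniq_leq_size -/(_ (mfactors (lift A))).
  rewrite size_traject ltnn; apply => Q /trajectP [i _ ->].
  exact: frob_iter_factor.
have ex : exists r, looping phi P r by exists N.
case: (ex_minnP ex) => -[|r] lr minr.
  by move: lr; rewrite /looping /= in_nil.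
have us : uniq (traject phi P r.+1).
  by rewrite looping_uniq; apply/negP => /minr; rewrite ltnn.
exists (traject phi P r.+1); split => //.
- exact: mem_head.
- by move=> Q /trajectP [i _ ->]; exists i.
(* The first repetition returns to P itself: otherwise injectivity of Frobenius would give an
   earlier repetition. *)
have back : iter r.+1 phi P = P.
  have /trajectP [[|i] ir e] := lr; first exact: e.
  have e' : iter r phi P = iter i phi P.
    by apply: (@map_mpoly_inj _ _ n (frobL io)); apply: e.
  have : looping phi P r by apply/trajectP; exists i.
  by move/minr; rewrite ltnn.
rewrite -(perm_cons P) -[in X in perm_eq _ (X :: _)]back.
have mapS m P' : map phi (traject phi P' m) = traject phi (phi P') m.
  by elim: m P' => [//|m IH] P' /=; rewrite IH.
have -> : P :: map phi (traject phi P r.+1) = traject phi P r.+2.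
  by rewrite [RHS]trajectS mapS.
by rewrite trajectSr back -cats1 perm_catC.
Qed.

(** Q is the product of the Frobenius orbit of P, hence has coefficients in [kappa]. The orbit is
    listed without repetition, so P occurs exactly once in Q; this is what makes multiplicities over
    L agree with those over [kappa]. *)
Lemma frob_descent P A : A != 0 -> monic_irr P -> rdivides P (lift A) ->
  exists Q, [/\ irreducible_elt Q, count_mem P (mfactors (lift Q)) = 1%N &
    forall C, C != 0 -> rdivides P (lift C) -> rdivides Q C].
Proof.
move=> A0 mP PA; have [s [us Ps orb ps]] := frob_orbit A0 mP PA.
have ms Q : Q \in s -> monic_irr Q.
  move=> /orb [i ->]; have := frob_iter_factor i A0 mP PA.
  by apply: mfactors_monic; rewrite map_mpoly_eq0.
have [Q liftQ] : exists Q, lift Q = \prod_(R <- s) R.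
  by apply: frob_mpoly_fixed; rewrite rmorph_prod -[RHS](perm_big _ ps) /= big_map.
have Q0 : lift Q != 0.
  rewrite liftQ prodf_seq_neq0; apply/allP => R /ms [[R0 _ _] _]; exact: R0.
have fQ : perm_eq (mfactors (lift Q)) s.
  by apply: (@mfactors_perm _ _ _ _ 1) => //; rewrite mul1r.
have descend C : C != 0 -> rdivides P (lift C) -> rdivides Q C.
  move=> C0 PC; have lC0 : lift C != 0 by rewrite map_mpoly_eq0.
  have sub : {subset s <= mfactors (lift C)}.
    by move=> R /orb [i ->]; apply: frob_iter_factor.
  have [u pu] := uniq_sub_perm us sub.
  have [W WE] : rdivides (lift Q) (lift C).
    rewrite (mfactorsE lC0) (perm_big _ pu) big_cat /= -liftQ.
    by exists ((mleadc (lift C))%:MP * \prod_(i <- u) i); rewrite mulrCA mulrC.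
  (* The quotient of two polynomials over [kappa] is fixed by Frobenius, so it is itself defined
     over [kappa]. *)
  have [W0 W0E] : exists W0, lift W0 = W.
    apply: frob_mpoly_fixed; apply: (mulIf Q0).
    have : phi (W * lift Q) = W * lift Q by rewrite -WE frob_mpoly_lift.
    by rewrite rmorphM /= frob_mpoly_lift.
  by exists W0; apply: (@map_mpoly_inj _ _ n io); rewrite WE -W0E rmorphM.
exists Q; split => //; last first.
  by rewrite (seq.permP fQ) count_uniq_mem // Ps.
have PQ : rdivides P (lift Q).
  by apply/mem_mfactors => //; rewrite (perm_mem fQ).
split; first by rewrite map_mpoly_eq0 in Q0.
  rewrite mpoly_unitE; apply/negP => /msize_poly1P [c c0 Qc].
  move: PQ; rewrite Qc map_mpolyC => -[W WE].
  have [[_ /negP Pu _] _] := mP; apply: Pu.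
  have : (io c)%:MP_[n] \is a GRing.unit by rewrite mpoly_unitE msizeC fmorph_eq0 c0.
  by rewrite WE unitrM => /andP[].
(* If Q = X Y and P divides [lift X], then Q divides X by descent and Y is a unit; P, being prime,
   divides one of the two lifts. *)
have step X Y : Q = X * Y -> rdivides P (lift X) -> Y \is a GRing.unit.
  move=> QXY PX; have X0 : X != 0.
    by apply: contraNneq Q0 => X0; rewrite QXY X0 mul0r rmorph0.
  have [W WX] := descend X X0 PX.
  have : W * Y = 1.
    by apply: (mulfI X0); rewrite mulr1 mulrCA -QXY -WX.
  by move/(congr1 (fun z => z \is a GRing.unit)); rewrite unitr1 unitrM => /andP[].
move=> X Y QXY; have [_ _ pP] := monic_irr_prime mP.
have := PQ; rewrite {1}QXY rmorphM => /pP [/(step _ _ QXY)|]; first by right.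
by rewrite mulrC in QXY => /(step _ _ QXY); left.
Qed.

End FrobeniusDescent.

(** * Counting solutions of translation relations *)

(* A fixed-point-free self-map has components of size at least two; a function
   constant on components is determined on at most half of the points. *)
Lemma card_constant_on_orbits (T B : finType) (phi : T -> T) (Y : {set B}) :
  (forall x, phi x != x) -> (0 < #|Y|)%N ->
  (#|[set c : {ffun T -> B} | [forall x, (c x \in Y) && (c (phi x) == c x)]]|
     <= #|Y| ^ (#|T|./2))%N.
Proof.
move=> nofix Y0; pose e : rel T := [rel x y | (phi x == y) || (phi y == x)].
have ind (P : T -> T -> Prop) : (forall x, P x x) ->
    (forall x z y, e x z -> P z y -> P x y) -> forall x y, connect e x y -> P x y.
  move=> P0 PS x y /connectP [q eq ->]; elim: q x eq => [|z q IH] x /=; first by [].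
  by move=> /andP[xz zq]; apply: PS xz (IH z zq).
have symc : connect_sym e.
  suff h x y : connect e x y -> connect e y x by move=> x y; apply/idP/idP; apply: h.
  apply: (ind (fun x y => connect e y x)) => {x y} [x|x z y xz zy]; first exact: connect0.
  by apply: connect_trans zy (connect1 _); move: xz; rewrite /e /= orbC.
have const (c : {ffun T -> B}) x y : (forall z, c (phi z) = c z) ->
    connect e x y -> c x = c y.
  move=> cphi; apply: (ind (fun x y => c x = c y)) => {x y} // x z y /orP[]/eqP <-.
    by rewrite cphi.
  by rewrite cphi.
pose Rt := [set x | fingraph.root e x == x].
(* [Rt] has one representative per component. As phi x lies in the component of x and differs from
   x, phi maps [Rt] injectively to its complement. *)
have half : (#|Rt| <= #|T|./2)%N.
  have rphi x : fingraph.root e (phi x) = fingraph.root e x.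
    by apply/eqP; rewrite (root_connect symc); apply: connect1; rewrite /e /= eqxx orbT.
  have inj : {in Rt &, injective phi}.
    move=> x y; rewrite !inE => /eqP rx /eqP ry /(congr1 (fingraph.root e)).
    by rewrite !rphi rx ry.
  have disj : Rt :&: (phi @: Rt) = finset.set0.
    apply/setP => y; rewrite !inE; apply/negbTE/negP => /andP[/eqP ry /imsetP [x]].
    rewrite inE => /eqP rx yE; move: ry; rewrite yE rphi rx => /eqP.
    by rewrite eq_sym (negPf (nofix x)).
  have := max_card (mem (Rt :|: phi @: Rt)).
  rewrite cardsU disj cards0 subn0 (card_in_imset inj) addnn => le.
  by rewrite -(doubleK #|Rt|) half_leq.
apply: (@leq_trans (#|Y| ^ #|Rt|)); last by rewrite leq_pexp2l.
have [y0 _] := card_gt0P Y0.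
pose r (c : {ffun T -> B}) := [ffun x => if x \in Rt then c x else y0].
rewrite -(card_pffun_on y0 (mem Rt) (mem Y)).
have injr : {in [set c : {ffun T -> B} | [forall x, (c x \in Y) && (c (phi x) == c x)]] &,
    injective r}.
  move=> c1 c2; rewrite !inE => /forallP h1 /forallP h2 rE.
  have const1 x : c1 x = c1 (fingraph.root e x).
    by apply: const (connect_root e x) => z; have /andP[_ /eqP] := h1 z.
  have const2 x : c2 x = c2 (fingraph.root e x).
    by apply: const (connect_root e x) => z; have /andP[_ /eqP] := h2 z.
  apply/ffunP => x; rewrite const1 const2.
  have := congr1 (fun f : {ffun T -> B} => f (fingraph.root e x)) rE.
  by rewrite !ffunE inE (root_root symc) eqxx.
rewrite -(card_in_imset injr); apply: subset_leq_card.
apply/fintype.subsetP => _ /imsetP [c cS ->]; apply/pffun_onP; split.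
  by apply/supportP => x xR; rewrite ffunE (negPf xR).
move=> y /fintype.imageP [x xR yE]; rewrite yE ffunE (xR : x \in Rt).
by move: cS; rewrite inE => /forallP /(_ x) /andP[].
Qed.

Section CountSolutions.
Variables (gT : finGroupType) (T : finType).
Hypothesis abelT : abelian [set: gT].
Implicit Types (H V : {group gT}) (phi : T -> T) (m : {ffun T -> gT}).
Local Open Scope group_scope.

(** In multiplicative notation, the relations m_(phi j) - m_j in V for all listed pairs (V, phi), on
    families with entries in H. *)
Definition solutions (L : seq ({group gT} * (T -> T))) H : {set {ffun T -> gT}} :=
  [set m : {ffun T -> gT} | [forall j, m j \in H] &&
     all (fun p : {group gT} * (T -> T) => [forall j, (m j)^-1 * m (p.2 j) \in p.1]) L].

Definition capgroup (L : seq ({group gT} * (T -> T))) H : {group gT} :=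
  foldl (fun A p => A :&: p.1)%G H L.

Lemma card_fiber_leq (I J : finType) (A : {set I}) (f : I -> J) (M : nat) :
  (forall y, #|[set x in A | f x == y]| <= M)%N -> (#|A| <= #|f @: A| * M)%N.
Proof.
move=> h; rewrite -sum1_card (partition_big f (mem (f @: A))) /=; last first.
  by move=> x xA; apply: imset_f.
rewrite -sum_nat_const; apply: leq_sum => y _; apply: leq_trans (h y).
by rewrite -sum1_card; apply: eq_leq; apply: eq_bigl => x; rewrite inE.
Qed.

(* For a pair (V, phi), a solution is constant along phi modulo H :&: V, and two
   solutions with the same class modulo H :&: V differ by a solution in it. *)
Lemma card_solutions L H : (forall p, p \in L -> forall x, p.2 x != x) ->
  (#|solutions L H| <= #|H| ^ (#|T|./2) * #|capgroup L H| ^ uphalf #|T|)%N.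
Proof.
elim: L H => [|[V phi] L IH] H nofix.
  (* Without relations the count is #H^(#T), and the two exponents add up to #T. *)
  rewrite -expnD uphalf_half addnC -addnA addnn odd_double_half.
  rewrite -(card_ffun_on T (mem H)); apply: subset_leq_card; apply/fintype.subsetP => m.
  by rewrite inE /= andbT => /forallP mH; apply/ffun_onP => j; apply: mH.
set V' := (H :&: V)%G.
pose f (m : {ffun T -> gT}) : {ffun T -> {set gT}} := [ffun j => m j *: V'].
have fib y : (#|[set m in solutions ((V, phi) :: L) H | f m == y]| <= #|solutions L V'|)%N.
  set A := [set m in _ | _]; have [->|[m0 m0A]] := set_0Vmem A; first by rewrite cards0.
  pose tr (m : {ffun T -> gT}) : {ffun T -> gT} := [ffun j => (m0 j)^-1 * m j].
  have trinj : injective tr.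
    move=> m1 m2 /ffunP e; apply/ffunP => j.
    by have := e j; rewrite !ffunE => /mulgI.
  rewrite -(card_imset _ trinj); apply: subset_leq_card.
  apply/fintype.subsetP => _ /imsetP [m mA ->].
  move: m0A mA; rewrite !inE /= => /andP[/andP[/forallP m0H /andP[_ /allP m0L]] /eqP f0].
  move=> /andP[/andP[/forallP mH /andP[_ /allP mL]] /eqP f1].
  apply/andP; split.
    apply/forallP => j; rewrite ffunE.
    have := congr1 (fun c : {ffun T -> {set gT}} => c j) (etrans f1 (esym f0)).
    by rewrite !ffunE => /lcoset_eqP; rewrite mem_lcoset.
  apply/allP => p pL; apply/forallP => j; rewrite !ffunE.
  have /forallP/(_ j) h0 := m0L p pL; have /forallP/(_ j) h1 := mL p pL.
  have comm (x z : gT) : x * z = z * x.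
    by apply: (centsP abelT); rewrite inE.
  have -> : ((m0 j)^-1 * m j)^-1 * ((m0 (p.2 j))^-1 * m (p.2 j)) =
      ((m j)^-1 * m (p.2 j)) * ((m0 j)^-1 * m0 (p.2 j))^-1.
    rewrite !invMg !invgK -!mulgA; congr (_ * _).
    by rewrite (comm (m0 j)) (comm _ (m (p.2 j))) mulgA.
  by rewrite groupM // groupV.
have im : (#|f @: solutions ((V, phi) :: L) H| <= #|H : V'| ^ (#|T|./2))%N.
  rewrite -card_lcosets.
  apply: leq_trans (card_constant_on_orbits (phi := phi) _ _); last 2 first.
  - by move=> x; apply: (nofix (V, phi)); rewrite inE eqxx.
  - by rewrite card_lcosets indexg_gt0.
  apply: subset_leq_card; apply/fintype.subsetP => _ /imsetP [m mA ->].
  move: mA; rewrite !inE /= => /andP[/forallP mH /andP[/forallP mV _]].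
  apply/forallP => j; rewrite !ffunE; apply/andP; split.
    by apply/lcosetsP; exists (m j).
  apply/eqP/lcoset_eqP; rewrite mem_lcoset inE mV andbT.
  by rewrite groupM ?groupV ?mH.
apply: leq_trans (card_fiber_leq fib) _.
apply: leq_trans (leq_mul im (IH V' _)) _.
  by move=> p pL; apply: nofix; rewrite inE pL orbT.
(* By Lagrange the index of V' from the classes and the order of V' from the induction hypothesis
   combine to the order of H. *)
rewrite mulnA -expnMn [(#|H : V'| * _)%N]mulnC Lagrange ?subsetIl //.
Qed.

End CountSolutions.

(** * The norm of a finite extension *)

Lemma finField_generator (F : finFieldType) :
  exists g : F, [/\ g != 0, forall y, y != 0 -> exists s, y = g ^+ s &
    forall a, g ^+ a = 1 -> (#|F|.-1 %| a)%N].
Proof.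
have /cyclic.cyclicP [g gE] := cyclic.field_unit_group_cyclic [set: {unit F}]%G.
exists (FinRing.uval g); split.
  by have := valP g; rewrite /= unitfE.
  move=> y y0; have yu : y \is a GRing.unit by rewrite unitfE.
  have : FinRing.Unit yu \in <[g]>%g by rewrite -gE inE.
  by move=> /cycleP [s e]; exists s; rewrite -FinRing.val_unitX -e.
move=> a ga; rewrite -card_finField_unit gE -orderE cyclic.order_dvdn.
by apply/eqP/val_inj; rewrite FinRing.val_unitX ga.
Qed.

Lemma finField_generator_exp (F : finFieldType) (x : F) (a : nat) :
  x != 0 -> (#|F|.-1 %| a)%N -> x ^+ a = 1.
Proof.
move=> x0 /dvdnP [b ->]; rewrite mulnC exprM.
have -> : x ^+ #|F|.-1 = 1; last by rewrite expr1n.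
apply: (mulfI x0); rewrite -exprS prednK ?expf_card ?mulr1 //.
by apply/card_gt0P; exists 0.
Qed.

Section Norm.
Variables (kappa : finFieldType) (k : fieldExtType kappa).
Local Notation K := (finvect_type k).

Lemma in_alg_inj : injective (in_alg K).
Proof. exact: fmorph_inj. Qed.

Lemma fieldnorm0 : fieldnorm (0 : K) = 0.
Proof. by apply: in_alg_inj; rewrite /= fieldnormE galNorm0 scale0r. Qed.

Lemma fieldnormX (x : K) s : fieldnorm (x ^+ s) = fieldnorm x ^+ s.
Proof.
apply: in_alg_inj; rewrite /= fieldnormE galNormX -fieldnormE.
by rewrite -[LHS](rmorphXn (in_alg K)).
Qed.

Lemma fieldnorm_eq0 (x : K) : (fieldnorm x == 0) = (x == 0).
Proof. by rewrite -(inj_eq in_alg_inj) /= scale0r fieldnormE galNorm_eq0. Qed.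

Lemma card_pred_dvd : (#|kappa|.-1 %| #|K|.-1)%N.
Proof.
have [g [g0 gen gord]] := finField_generator kappa; apply: gord.
apply: in_alg_inj; rewrite rmorphXn rmorph1.
by apply: finField_generator_exp; rewrite ?fmorph_eq0.
Qed.

(** This is surjectivity of the norm: the norm of a generator x has full order. Writing b = x^t
    gives x^(a + t (q0 - 1)) = 1, and q0 - 1 divides #K - 1. *)
Lemma fieldnorm_order (x : K) : (forall a, x ^+ a = 1 -> (#|K|.-1 %| a)%N) ->
  x != 0 -> (forall y, y != 0 -> exists s, y = x ^+ s) ->
  forall a, fieldnorm x ^+ a = 1 -> (#|kappa|.-1 %| a)%N.
Proof.
move=> xord x0 gen a na.
have [alpha galpha alphaE] := finField_galois_generator (sub1v {: K}).
(* Hilbert 90: N(x)^a = 1 gives x^a = b / b^q0, and b is a power of x. *)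
have /(Hilbert's_theorem_90 galpha (memvf _)) [b [_ b0]] : galNorm 1 {: K} (x ^+ a) == 1.
  by rewrite -fieldnormE fieldnormX na scale1r.
rewrite alphaE ?memvf // dimv1 expn1; have [t ->] := gen b b0.
set q0 := #|kappa|; rewrite -exprM => /(congr1 (fun z => z * x ^+ (t * q0))).
rewrite divfK ?expf_neq0 // -exprD => e.
have q00 : (0 < q0)%N by apply/card_gt0P; exists 0.
have : x ^+ (a + t * q0.-1) = 1.
  apply: (mulIf (expf_neq0 t x0)); rewrite -exprD mul1r -e -addnA; congr (_ ^+ (_ + _)).
  by rewrite -mulnSr prednK.
move/xord/(dvdn_trans card_pred_dvd); rewrite dvdn_addl // dvdn_mull //.
Qed.

(** The norm of a generator generates the unit group of [kappa], so composing with the norm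
    preserves the order d. *)
Lemma cyclic_char_norm_comp (R : realType) (chi : {unit kappa} -> R[i]) (d : nat) :
  mulchar chi -> char_order chi d ->
  cyclic_char d (fun y : K => char_ext chi (fieldnorm y)).
Proof.
move=> [chi1 chiM] [d0 chid mind].
have [g [g0 gen gord]] := finField_generator K.
have chiX u s : chi (u ^+ s)%g = chi u ^+ s.
  by elim: s => [|s IH]; rewrite ?expg0 // expgS chiM IH -exprS.
have nu : fieldnorm g \is a GRing.unit by rewrite unitfE fieldnorm_eq0.
pose u := FinRing.Unit nu.
have extE s : char_ext chi (fieldnorm g ^+ s) = chi u ^+ s.
  rewrite /char_ext -[fieldnorm g]/(val u) -FinRing.val_unitX valK.
  exact: chiX.
have uord a : (u ^+ a)%g = 1%g -> (#|kappa|.-1 %| a)%N.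
  move=> ua; apply: (fieldnorm_order gord g0 gen).
  by rewrite -[fieldnorm g]/(val u) -FinRing.val_unitX ua.
have gen_u v : exists s, v = (u ^+ s)%g.
  have : v \in <[u]>%g.
    have -> : <[u]>%g = [set: {unit kappa}]; last by rewrite inE.
    apply/eqP; rewrite eqEcard finset.subsetT card_finField_unit -orderE.
    by apply: dvdn_leq; rewrite ?order_gt0 //; apply: uord; rewrite expg_order.
  by move=> /cycleP.
exists g, (chi u); split => //.
- apply/andP; split => //; apply/forallP => i; rewrite unity_rootE; apply/eqP.
  have [->|ne] := eqVneq i.+1 d; first by rewrite chid eqxx.
  apply/negbTE/negP => /eqP e; have : (d <= i.+1)%N.
    by apply: mind => // v; have [s ->] := gen_u v; rewrite chiX -exprM mulnC exprM e expr1n.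
  by rewrite leq_eqVlt eq_sym (negPf ne) ltnS leqNgt ltn_ord.
- by rewrite fieldnorm0 /char_ext insubF // unitr0.
- by move=> s; rewrite fieldnormX extE.
Qed.

End Norm.

(** The generator g of k is sent to a root in L of its minimal polynomial. This moves translations
    over k into the closed field where the stabilizer of F is assumed finite. *)
Lemma finField_embedding (kappa : finFieldType) (k : fieldExtType kappa)
    (L : closedFieldType) (io : {rmorphism kappa -> L}) :
  exists e : {rmorphism finvect_type k -> L}, forall a, e (a%:A) = io a.
Proof.
set K := finvect_type k.
have [g [g0 gen _]] := finField_generator K.
pose f (q : {poly kappa}) : K := (map_poly (in_alg K) q).[g].
have [mp mpE] := polyOver1P (minPolyOver 1 g).
have [r rP] : exists r, root (map_poly io mp) r.
  apply/closed_rootP; rewrite size_map_poly -(size_map_poly (in_alg K)) -mpE size_minPoly.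
  by rewrite eqSS -lt0n.
pose h (q : {poly kappa}) : L := (map_poly io q).[r].
have f0h q : f q = 0 -> h q = 0.
  move=> fq; have : minPoly 1 g %| map_poly (in_alg K) q.
    apply: minPoly_dvdp; last by rewrite /root -/(f q) fq.
    by apply/polyOver1P; exists q.
  rewrite mpE dvdp_map => /dvdpP [c ->].
  by rewrite /h rmorphM hornerM (eqP rP) mulr0.
have fD q1 q2 : f (q1 - q2) = f q1 - f q2 by rewrite /f rmorphB hornerD hornerN.
have fM q1 q2 : f (q1 * q2) = f q1 * f q2 by rewrite /f rmorphM hornerM.
have hD q1 q2 : h (q1 - q2) = h q1 - h q2 by rewrite /h rmorphB hornerD hornerN.
have hM q1 q2 : h (q1 * q2) = h q1 * h q2 by rewrite /h rmorphM hornerM.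
have surj y : exists q, f q = y.
  have [->|/gen [s ->]] := eqVneq y 0; first by exists 0; rewrite /f rmorph0 horner0.
  by exists 'X^s; rewrite /f map_polyXn hornerXn.
have [sec secE] := choice surj.
pose e0 (y : K) : L := h (sec y).
have e0f q : e0 (f q) = h q.
  by apply/eqP; rewrite -subr_eq0 -hD; apply/eqP/f0h; rewrite fD secE subrr.
have e0_zmod : zmod_morphism e0.
  by move=> x y; rewrite -{1}(secE x) -{1}(secE y) -fD e0f hD.
have e0_monoid : monoid_morphism e0.
  split=> [|x y]; last by rewrite -{1}(secE x) -{1}(secE y) -fM e0f hM.
  have -> : 1 = f 1 by rewrite /f rmorph1 hornerC.
  by rewrite e0f /h rmorph1 hornerC.
pose e : {rmorphism K -> L} := HB.pack e0
  (GRing.isZmodMorphism.Build K L e0 e0_zmod)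
  (GRing.isMonoidMorphism.Build K L e0 e0_monoid).
exists e => a; have -> : a%:A = f a%:P by rewrite /f map_polyC hornerC.
by rewrite /= e0f /h map_polyC hornerC.
Qed.

(** * Multiplicities in a perfect power *)

Section MultiplicityCount.
Variables (L : fieldType) (n : nat).
Implicit Types (P A B : {mpoly L[n]}).

Definition multiplicity P A := count_mem P (mfactors A).

Lemma multiplicityM P A B : A != 0 -> B != 0 ->
  multiplicity P (A * B) = (multiplicity P A + multiplicity P B)%N.
Proof. by move=> A0 B0; rewrite /multiplicity (seq.permP (mfactorsM A0 B0)) count_cat. Qed.

Lemma multiplicity1 P : multiplicity P 1 = 0%N.
Proof.
rewrite /multiplicity (seq.permP (@mfactors_perm _ _ 1 [::] 1 (oner_neq0 _) _ _)) //.
by rewrite big_nil mulr1.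
Qed.

Lemma multiplicityX P A m : A != 0 -> multiplicity P (A ^+ m) = (m * multiplicity P A)%N.
Proof.
move=> A0; elim: m => [|m IH]; first by rewrite expr0 multiplicity1.
by rewrite exprS multiplicityM ?expf_neq0 // IH mulSn.
Qed.

Lemma multiplicity_prod P (I : eqType) (r : seq I) (Q : pred I) (F : I -> {mpoly L[n]}) :
  (forall i, F i != 0) ->
  multiplicity P (\prod_(i <- r | Q i) F i) = (\sum_(i <- r | Q i) multiplicity P (F i))%N.
Proof.
move=> F0; elim: r => [|i r IH]; first by rewrite !big_nil multiplicity1.
rewrite !big_cons; case: (Q i) => //; rewrite multiplicityM // ?IH //.
by rewrite prodf_seq_neq0; apply/allP => t _; rewrite F0 implybT.
Qed.

Lemma multiplicity_eq0 P A : A != 0 -> monic_irr P -> ~ rdivides P A -> multiplicity P A = 0%N.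
Proof.
move=> A0 mP nPA; apply/count_memPn/negP => /(mem_mfactors A0 mP); exact: nPA.
Qed.

Lemma multiplicity_mshift P A (a : 'rV[L]_n) : A != 0 ->
  multiplicity P (mshift a A) = multiplicity (mshift (- a) P) A.
Proof. exact: count_mfactors_mshift. Qed.

End MultiplicityCount.

(** Let Q be the descent of P. Since P occurs once in Q and Q divides whatever P divides, the
    multiplicity of P over L is that of Q over [kappa], where power-freeness applies. *)
Lemma power_free_multiplicity (kappa : finFieldType) (L : closedFieldType)
    (io : {rmorphism kappa -> L}) (n d : nat) (N D : {mpoly kappa[n]}) P :
  (0 < d)%N -> N != 0 -> D != 0 -> power_free d (tofrac N / tofrac D) ->
  monic_irr P ->
  (multiplicity P (map_mpoly io N) < multiplicity P (map_mpoly io D) + d)%N /\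
  (multiplicity P (map_mpoly io D) < multiplicity P (map_mpoly io N) + d)%N.
Proof.
move=> d0 N0 D0 free mP.
have l0 C : C != 0 -> map_mpoly io C != 0 :> {mpoly L[n]} by rewrite map_mpoly_eq0.
have [[A [A0 PA]]|none] := pselect (exists A, A != 0 /\ rdivides P (map_mpoly io A)); last first.
  have z C : C != 0 -> multiplicity P (map_mpoly io C) = 0%N.
    by move=> C0; apply: multiplicity_eq0 => //; [exact: l0 | move=> h; apply: none; exists C].
  by rewrite !z //.
have [Q [irQ mQ descend]] := frob_descent A0 mP PA.
have [Q0 Qu _] := irQ.
have split_off C : C != 0 -> exists e C', [/\ C = Q ^+ e * C', ~ rdivides Q C' &
    multiplicity P (map_mpoly io C) = e].
  have [b sb] := ubnP (msize C); elim: b C sb => [//|b IH] C; rewrite ltnS => sb C0.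
  have [[C1 CE]|nQC] := pselect (rdivides Q C); last first.
    exists 0%N, C; rewrite expr0 mul1r; split => //.
    by apply: multiplicity_eq0 (l0 C C0) mP _ => /(descend _ C0).
  have C10 : C1 != 0 by apply: contraNneq C0 => e; rewrite CE e mul0r.
  have [|e [C' [C1E nQ mC1]]] := IH C1 _ C10.
    apply: leq_trans sb; rewrite CE msizeM //.
    have Q1 : (1 < msize Q)%N.
      by move: Qu Q0; rewrite mpoly_unitE -msize_poly_eq0; case: (msize Q) => [|[|]].
    have C11 : (0 < msize C1)%N by rewrite lt0n msize_poly_eq0.
    by move: Q1 C11; move: (msize Q) (msize C1) => x y; clear; lia.
  exists e.+1, C'; rewrite exprS; split => //; first by rewrite CE C1E; ring.
  rewrite CE rmorphM multiplicityM ?l0 //; rewrite mC1.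
  by rewrite [multiplicity P (map_mpoly io Q)]mQ addn1.
have [a [N' [NE nN mN]]] := split_off N N0; have [b [D' [DE nD mD]]] := split_off D D0.
have TQ0 : tofrac Q != 0 by rewrite tofrac_eq0.
have hm : has_mult Q (tofrac N / tofrac D) (a%:Z - b%:Z).
  exists N', D'; split => //; rewrite NE DE !tofracM !tofracXn.
  rewrite expfzDr // -exprnN /exprz invfM; ring.
have /andP [h1 h2] := free Q irQ _ hm.
rewrite mN mD; split; move: h1 h2; clear; lia.
Qed.

Lemma cross_power (F : fieldType) (x y g a b : F) (d : nat) :
  x / y = g ^+ d -> g = a / b -> y != 0 -> b != 0 -> x * b ^+ d = y * a ^+ d.
Proof.
move=> e1 e2 y0 b0; have bd0 : b ^+ d != 0 by rewrite expf_neq0.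
by rewrite -[x](divfK y0) e1 e2 expr_div_n mulrAC divfK // mulrC.
Qed.

(** Consider the translate of P by a_i0. If all other indices are balanced, their contributions
    cancel, and the d-th power identity forces the multiplicities of P in N and D to be congruent
    modulo d; they differ by less than d, so they are equal. *)
Lemma perfect_power_shift (L : fieldType) (n d s : nat) (N D : {mpoly L[n]})
    (a : 'I_(2 * s) -> 'rV[L]_n) :
  (0 < d)%N -> N != 0 -> D != 0 ->
  (forall P, monic_irr P -> (multiplicity P N < multiplicity P D + d)%N /\
    (multiplicity P D < multiplicity P N + d)%N) ->
  perfect_power d
    (tofrac (\prod_(i < 2 * s | (i < s)%N) mshift (a i) N *
             \prod_(i < 2 * s | (s <= i)%N) mshift (a i) D) /
     tofrac (\prod_(i < 2 * s | (i < s)%N) mshift (a i) D *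
             \prod_(i < 2 * s | (s <= i)%N) mshift (a i) N)) ->
  forall P, monic_irr P -> multiplicity P N != multiplicity P D ->
  forall i0, exists i1, i1 != i0 /\
    multiplicity (mshift (a i0 - a i1) P) N != multiplicity (mshift (a i0 - a i1) P) D.
Proof.
move=> d0 N0 D0 bnd [g gE] P mP wP i0.
apply: contrapT => none.
have same i : i != i0 -> multiplicity (mshift (a i0 - a i) P) N =
    multiplicity (mshift (a i0 - a i) P) D.
  by move=> ne; apply/eqP; apply: contrapT => /negP h; apply: none; exists i.
have shift0 C i : C != 0 -> mshift (a i) C != 0 by rewrite mshift_eq0.
move: gE; set Num := (X in tofrac X / _); set Den := (X in _ / tofrac X) => gE.
have Num0 : Num != 0.
  by rewrite mulf_neq0 //; apply/prodf_neq0 => i _; apply: shift0.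
have Den0 : Den != 0.
  by rewrite mulf_neq0 //; apply/prodf_neq0 => i _; apply: shift0.
have [A [B [B0 gAB]]] := frac_ratio g.
(* Denominators are cleared so that multiplicities can be compared between polynomials. *)
have E : Num * B ^+ d = Den * A ^+ d.
  apply: tofrac_inj; rewrite (tofracM Num) (tofracM Den) (tofracXn d B) (tofracXn d A).
  by apply: cross_power gE gAB _ _; rewrite tofrac_eq0.
have A0 : A != 0.
  apply: contraTneq (mulf_neq0 Num0 (expf_neq0 d B0)) => A0.
  by rewrite E A0 expr0n gtn_eqF // mulr0 negbK.
pose P0 := mshift (a i0) P.
have back C i : C != 0 -> multiplicity P0 (mshift (a i) C) = multiplicity (mshift (a i0 - a i) P) C.
  move=> C0; rewrite (multiplicity_mshift P0 (a i) C0) /P0 (mshift_comp (- a i) (a i0) P).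
  by rewrite [in LHS](addrC (- a i) (a i0)).
pose c C (i : 'I_(2 * s)) := multiplicity (mshift (a i0 - a i) P) C.
have total C C' : C != 0 -> C' != 0 ->
    multiplicity P0 (\prod_(i < 2 * s | (i < s)%N) mshift (a i) C *
             \prod_(i < 2 * s | (s <= i)%N) mshift (a i) C') =
    (\sum_(i < 2 * s) (if (i < s)%N then c C i else c C' i))%N.
  move=> C0 C'0; rewrite multiplicityM; last 2 first.
  - by apply/prodf_neq0 => i _; apply: shift0.
  - by apply/prodf_neq0 => i _; apply: shift0.
  rewrite !multiplicity_prod; try by move=> i; apply: shift0.
  rewrite [RHS](bigID (fun i : 'I_(2 * s) => (i < s)%N)) /=; congr (_ + _)%N.
    by apply: eq_bigr => i is_; rewrite is_ back.
  apply: eq_big => [i|i]; first by rewrite leqNgt.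
  by rewrite leqNgt => /negPf ->; rewrite back.
have := congr1 (multiplicity P0) E.
rewrite (multiplicityM P0 Num0 (expf_neq0 d B0)) (multiplicityM P0 Den0 (expf_neq0 d A0)).
rewrite (multiplicityX P0 d B0) (multiplicityX P0 d A0).
rewrite (total N D N0 D0) (total D N D0 N0).
rewrite (bigD1 i0) //= [X in _ = (X + _)%N](bigD1 i0) //=.
rewrite (eq_bigr (fun i : 'I_(2 * s) => if (i < s)%N then c D i else c N i)); last first.
  by move=> i ne; rewrite /c same.
set X := (\sum_(i | _) _)%N.
have ci0 C : c C i0 = multiplicity P C by rewrite /c subrr mshift_by0.
rewrite !ci0.
have [h1 h2] := bnd P mP.
move: h1 h2 wP; set x := multiplicity P N; set y := multiplicity P D.
move: (multiplicity P0 A) (multiplicity P0 B) => u v h1 h2 /eqP wP e.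
apply: wP.
have key x1 y1 u1 v1 : (x1 + d * v1 = y1 + d * u1 -> x1 < y1 + d -> y1 < x1 + d -> x1 = y1)%N.
  have mono t t' : (t < t' -> d * t + d <= d * t')%N.
    by rewrite -mulnSr leq_mul2l => ->; rewrite orbT.
  case: (ltngtP u1 v1) => [/mono|/mono|->]; clear; lia.
move: e; case: (i0 < s)%N => e.
  by apply: (key x y u v) => //; move: e; clear; lia.
by apply/esym; apply: (key y x u v) => //; move: e; clear; lia.
Qed.

Lemma map_mpoly_mshift (K L : fieldType) (f : {rmorphism K -> L}) n (a : 'rV[K]_n)
    (P : {mpoly K[n]}) :
  map_mpoly f (mshift a P) = mshift (map_mx f a) (map_mpoly f P).
Proof.
have XU i : map_mpoly f (mshift a 'X_i) = mshift (map_mx f a) 'X_i.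
  by rewrite !mshiftXU rmorphD /= map_mpolyC map_mpolyX mxE.
have X m : map_mpoly f (mshift a 'X_[m]) = mshift (map_mx f a) 'X_[m].
  rewrite !mpolyXE_id (mshift_prod a) (mshift_prod (map_mx f a)) rmorph_prod.
  apply: eq_bigr => i _.
  by rewrite (mshiftX a 'X_i) (mshiftX (map_mx f a) 'X_i) rmorphXn /= XU.
elim/mpolyind: P => [|c m P _ _ IH]; first by rewrite mshift_zero !rmorph0 mshift_zero.
have E : map_mpoly f (mshift a (c *: 'X_[m])) = mshift (map_mx f a) (map_mpoly f (c *: 'X_[m])).
  rewrite (mshiftZ a c 'X_[m]) !map_mpolyZ X map_mpolyX.
  by rewrite (mshiftZ (map_mx f a) (f c) 'X_[m]).
rewrite (mshiftD a (c *: 'X_[m]) P) !rmorphD /= IH E.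
by rewrite (mshiftD (map_mx f a) (map_mpoly f (c *: 'X_[m])) (map_mpoly f P)).
Qed.

(** * Unbalanced factors and their stabilizers *)

Section UnbalancedFactors.
Variables (L : fieldType) (n : nat) (N D : {mpoly L[n]}).
Hypotheses (N0 : N != 0) (D0 : D != 0).

Definition unbalanced : seq {mpoly L[n]} :=
  [seq P <- mfactors N ++ mfactors D | multiplicity P N != multiplicity P D].

Lemma mem_unbalanced P :
  P \in unbalanced <-> monic_irr P /\ multiplicity P N != multiplicity P D.
Proof.
rewrite mem_filter mem_cat; split.
  by move=> /andP[-> /orP[]/mfactors_monic h]; split => //; apply: h.
move=> [_ neq]; rewrite neq -!has_pred1 !has_count /= -!/(multiplicity _ _).
by move: neq; case: (multiplicity P N) => [|x] //; case: (multiplicity P D).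
Qed.

Lemma size_unbalanced : (size unbalanced <= msize N + msize D)%N.
Proof.
rewrite size_filter; apply: leq_trans (count_size _ _) _; rewrite size_cat.
by apply: leq_add; apply: ltnW; apply: size_mfactors.
Qed.

(** Both sides have the same multiplicity at every P. An unbalanced P is fixed by the translation;
    if P is balanced, so is its translate by -a, since an unbalanced translate would be fixed and so
    equal to P. *)
Lemma fixed_unbalanced (a : 'rV[L]_n) :
  (forall P, P \in unbalanced -> mshift a P = P) ->
  N * mshift a D = mshift a N * D.
Proof.
move=> fixU.
have [tN0 tD0] : mshift a N != 0 /\ mshift a D != 0 by rewrite !mshift_eq0.
have l0 : N * mshift a D != 0 by rewrite mulf_neq0.
have r0 : mshift a N * D != 0 by rewrite mulf_neq0.
have lead : mleadc (N * mshift a D) = mleadc (mshift a N * D).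
  by rewrite !mleadM // !mleadcM (mlead_mshift a N).2 (mlead_mshift a D).2.
rewrite (mfactorsE l0) (mfactorsE r0) lead; congr (_ * _); apply: perm_big.
apply/allP => P Pin /=.
have mP : monic_irr P.
  by move: Pin; rewrite mem_cat => /orP[]/mfactors_monic h; apply: h.
rewrite -!/(multiplicity _ _) !multiplicityM // !multiplicity_mshift //.
have mtP : monic_irr (mshift (- a) P) by apply: monic_irr_mshift.
have [eq|neq] := eqVneq (multiplicity P N) (multiplicity P D); last first.
  have tP : mshift a P = P by apply: fixU; apply/mem_unbalanced.
  by rewrite -{2 3}tP mshiftK addnC.
have [eq2|neq2] := eqVneq (multiplicity (mshift (- a) P) N) (multiplicity (mshift (- a) P) D).
  by rewrite eq eq2 addnC.
have : mshift a (mshift (- a) P) = mshift (- a) P by apply: fixU; apply/mem_unbalanced.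
by rewrite mshiftKV => tP; move: neq2; rewrite -tP eq eqxx.
Qed.

End UnbalancedFactors.

Section CountPerfect.
Variables (K : finFieldType) (L : fieldType) (j : {rmorphism K -> L}) (n : nat).

Definition stabilizer (P : {mpoly L[n]}) : {set 'rV[K]_n} :=
  [set u : 'rV[K]_n | mshift (map_mx j u) P == P].

Lemma group_set_stabilizer P : group_set (stabilizer P).
Proof.
apply/group_setP; split.
  by rewrite inE FinRing.zmod1gE map_mx0 mshift_by0.
move=> u v; rewrite !inE FinRing.zmodMgE map_mxD => /eqP uP /eqP vP.
by rewrite -(mshift_comp (map_mx j u) (map_mx j v)) vP uP.
Qed.

Definition stabilizer_group P : {group 'rV[K]_n} := Group (group_set_stabilizer P).

Lemma mem_capgroup (T : finType) (l : seq ({group 'rV[K]_n} * (T -> T))) H u :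
  u \in capgroup l H -> u \in H /\ forall p, p \in l -> u \in p.1.
Proof.
elim: l H => [|p l IH] H //= /IH [uH ul]; move: uH; rewrite inE => /andP[uH up].
by split => // p'; rewrite inE => /predU1P[->|/ul].
Qed.

(** For each m, record which index i1 and which member of S answer each pair (P, i0). There are
    boundedly many such records, and for a fixed one the differences of two solutions satisfy the
    stabilizer relations counted by [card_solutions]. *)
Lemma count_shift_related (s t r : nat) (S : seq {mpoly L[n]}) (A : {set 'M[K]_(2 * s, n)}) :
  (size S <= r)%N ->
  (#|[set u : 'rV[K]_n | all (fun P => mshift (map_mx j u) P == P) S]| <= t)%N ->
  (forall m, m \in A -> forall P, P \in S -> forall i0, exists i1, i1 != i0 /\
    mshift (map_mx j (row i0 m) - map_mx j (row i1 m)) P \in S) ->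
  (#|A| <= ((2 * s).+1 * r.+1) ^ (r * (2 * s)) * (#|K| ^ (n * s) * t ^ s))%N.
Proof.
move=> sS st rel.
have leq_expn2r x y e : (x <= y -> x ^ e <= y ^ e)%N.
  by case: e => // e xy; rewrite leq_exp2r.
pose T := 'I_(2 * s); pose I := 'I_(size S).
pose data := {ffun I * T -> T * I}.
pose R (m : 'M[K]_(2 * s, n)) (dl : data) := [forall l : I, forall i : T,
  ((dl (l, i)).1 != i) &&
  (mshift (map_mx j (row i m) - map_mx j (row (dl (l, i)).1 m)) S`_l == S`_(dl (l, i)).2)].
have exR m : m \in A -> exists dl, R m dl.
  move=> mA; have ex (li : I * T) : exists ti : T * I, (ti.1 != li.2) &&
     (mshift (map_mx j (row li.2 m) - map_mx j (row ti.1 m)) S`_li.1 == S`_ti.2).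
    have [i1 [ne /(nthP 0) [x xS xE]]] := rel m mA S`_li.1 (mem_nth 0 (ltn_ord _)) li.2.
    by exists (i1, Ordinal xS); rewrite /= ne xE eqxx.
  have [f fE] := choice ex; exists (finfun f).
  by apply/forallP => l; apply/forallP => i; rewrite ffunE; apply: (fE (l, i)).
have bound dl : (#|[set m | R m dl]| <= #|K| ^ (n * s) * t ^ s)%N.
  have [->|[m0 m0R]] := set_0Vmem [set m | R m dl]; first by rewrite cards0.
  pose l := [seq (stabilizer_group S`_(x : I), fun i : T => (dl (x, i)).1) | x : I <- enum I].
  have nofix p : p \in l -> forall i, p.2 i != i.
    move=> /mapP [x _ ->] i /=; move: m0R; rewrite inE => /forallP /(_ x) /forallP /(_ i).
    by case/andP.
  have abel : abelian [set: 'rV[K]_n].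
    by apply/centsP => u _ v _; rewrite /commute !FinRing.zmodMgE addrC.
  (* Both m and m0 carry the same polynomial of S to the same translate, so in m - m0 the relations
     become membership in stabilizers. *)
  pose tr (m : 'M[K]_(2 * s, n)) : {ffun T -> 'rV[K]_n} := [ffun i => row i m - row i m0].
  have trinj : injective tr.
    move=> m1 m2 /ffunP e; apply/row_matrixP => i.
    by have := e i; rewrite !ffunE => /addIr.
  rewrite -(card_imset _ trinj).
  apply: (@leq_trans #|solutions l [set: 'rV[K]_n]%G|).
    apply: subset_leq_card; apply/fintype.subsetP => _ /imsetP [m mR ->].
    rewrite inE; apply/andP; split; first by apply/forallP => i; rewrite inE.
    apply/allP => _ /mapP [x _ ->]; apply/forallP => i /=.
    move: m0R mR; rewrite !inE => /forallP/(_ x)/forallP/(_ i)/andP[_ /eqP h0].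
    move=> /forallP/(_ x)/forallP/(_ i)/andP[_ /eqP h1].
    rewrite !ffunE FinRing.zmodMgE FinRing.zmodVgE.
    set i1 := (dl (x, i)).1 in h0 h1 *.
    have -> : - (row i m - row i m0) + (row i1 m - row i1 m0) =
        - (row i m - row i1 m) + (row i m0 - row i1 m0).
      rewrite !opprB; set a := row i m; set b := row i m0.
      set c := row i1 m; set d := row i1 m0.
      by rewrite addrACA [b + c]addrC -addrACA.
    rewrite map_mxD map_mxN !map_mxB.
    rewrite -(mshift_comp (- (map_mx j (row i m) - map_mx j (row i1 m)))).
    by rewrite h0 -h1 mshiftK.
  apply: leq_trans (card_solutions abel [set: 'rV[K]_n]%G nofix) _.
  (* As #T = 2 s, both exponents of [card_solutions] are s. *)
  have half : #|T|./2 = s by rewrite card_ord mul2n doubleK.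
  have uph : uphalf #|T| = s by rewrite card_ord mul2n uphalf_double.
  rewrite half uph cardsT card_mx mul1n expnM leq_mul2l; apply/orP; right.
  apply: leq_expn2r; apply: leq_trans st; apply: subset_leq_card.
  apply/fintype.subsetP => u /mem_capgroup [_ h]; rewrite inE.
  apply/(all_nthP 0) => x xS; pose x' : I := Ordinal xS.
  have := h (stabilizer_group S`_x', fun i : T => (dl (x', i)).1).
  by rewrite (map_f _ (mem_enum _ x')) inE; apply.
apply: (@leq_trans (\sum_(dl : data) #|[set m | R m dl]|)%N).
  rewrite -sum1_card big_mkcond /=.
  under [leqRHS]eq_bigr do rewrite -sum1_card big_mkcond /=.
  rewrite exchange_big /=; apply: leq_sum => m _; case: ifP => // /exR [dl mdl].
  by rewrite (bigD1 dl) //= inE mdl.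
apply: (@leq_trans (\sum_(dl : data) #|K| ^ (n * s) * t ^ s)%N).
  by apply: leq_sum => dl _; apply: bound.
rewrite sum_nat_const leq_mul2r; apply/orP; right.
rewrite card_ffun !card_prod !card_ord.
apply: (@leq_trans (((2 * s).+1 * r.+1) ^ (size S * (2 * s)))%N).
  by apply: leq_expn2r; apply: leq_mul => //; apply: leqW.
by apply: leq_pexp2l => //; rewrite leq_mul2r sS orbT.
Qed.

End CountPerfect.


(** * Bounds for the moments *)

Lemma rnum_ratmoment (K : fieldType) n s (F : ratfun K n) (m : 'M[K]_(2 * s, n)) :
  rnum (ratmoment F m) = \prod_(i < 2 * s | (i < s)%N) mshift (row i m) (rnum F) *
                         \prod_(i < 2 * s | (s <= i)%N) mshift (row i m) (rden F).
Proof.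
rewrite /ratmoment /=; congr (_ * _).
  exact: (big_morph (@rnum K n) (fun _ _ => erefl) erefl).
exact: (big_morph (@rnum K n) (fun _ _ => erefl) erefl).
Qed.

Lemma rden_ratmoment (K : fieldType) n s (F : ratfun K n) (m : 'M[K]_(2 * s, n)) :
  rden (ratmoment F m) = \prod_(i < 2 * s | (i < s)%N) mshift (row i m) (rden F) *
                         \prod_(i < 2 * s | (s <= i)%N) mshift (row i m) (rnum F).
Proof.
rewrite /ratmoment /=; congr (_ * _).
  exact: (big_morph (@rden K n) (fun _ _ => erefl) erefl).
exact: (big_morph (@rden K n) (fun _ _ => erefl) erefl).
Qed.

Lemma msize_map_mpoly (K L : fieldType) (f : {rmorphism K -> L}) n (P : {mpoly K[n]}) :
  msize (map_mpoly f P) = msize P.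
Proof.
rewrite !msizeE; apply: perm_big; apply: msupp_map_mpoly; exact: fmorph_inj.
Qed.

Lemma msize_mshift (K : fieldType) n (a : 'rV[K]_n) (P : {mpoly K[n]}) :
  (msize (mshift a P) <= msize P)%N.
Proof.
rewrite -[mshift a P](subrK P); apply: leq_trans (msizeD_le _ _) _.
by rewrite geq_max leqnn andbT (leq_trans (msize_mshiftB a P)) // leq_pred.
Qed.

Lemma msizeM_leqD (K : fieldType) n (P Q : {mpoly K[n]}) :
  (msize (P * Q) <= msize P + msize Q)%N.
Proof.
have [->|P0] := eqVneq P 0; first by rewrite mul0r msize0.
have [->|Q0] := eqVneq Q 0; first by rewrite mulr0 msize0.
by rewrite msizeM // leq_pred.
Qed.

Lemma msize_prod_leq (K : fieldType) n (I : Type) (r : seq I) (Q : pred I)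
    (F : I -> {mpoly K[n]}) (b : nat) :
  (forall i, msize (F i) <= b)%N ->
  (msize (\prod_(i <- r | Q i) F i) <= (size r * b).+1)%N.
Proof.
move=> Fb; elim: r => [|i r IH]; first by rewrite big_nil msize1.
rewrite big_cons /= mulSn -addnS; case: (Q i).
  by apply: leq_trans (msizeM_leqD _ _) _; apply: leq_add.
by apply: leq_trans IH _; apply: leq_addl.
Qed.

Lemma msizeX_leq (K : fieldType) n (P : {mpoly K[n]}) e : (msize (P ^+ e) <= (msize P * e).+1)%N.
Proof.
elim: e => [|e IH]; first by rewrite expr0 msize1.
by rewrite exprS mulnS -addnS; apply: leq_trans (msizeM_leqD _ _) _; rewrite leq_add2l.
Qed.

(** For y nonzero psi(y^d) = 1; at y = 0 both sides are psi(0), the right one because d > 1. *)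
Lemma cyclic_char_div (C : numDomainType) (K : finFieldType) (d : nat) (psi : K -> C) (x y : K) :
  (1 < d)%N -> cyclic_char d psi -> psi (x / y) = psi (x * y ^+ d.-1).
Proof.
move=> d1 cpsi; have [->|y0] := eqVneq y 0.
  by rewrite invr0 expr0n gtn_eqF // -subn1 subn_gt0.
have d0 : (0 < d)%N by apply: ltnW.
have -> : x * y ^+ d.-1 = x / y * y ^+ d by rewrite -[d in RHS]prednK // exprS mulrA divfK.
by rewrite (cyclic_charM cpsi _ (y ^+ d)) (cyclic_charX cpsi) // (cyclic_char_order cpsi) // mulr1.
Qed.

(** The polynomial 1 + X prod (X - a) is nonconstant, so it has a root, but it takes the value 1 on
    [l]. *)
Lemma closed_field_avoid (L : closedFieldType) (l : seq L) : exists x, x \notin l.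
Proof.
pose P : {poly L} := 'X * \prod_(a <- l) ('X - a%:P) + 1.
have sP : size P != 1%N.
  rewrite size_polyDl size_mul ?polyX_eq0 ?monic_neq0 ?monic_prod_XsubC // size_polyX
    size_prod_XsubC // size_poly1 //.
have /closed_rootP [x xP] := sP; exists x; apply/negP => xl.
have : root (\prod_(a <- l) ('X - a%:P)) x by rewrite root_prod_XsubC.
rewrite rootE => /eqP prod0; move: xP.
by rewrite rootE /P hornerD hornerM hornerC prod0 mulr0 add0r oner_eq0.
Qed.

(** The zero function is fixed by all translations, which are infinitely many as n > 0. *)
Lemma transl_stab_num_neq0 (L : closedFieldType) n (F : ratfun L n) :
  (0 < n)%N -> finite_set (transl_stab F) -> rnum F != 0.
Proof.
move=> n0 /finite_seqP [l lE]; apply/eqP => N0.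
have [x] := closed_field_avoid [seq u 0 (Ordinal n0) | u : 'rV[L]_n <- l].
case/negP; apply/mapP; exists (const_mx x); last by rewrite mxE.
have : transl_stab F (const_mx x).
  by rewrite /transl_stab /= /ratfrac /= N0 mshift_zero tofrac0 !mul0r.
by rewrite lE.
Qed.

Lemma map_mpolyM_mshift (K L : fieldType) (f : {rmorphism K -> L}) n (a : 'rV[K]_n)
    (P Q : {mpoly K[n]}) :
  map_mpoly f (P * mshift a Q) = map_mpoly f P * mshift (map_mx f a) (map_mpoly f Q).
Proof. by rewrite -map_mpoly_mshift; apply: rmorphM. Qed.

Lemma map_in_algM_mshift (kappa : finFieldType) (k : fieldExtType kappa) (L : fieldType)
    (f : {rmorphism finvect_type k -> L}) (io : {rmorphism kappa -> L}) n
    (a : 'rV[finvect_type k]_n) (P Q : {mpoly kappa[n]}) :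
  (forall c, f c%:A = io c) ->
  map_mpoly f (map_mpoly (in_alg (finvect_type k)) P *
               mshift a (map_mpoly (in_alg (finvect_type k)) Q)) =
  map_mpoly io P * mshift (map_mx f a) (map_mpoly io Q).
Proof.
move=> fE; have map_f (T : {mpoly kappa[n]}) :
    map_mpoly f (map_mpoly (in_alg (finvect_type k)) T) = map_mpoly io T.
  by apply/mpolyP => m; rewrite !mcoeff_map_mpoly /= fE.
apply: etrans (map_mpolyM_mshift _ _ _ _) _.
exact: (congr2 (fun A B => A * mshift (map_mx f a) B) (map_f P) (map_f Q)).
Qed.

Lemma cross_div (E : fieldType) (x y z t : E) :
  y != 0 -> t != 0 -> x * t = y * z -> x / y = z / t.
Proof. by move=> y0 t0 e; apply/eqP; rewrite eqr_div // e mulrC. Qed.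

Lemma tofrac_div_eq (L : fieldType) n (A B A' B' : {mpoly L[n]}) :
  B != 0 -> B' != 0 -> A * B' = B * A' -> tofrac A / tofrac B = tofrac A' / tofrac B'.
Proof.
move=> B0 B'0 /(congr1 (@tofrac _)); rewrite (tofracM A) (tofracM B) => E.
by apply: (cross_div _ _ E); rewrite tofrac_eq0.
Qed.

(** * Counting the perfect d-th powers *)

Section PartA.
Variables (kappa : finFieldType) (kappabar : closedFieldType)
  (iota : {rmorphism kappa -> kappabar}) (n d s : nat) (F : ratfun kappa n).
Hypotheses (d0 : (0 < d)%N) (N0 : rnum F != 0) (D0 : rden F != 0)
  (free : power_free d (ratfrac F)).
Variables (k : fieldExtType kappa) (kbar : closedFieldType)
  (j : {rmorphism finvect_type k -> kbar}).
Local Notation K := (finvect_type k).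

Let io : {rmorphism kappa -> kbar} := j \o in_alg K.
Let N := map_mpoly io (rnum F).
Let D := map_mpoly io (rden F).

Let map_in_alg (P : {mpoly kappa[n]}) : map_mpoly j (map_mpoly (in_alg K) P) = map_mpoly io P.
Proof. by apply/mpolyP => m; rewrite !mcoeff_map_mpoly. Qed.

Let map_shift_prod (m : 'M[K]_(2 * s, n)) (Q : pred 'I_(2 * s)) (P : {mpoly kappa[n]}) :
  map_mpoly j (\prod_(i < 2 * s | Q i) mshift (row i m) (map_mpoly (in_alg K) P)) =
  \prod_(i < 2 * s | Q i) mshift (map_mx j (row i m)) (map_mpoly io P).
Proof. by rewrite rmorph_prod; apply: eq_bigr => i _ /=; rewrite map_mpoly_mshift map_in_alg. Qed.

Let map_shift_prodM (m : 'M[K]_(2 * s, n)) (Q Q' : pred 'I_(2 * s)) (A B : {mpoly kappa[n]}) :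
  map_mpoly j (\prod_(i < 2 * s | Q i) mshift (row i m) (map_mpoly (in_alg K) A) *
    \prod_(i < 2 * s | Q' i) mshift (row i m) (map_mpoly (in_alg K) B)) =
  \prod_(i < 2 * s | Q i) mshift (map_mx j (row i m)) (map_mpoly io A) *
    \prod_(i < 2 * s | Q' i) mshift (map_mx j (row i m)) (map_mpoly io B).
Proof.
apply: etrans (rmorphM (map_mpoly j) _ _) _.
exact: (congr2 *%R (map_shift_prod m Q A) (map_shift_prod m Q' B)).
Qed.

Lemma moment_perfect_related (m : 'M[K]_(2 * s, n)) : moment_perfect j d F m ->
  forall P, P \in unbalanced N D -> forall i0, exists i1, i1 != i0 /\
    mshift (map_mx j (row i0 m) - map_mx j (row i1 m)) P \in unbalanced N D.
Proof.
move=> perf P PU i0.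
have N0' : N != 0 by rewrite map_mpoly_eq0.
have D0' : D != 0 by rewrite map_mpoly_eq0.
have [mP wP] := (mem_unbalanced N0' D0' P).1 PU.
have bnd (Q : {mpoly kbar[n]}) : monic_irr Q ->
    (multiplicity Q N < multiplicity Q D + d)%N /\ (multiplicity Q D < multiplicity Q N + d)%N.
  by move=> mQ; apply: power_free_multiplicity.
have [g gE] := perf.
have num := etrans (congr1 (map_mpoly j) (rnum_ratmoment (ratmap (in_alg K) F) m))
  (map_shift_prodM m (fun i => (i < s)%N) (fun i => (s <= i)%N) (rnum F) (rden F)).
have den := etrans (congr1 (map_mpoly j) (rden_ratmoment (ratmap (in_alg K) F) m))
  (map_shift_prodM m (fun i => (i < s)%N) (fun i => (s <= i)%N) (rden F) (rnum F)).
have E := etrans (esym (congr2 (fun A B => tofrac A / tofrac B) num den)) gE.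
have [i1 [ne w1]] := perfect_power_shift d0 N0' D0' bnd (ex_intro _ g E) mP wP i0.
exists i1; split; first exact: ne.
by apply/(mem_unbalanced N0' D0'); split; [apply: monic_irr_mshift mP | exact: w1].
Qed.

(** A translation fixing all unbalanced factors fixes F over [kbar]. The cross-multiplied identity
    descends to k and is carried to [kappabar], so these translations inject into the stabilizer of
    F there. *)
Lemma card_common_stabilizer (l : seq 'rV[kappabar]_n) :
  transl_stab (ratmap iota F) = [set` l]%classic ->
  (#|[set u : 'rV[K]_n | all (fun P => mshift (map_mx j u) P == P) (unbalanced N D)]|
     <= size l)%N.
Proof.
move=> lE; have [e eE] := finField_embedding k iota.
set A := [set u | _].
have inj : injective (map_mx e : 'rV[K]_n -> 'rV[kappabar]_n).
  by apply: map_mx_inj; apply: fmorph_inj.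
rewrite cardE -(size_map (map_mx e)); apply: uniq_leq_size.
  by rewrite (map_inj_uniq inj) enum_uniq.
move=> _ /mapP [u uA ->].
have E : N * mshift (map_mx j u) D = D * mshift (map_mx j u) N.
  rewrite [RHS]mulrC; apply: fixed_unbalanced; rewrite ?map_mpoly_eq0 // => P PU.
  by apply/eqP; move: uA; rewrite mem_enum inE => /allP; apply.
pose NK := map_mpoly (in_alg K) (rnum F); pose DK := map_mpoly (in_alg K) (rden F).
have EK : NK * mshift u DK = DK * mshift u NK.
  apply: (@map_mpoly_inj _ _ n j).
  have toN P Q := @map_in_algM_mshift _ _ _ j io n u P Q (fun c => erefl).
  exact: etrans (toN _ _) (etrans E (esym (toN _ _))).
have toe P Q := @map_in_algM_mshift _ _ _ e iota n u P Q eE.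
have Ee := etrans (esym (toe _ _)) (etrans (congr1 (map_mpoly e) EK) (toe _ _)).
have : transl_stab (ratmap iota F) (map_mx e u).
  by apply: tofrac_div_eq Ee; rewrite ?mshift_eq0 map_mpoly_eq0.
by rewrite lE.
Qed.

Lemma card_moment_perfect (l : seq 'rV[kappabar]_n) :
  transl_stab (ratmap iota F) = [set` l]%classic ->
  (#|[set m : 'M[K]_(2 * s, n) | `[< moment_perfect j d F m >]]|
     <= ((2 * s).+1 * (msize (rnum F) + msize (rden F)).+1) ^
          ((msize (rnum F) + msize (rden F)) * (2 * s)) * (#|K| ^ (n * s) * size l ^ s))%N.
Proof.
move=> lE; apply: (@count_shift_related _ _ j _ _ _ _ (unbalanced N D)).
- apply: leq_trans (size_unbalanced _ _) _; rewrite ?map_mpoly_eq0 //.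
  by rewrite !msize_map_mpoly.
- exact: card_common_stabilizer.
- by move=> m; rewrite inE => /asboolP; apply: moment_perfect_related.
Qed.

End PartA.

(** * Bounding the character sum of a moment *)

Lemma div_expr (E : fieldType) (a b g : E) d : (0 < d)%N -> b != 0 ->
  a * b ^+ d.-1 = g ^+ d -> a / b = (g / b) ^+ d.
Proof.
by move=> d0 b0 e; rewrite expr_div_n -e -[d in RHS]prednK // exprSr invfM mulrA mulfK // expf_neq0.
Qed.

(** A / B and A B^(d-1) differ by the d-th power B^d. *)
Lemma perfect_power_clear (L : fieldType) n d (A B : {mpoly L[n]}) : (0 < d)%N ->
  perfect_power d (tofrac (A * B ^+ d.-1)) -> perfect_power d (tofrac A / tofrac B).
Proof.
move=> d0 [g gE]; have [->|B0] := eqVneq B 0.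
  by exists 0; rewrite tofrac0 invr0 mulr0 expr0n gtn_eqF.
exists (g / tofrac B); apply: (div_expr d0); first by rewrite tofrac_eq0.
by rewrite -gE (tofracM A) (tofracXn d.-1 B).
Qed.

Section PartB.
Variables (R : realType) (kappa : finFieldType) (n d s : nat)
  (chi : {unit kappa} -> R[i]) (F : ratfun kappa n).
Hypotheses (mchi : mulchar chi) (ochi : char_order chi d).

(* Bounds the degree of rnum M * rden M ^+ d.-1, M the moment function. *)
Definition moment_degree : nat :=
  let c := (2 * ((2 * s) * (msize (rnum F) + msize (rden F))).+1)%N in (c + (c * d).+1)%N.

Lemma moment_sum_bound (B p : nat) : (p \in [pchar kappa]) ->
  (forall (C : numDomainType) (K : finFieldType) (L : closedFieldType)
    (j : {rmorphism K -> L}) (psi : K -> C) (G : {mpoly K[n]}),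
    p \in [pchar K] -> cyclic_char d psi -> (msize G <= moment_degree)%N ->
    ~ perfect_power d (tofrac (map_mpoly j G)) ->
    `|\sum_(x : 'rV[K]_n) psi G.@[x 0]| * #|K|%:R
      <= (B * frob_half p #|K| * #|K| ^ n)%:R) ->
  forall (k : fieldExtType kappa) (kbar : closedFieldType)
    (j : {rmorphism finvect_type k -> kbar}) (m : 'M[finvect_type k]_(2 * s, n)),
  ~ moment_perfect j d F m ->
  `|moment_sum chi F m| * #|finvect_type k|%:R
    <= (B * frob_half p #|finvect_type k| * #|finvect_type k| ^ n)%:R.
Proof.
move=> pk bound k kbar j m nperf.
have [d0 _ _] := ochi.
pose psi (y : finvect_type k) := char_ext chi (fieldnorm y).
have cpsi : cyclic_char d psi := cyclic_char_norm_comp k mchi ochi.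
pose M := ratmoment (ratmap (in_alg (finvect_type k)) F) m.
pose G := rnum M * rden M ^+ d.-1.
(* For d = 1 every fraction is a perfect d-th power. *)
have d1 : (1 < d)%N.
  rewrite ltn_neqAle d0 andbT eq_sym; apply/eqP => d1; apply: nperf.
  by rewrite d1; eexists; rewrite expr1; reflexivity.
have npow : ~ perfect_power d (tofrac (map_mpoly j G)).
  move=> pG; apply: nperf; apply: (perfect_power_clear d0).
  by rewrite /G (rmorphM (map_mpoly j)) (rmorphXn (map_mpoly j)) in pG.
have pK : p \in [pchar finvect_type k] := rmorph_pchar (in_alg (finvect_type k)) pk.
have mdb (P Q : {mpoly (finvect_type k)[n]}) (u v : pred 'I_(2 * s)) :
    msize P = msize (rnum F) \/ msize P = msize (rden F) ->
    msize Q = msize (rnum F) \/ msize Q = msize (rden F) ->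
    (msize (\prod_(i < 2 * s | u i) mshift (row i m) P *
            \prod_(i < 2 * s | v i) mshift (row i m) Q)
      <= 2 * ((2 * s) * (msize (rnum F) + msize (rden F))).+1)%N.
  move=> hP hQ; apply: leq_trans (msizeM_leqD _ _) _; rewrite [leqRHS]mul2n -[leqRHS]addnn.
  have one (T : {mpoly (finvect_type k)[n]}) (w : pred 'I_(2 * s)) :
      msize T = msize (rnum F) \/ msize T = msize (rden F) ->
      (msize (\prod_(i < 2 * s | w i) mshift (row i m) T)
        <= ((2 * s) * (msize (rnum F) + msize (rden F))).+1)%N.
    move=> hT; have := @msize_prod_leq (finvect_type k) n 'I_(2 * s) (index_enum 'I_(2 * s)) w
      (fun i => mshift (row i m) T) (msize (rnum F) + msize (rden F)).
    rewrite -sum1_size sum_nat_const card_ord muln1; apply => i.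
    apply: leq_trans (msize_mshift _ _) _.
    by case: hT => ->; rewrite ?leq_addr ?leq_addl.
  exact: leq_add (one P u hP) (one Q v hQ).
have sG : (msize G <= moment_degree)%N.
  rewrite /moment_degree; apply: leq_trans (msizeM_leqD _ _) _; apply: leq_add.
    rewrite /M rnum_ratmoment; apply: mdb; rewrite !msize_map_mpoly; by [left|right].
  have sD : (msize (rden M) <= 2 * ((2 * s) * (msize (rnum F) + msize (rden F))).+1)%N.
    rewrite /M rden_ratmoment; apply: mdb; rewrite !msize_map_mpoly; by [left|right].
  apply: leq_trans (msizeX_leq _ _) _; rewrite ltnS.
  by apply: leq_mul => //; apply: leq_pred.
have -> : moment_sum chi F m = \sum_(x : 'rV[finvect_type k]_n) psi G.@[x 0].
  apply: eq_bigr => x _; rewrite -/(psi _) /rateval /G.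
  rewrite (rmorphM (meval (x 0)) (rnum M)) (rmorphXn (meval (x 0))).
  exact: cyclic_char_div.
exact: bound pK cpsi sG npow.
Qed.

End PartB.


(** The exponent is half of log_p q rounded up, so its double is at most log_p q + 1. *)
Lemma frob_half_sqr (p q : nat) : (0 < p)%N -> q = (p ^ logn p q)%N ->
  (frob_half p q ^ 2 <= p * q)%N.
Proof.
move=> p0 qE; rewrite /frob_half [in leqRHS]qE -expnM -expnS.
by apply: leq_pexp2l => //; move: (logn p q) => e; clear; lia.
Qed.

(** Q is at most sqrt p sqrt q; dividing by q turns q^n sqrt q into q^(n - 1/2). *)
Lemma powR_bound (R : realType) (B Q p q n : nat) (S : R[i]) : (0 < q)%N -> (Q ^ 2 <= p * q)%N ->
  `|S| * q%:R <= (B * Q * q ^ n)%:R ->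
  `|S| <= (B%:R * Num.sqrt p%:R * (q%:R `^ (n%:R - 2^-1)))%:C.
Proof.
move=> q0 Qpq; have qR : 0 < q%:R :> R by rewrite ltr0n.
have qC : 0 < q%:R :> R[i] by rewrite ltr0n.
move=> h; rewrite -(ler_pM2r qC); apply: le_trans h _.
have natC (a : nat) : a%:R = (a%:R : R)%:C :> R[i] by rewrite rmorph_nat.
rewrite !natC -rmorphM lecR.
have sq0 : 0 < Num.sqrt q%:R :> R by rewrite sqrtr_gt0.
have QE : Q%:R <= Num.sqrt p%:R * Num.sqrt q%:R :> R.
  rewrite -sqrtrM ?ler0n // -[Q%:R]ger0_norm ?ler0n // -sqrtr_sqr.
  by rewrite ler_sqrt ?mulr_ge0 ?ler0n // -natrX -natrM ler_nat.
have -> : q%:R `^ (n%:R - 2^-1) = q%:R ^+ n / Num.sqrt q%:R :> R.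
  rewrite powRD; last by rewrite [_%:R == 0]gt_eqF // implybT.
  by rewrite powR_mulrn ?ler0n // powRN powR12_sqrt ?ler0n.
have -> : B%:R * Num.sqrt p%:R * (q%:R ^+ n / Num.sqrt q%:R) * q%:R =
    B%:R * (Num.sqrt p%:R * Num.sqrt q%:R) * q%:R ^+ n :> R.
  rewrite -[X in _ * X = _](@sqr_sqrtr R) ?ler0n //; field; exact: lt0r_neq0.
by rewrite !natrM natrX ler_wpM2r ?exprn_ge0 ?ler0n // ler_wpM2l ?ler0n.
Qed.

Theorem proposition1p4 (R : realType) (kappa : finFieldType)
    (kappabar : closedFieldType) (iota : {rmorphism kappa -> kappabar})
    (n : nat) (chi : {unit kappa} -> R[i]) (d : nat) (F : ratfun kappa n)
    (s : nat) :
  integralRange iota ->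
  (1 <= n)%N ->
  mulchar chi -> char_order chi d ->
  rden F != 0 ->
  power_free d (ratfrac F) ->
  finite_set (transl_stab (ratmap iota F)) ->
  (exists C : R, forall (k : fieldExtType kappa) (kbar : closedFieldType)
      (j : {rmorphism finvect_type k -> kbar}),
      integralRange j ->
      #|[set m : 'M[finvect_type k]_(2 * s, n) | `[< moment_perfect j d F m >]]|%:R
        <= C * #|finvect_type k|%:R ^+ (n * s))
  /\
  (exists C : R, forall (k : fieldExtType kappa) (kbar : closedFieldType)
      (j : {rmorphism finvect_type k -> kbar}),
      integralRange j ->
      forall m : 'M[finvect_type k]_(2 * s, n),
      ~ moment_perfect j d F m ->
      `| moment_sum chi F m |
        <= (C * (#|finvect_type k|%:R `^ (n%:R - 2^-1)))%:C).
Proof.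
move=> _ n1 mchi ochi D0 free fin; have [d0 _ _] := ochi.
have N0 : rnum F != 0.
  by have := transl_stab_num_neq0 n1 fin; rewrite /= map_mpoly_eq0.
split.
  have /finite_seqP [l lE] := fin.
  exists (((2 * s).+1 * (msize (rnum F) + msize (rden F)).+1) ^
          ((msize (rnum F) + msize (rden F)) * (2 * s)) * size l ^ s)%:R.
  move=> k kbar j _; rewrite -natrX -natrM ler_nat -mulnA [(size l ^ s * _)%N]mulnC.
  exact: (card_moment_perfect s d0 N0 D0 free j lE).
have [p p_pr pk] := finPcharP kappa.
(* The degree bound depends only on d, s and F, and p only on [kappa], so B and the constant B sqrt
   p are fixed before k and m. *)
have [B bound] := mpoly_char_sum_bound p d (moment_degree d s F) n.
exists (B%:R * Num.sqrt p%:R) => k kbar j _ m nperf.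
apply: (@powR_bound _ _ (frob_half p #|finvect_type k|)).
- by apply/card_gt0P; exists 0.
- apply: frob_half_sqr; first exact: prime_gt0.
  by apply: card_finField_pchar; apply: (rmorph_pchar (in_alg (finvect_type k))).
- exact: (moment_sum_bound mchi ochi pk bound nperf).
Qed.
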